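(* Let $(\Sigma,\sigma)$ be a Riemannian manifold with Riemannian distance $d_\sigma$, and let $(\Sigma',\sigma')=(\mathbb{R}\times\Sigma,\,-dt^2\oplus\sigma)$ be the corresponding Lorentzian product, time oriented by $\partial_t$. Then $(\Sigma',\sigma')$ is a stably causal spacetime and the following statements hold: (i) $(\Sigma,d_\sigma)$ satisfies the Heine--Borel property (every closed and bounded subset of $\Sigma$ is compact) if and only if all causal diamonds $J^+(p)\cap J^-(q)$, $p,q\in\Sigma'$, of $(\Sigma',\sigma')$ are compact, i.e., if and only if $(\Sigma',\sigma')$ is globally hyperbolic. (ii) $(\Sigma,d_\sigma)$ is a complete metric space if and only if $(\Sigma',\hat d_t)$ is a complete metric space, where $\hat d_t$ is the null distance with respect to the canonical time function $t(p_0,p_\Sigma)=p_0$.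
   Context: Manifolds are smooth, paracompact, Hausdorff, connected, finite-dimensional, and without boundary. Lorentzian signature is $(+,\ldots,+,-)$. A spacetime is a Lorentzian manifold $(M,g)$ with a fixed continuous timelike vector field $X$ (time orientation). A vector $v\neq 0$ is timelike if $g(v,v)<0$, null if $g(v,v)=0$, and causal if it is timelike or null; a causal vector $v\in T_pM$ is future directed if $g_p(v,X(p))<0$ (past directed if $-v$ is future directed). A locally Lipschitz curve is future (past) directed causal if its tangent vector is so almost everywhere. Write $p\le q$ if $p=q$ or there is a future directed causal curve from $p$ to $q$; $p<q$ means $p\le q$ and $p\ne q$; $J^+(p)=\{q: p\le q\}$, $J^-(p)=\{q: q\le p\}$. A time function is a continuous function $\tau\colon M\to\mathbb{R}$ such that $p<q$ implies $\tau(p)<\tau(q)$. A spacetime is causal if it admits no closed causal curves, and stably causal if causality is a stable property of the metric (causality persists for some Lorentzian metric with strictly wider light cones), which is equivalent to the existence of a time function. A spacetime is globally hyperbolic if it is causal and all causal diamonds $J^+(p)\cap J^-(q)$ are compact. Null distance: a locally Lipschitz curve $\beta\colon[a,b]\to M$ is piecewise causal if there is a partition $a=a_0<\dots<a_k=b$ such that $\beta$ is either future directed causal or past directed causal on each $[a_{i-1},a_i]$. Its null length with respect to a time function $\tau$ is $\hat L_\tau(\beta)=\sum_{i=1}^k|\tau(\beta(a_i))-\tau(\beta(a_{i-1}))|$. The null distance is $\hat d_\tau(p,q)=\inf\{\hat L_\tau(\beta): \beta \text{ piecewise causal from } p \text{ to } q\}$ (and $\hat d_\tau(p,p)=0$).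 *)

(* Defs.v *)
From HB Require Import structures.
From mathcomp Require Import all_boot all_order all_algebra.
From mathcomp Require Import all_classical all_reals all_analysis.
Set Implicit Arguments.
Unset Strict Implicit.
Unset Printing Implicit Defensive.
Import Order.TTheory GRing.Theory Num.Theory.
Import numFieldNormedType.Exports.
Local Open Scope classical_set_scope.
Local Open Scope ring_scope.

(* A manifold modelled on a normed space E is a topological space M together
   with an indexed family of charts, among which one preferred chart
   [chart_at p] is singled out around each point p.  The tangent space T_pM is
   identified with E through [chart_at p]: a vector v : E, regarded as an
   element of T_pM, stands for the tangent vector whose components in the
   chart [chart_at p] are v.  Its components in any other chart are obtained
   by applying the differential of the transition map ([to_chart] below). *)

Section Topology.
Context (T : topologicalType).

Definition locally_finite (V : set (set T)) : Prop :=
  forall x : T, exists2 N : set T, nbhs x N &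
    finite_set [set B | V B /\ B `&` N !=set0].

Definition paracompact : Prop :=
  forall U : set (set T),
    (forall A, U A -> open A) -> \bigcup_(A in U) A = [set: T] ->
  exists V : set (set T),
    [/\ forall B, V B -> open B, \bigcup_(B in V) B = [set: T],
        forall B, V B -> exists2 A, U A & B `<=` A & locally_finite V].

End Topology.

Section MetricSpace.
Context (R : realType) (T : Type) (d : T -> T -> \bar R).
Local Open Scope ereal_scope.

Definition is_metric : Prop :=
  [/\ forall x y, d x y \is a fin_num,
      forall x y, 0 <= d x y,
      forall x y, d x y = 0 <-> x = y,
      forall x y, d x y = d y x &
      forall x y z, d x z <= d x y + d y z].

Definition cauchy_sequence (u : nat -> T) : Prop :=
  forall e : R, (0 < e)%R -> exists N : nat, forall m k : nat,
    (N <= m)%N -> (N <= k)%N -> d (u m) (u k) < e%:E.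

Definition converges_to (u : nat -> T) (l : T) : Prop :=
  forall e : R, (0 < e)%R -> exists N : nat, forall m : nat,
    (N <= m)%N -> d (u m) l < e%:E.

Definition complete_metric_space : Prop :=
  is_metric /\ forall u, cauchy_sequence u -> exists l, converges_to u l.

Definition metric_bounded (A : set T) : Prop :=
  exists r : R, forall x y, A x -> A y -> d x y <= r%:E.

End MetricSpace.

Section Smoothness.
Context (R : realType) (V W : normedModType R).

Fixpoint Ck (k : nat) (U : set V) (f : V -> W) : Prop :=
  match k with
  | 0 => forall x, U x -> {for x, continuous f}
  | k'.+1 => (forall x, U x -> differentiable f x) /\
             (forall v : V, Ck k' U (fun x => 'D_v f x))
  end.

Definition smooth_on (U : set V) (f : V -> W) : Prop := forall k, Ck k U f.

End Smoothness.

(* [phi i] and [psi i] are total functions; [phi i] is only meaningful on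
   [dom i], and [psi i], the inverse of the chart, on [phi i @` dom i]. *)
Record atlas (R : realType) (E : normedModType R) (M : topologicalType) :=
  Atlas {
    chart_index : Type;
    dom : chart_index -> set M;
    phi : chart_index -> M -> E;
    psi : chart_index -> E -> M;
    chart_at : M -> chart_index
  }.

Section Manifold.
Context (R : realType) (E : normedModType R) (M : topologicalType).
Variable A : atlas E M.

Definition is_chart (i : chart_index A) : Prop :=
  [/\ open (dom i), open (phi i @` dom i),
      forall p, dom i p -> psi i (phi i p) = p,
      {within dom i, continuous (phi i)} &
      {within phi i @` dom i, continuous (psi i)}].

Definition smooth_manifold : Prop :=
  [/\ hausdorff_space M, connected [set: M] & paracompact M] /\
  [/\ forall i, is_chart i,
      forall p, dom (chart_at A p) p &
      forall i j : chart_index A,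
        smooth_on (phi i @` (dom i `&` dom j)) (phi j \o psi i)].

Definition transition_diff (i j : chart_index A) (p : M) : E -> E :=
  'd (phi j \o psi i) (phi i p).

Definition to_chart (i : chart_index A) (p : M) : E -> E :=
  transition_diff (chart_at A p) i p.

Definition of_chart (i : chart_index A) (p : M) : E -> E :=
  transition_diff i (chart_at A p) p.

Definition symmetric_bilinear (b : E -> E -> R) : Prop :=
  (forall (c : R) u v w, b (c *: u + v) w = c * b u w + b v w) /\
  (forall u v, b u v = b v u).

(* [g p] is a bilinear form on T_pM, and smoothness is that of the components
   of g in every chart. *)
Definition smooth_metric_tensor (g : M -> E -> E -> R) : Prop :=
  (forall p, symmetric_bilinear (g p)) /\
  (forall (i : chart_index A) (u v : E),
     smooth_on (phi i @` dom i)
       (fun x : E => g (psi i x) (of_chart i (psi i x) u)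
                                 (of_chart i (psi i x) v) : R^o)).

Definition riemannian_metric (g : M -> E -> E -> R) : Prop :=
  smooth_metric_tensor g /\ forall p v, v != 0 -> 0 < g p v v.

(* Signature (+, ..., +, -): there is a basis in which the form is
   diag(1, ..., 1, -1). *)
Definition lorentzian_form (b : E -> E -> R) : Prop :=
  exists (m : nat) (e : 'I_m.+1 -> E),
    (forall v, exists c : 'I_m.+1 -> R, v = \sum_i c i *: e i) /\
    (forall i j, b (e i) (e j) =
       if i == j then (if i == ord_max then -1 else 1) else 0).

Definition lorentzian_metric (g : M -> E -> E -> R) : Prop :=
  smooth_metric_tensor g /\ forall p, lorentzian_form (g p).

Definition continuous_vector_field (X : M -> E) : Prop :=
  forall i : chart_index A,
    {within dom i, continuous (fun p => to_chart i p (X p))}.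

(* The velocity at time s of a curve, as an element of T_(c s)M. *)
Definition velocity (c : R -> M) (s : R) : E :=
  derive1 (phi (chart_at A (c s)) \o c : R^o -> E) s.

Definition interval_partition (a b : R) (k : nat) (s : nat -> R) : Prop :=
  [/\ (0 < k)%N, s 0%N = a, s k = b & forall i, (i < k)%N -> s i < s i.+1].

Definition C1_at (c : R -> M) (s : R) : Prop :=
  {for s, continuous c} /\
  exists2 N : set R, nbhs s N &
    Ck 1 (N : set R^o) (phi (chart_at A (c s)) \o c).

(* C^1 up to the end points, as the restriction of a C^1 curve defined around
   [a, b]. *)
Definition C1_curve (c : R -> M) (a b : R) : Prop :=
  exists c' : R -> M,
    forall s, s \in `[a, b] -> c' s = c s /\ C1_at c' s.

Definition piecewise_C1_curve (c : R -> M) (a b : R) : Prop :=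
  exists k s, interval_partition a b k s /\
    forall i, (i < k)%N -> C1_curve c (s i) (s i.+1).

Definition curve_length (g : M -> E -> E -> R) (c : R -> M) (a b : R) : \bar R :=
  (\int[lebesgue_measure]_(s in `[a, b])
     (Num.sqrt (g (c s) (velocity c s) (velocity c s)))%:E)%E.

Definition riemannian_distance (g : M -> E -> E -> R) (p q : M) : \bar R :=
  ereal_inf [set l | exists c a b,
    [/\ piecewise_C1_curve c a b, c a = p, c b = q & l = curve_length g c a b]].

Definition timelike (g : M -> E -> E -> R) (p : M) (v : E) : Prop :=
  v != 0 /\ g p v v < 0.

Definition null_vector (g : M -> E -> E -> R) (p : M) (v : E) : Prop :=
  v != 0 /\ g p v v = 0.

Definition causal_vector (g : M -> E -> E -> R) (p : M) (v : E) : Prop :=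
  timelike g p v \/ null_vector g p v.

Definition spacetime (g : M -> E -> E -> R) (X : M -> E) : Prop :=
  [/\ smooth_manifold, lorentzian_metric g, continuous_vector_field X &
      forall p, timelike g p (X p)].

Definition future_directed (g : M -> E -> E -> R) (X : M -> E) (p : M) (v : E) :
  Prop := causal_vector g p v /\ g p v (X p) < 0.

Definition past_directed (g : M -> E -> E -> R) (X : M -> E) (p : M) (v : E) :
  Prop := future_directed g X p (- v).

Definition locally_lipschitz_curve (c : R -> M) (a b : R) : Prop :=
  {within `[a, b], continuous c} /\
  forall s, s \in `[a, b] -> exists2 N : set R, nbhs s N &
    [lipschitz (phi (chart_at A (c s)) \o c : R^o -> E) t
      | t in (N `&` `[a, b] : set R^o)].

(* a < b is essential: a constant curve on a degenerate interval would
   otherwise count as a closed causal curve. *)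
Definition curve_directed_by (D : M -> E -> Prop) (c : R -> M) (a b : R) :
  Prop :=
  [/\ a < b, locally_lipschitz_curve c a b &
      {ae lebesgue_measure, forall s : R, s \in `]a, b[ ->
        derivable (phi (chart_at A (c s)) \o c : R^o -> E) s 1 /\
        D (c s) (velocity c s)}].

Definition future_causal_curve g X := curve_directed_by (future_directed g X).

Definition past_causal_curve g X := curve_directed_by (past_directed g X).

Definition causal_le g X (p q : M) : Prop :=
  p = q \/
  exists c a b, [/\ future_causal_curve g X c a b, c a = p & c b = q].

Definition causal_lt g X (p q : M) : Prop := causal_le g X p q /\ p <> q.

Definition causal_future g X (p : M) : set M := [set q | causal_le g X p q].

Definition causal_past g X (p : M) : set M := [set q | causal_le g X q p].

Definition causal_diamond g X (p q : M) : set M :=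
  causal_future g X p `&` causal_past g X q.

Definition time_function g X (tau : M -> R) : Prop :=
  continuous tau /\ forall p q, causal_lt g X p q -> tau p < tau q.

Definition causal g X : Prop :=
  ~ exists c a b, future_causal_curve g X c a b /\ c a = c b.

(* X, being timelike for g, is also timelike for h, and is kept as the time
   orientation of h. *)
Definition stably_causal (g : M -> E -> E -> R) (X : M -> E) : Prop :=
  exists h : M -> E -> E -> R,
    [/\ lorentzian_metric h,
        forall p v, causal_vector g p v -> timelike h p v &
        causal h X].

Definition globally_hyperbolic g X : Prop :=
  causal g X /\ forall p q, compact (causal_diamond g X p q).

Definition piecewise_causal_curve g X (c : R -> M) (a b : R) (k : nat)
    (s : nat -> R) : Prop :=
  [/\ interval_partition a b k s, locally_lipschitz_curve c a b &
      forall i, (i < k)%N ->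
        future_causal_curve g X c (s i) (s i.+1) \/
        past_causal_curve g X c (s i) (s i.+1)].

Definition null_length (tau : M -> R) (c : R -> M) (k : nat) (s : nat -> R) : R :=
  \sum_(i < k) `|tau (c (s i.+1)) - tau (c (s i))|.

Definition null_distance g X (tau : M -> R) (p q : M) : \bar R :=
  if `[< p = q >] then 0%E else
  ereal_inf [set l | exists c a b k s,
    [/\ piecewise_causal_curve g X c a b k s, c a = p, c b = q &
        l = (null_length tau c k s)%:E]].

(* Closedness and compactness refer to the manifold topology, which is the
   topology of the Riemannian distance. *)
Definition heine_borel (g : M -> E -> E -> R) : Prop :=
  forall B : set M, closed B -> metric_bounded (riemannian_distance g) B ->
    compact B.

End Manifold.

(* The Lorentzian product (R x S, - dt^2 + sigma), modelled on R x E.  The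
   charts are (t, x) |-> (t, phi i x), so T_(t, x)(R x S) = R x T_xS. *)
Section LorentzianProduct.
Context (R : realType) (E : normedModType R) (S : topologicalType).

Definition product_atlas (A : atlas E S) : atlas (R^o * E)%type (R^o * S)%type :=
  @Atlas R (R^o * E)%type (R^o * S)%type (chart_index A)
    (fun i => [set p | dom i p.2])
    (fun i p => (p.1, phi i p.2))
    (fun i x => (x.1, psi i x.2))
    (fun p => chart_at A p.2).

Definition product_metric (sigma : S -> E -> E -> R) :
    R^o * S -> R^o * E -> R^o * E -> R :=
  fun p u v => - (u.1 * v.1) + sigma p.2 u.2 v.2.

Definition partial_t : R^o * S -> R^o * E := fun=> (1, 0).

Definition time_coord : R^o * S -> R := fun p => p.1.

End LorentzianProduct.

(* Main.v *)
(* The coordinate expression of sigma is continuous, so in a chart around p the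
   length of a curve is, up to a factor close to 1, at least the norm sigma_p of
   the coordinate increment, with equality for coordinate segments.  Hence
   d_sigma is a metric inducing the manifold topology, and along a locally
   Lipschitz curve its upper derivative is at most the speed.  A locally
   Lipschitz function whose lower right derivative is almost everywhere
   nonnegative is nondecreasing; applied to t - d_sigma(p, .) along a causal
   curve this gives d_sigma(p, q) <= Delta t.  Conversely a curve of length less
   than Delta t, suitably parametrized, is the projection of a causal curve.  So
   causality is governed by d_sigma up to the boundary case d_sigma = Delta t,
   and the null distance is max(|Delta t|, d_sigma): take a causal curve rising
   by slightly more than this maximum and reflect its time component.  This
   gives (ii).
   Under the Heine-Borel property almost minimizing curves, which stay in a
   compact ball, have a 1-Lipschitz pointwise cluster point (Tychonoff), which is
   almost everywhere differentiable and is therefore the projection of a causal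
   curve; diamonds are then closed subsets of compact sets.  Conversely a closed
   bounded subset of the slice t = 0 lies in a diamond. *)
Require Import Defs.
From HB Require Import structures.
From mathcomp Require Import all_boot all_order all_algebra.
From mathcomp Require Import all_classical all_reals all_analysis.
From mathcomp Require Import finmap measurable_realfun ring lra.
Set Implicit Arguments.
Unset Strict Implicit.
Unset Printing Implicit Defensive.
Import Order.TTheory GRing.Theory Num.Theory.
Import numFieldNormedType.Exports.
Local Open Scope classical_set_scope.
Local Open Scope ring_scope.

(** * Monotonicity and differentiability of Lipschitz functions *)

Lemma real_induction (R : realType) (a b : R) (P : R -> Prop) :
  a <= b -> P a ->
  (forall x, a <= x < b -> (forall y, a <= y <= x -> P y) ->
     exists2 y, x < y & forall z, x < z <= y -> P z) ->
  (forall x, a < x <= b -> (forall y, a <= y < x -> P y) -> P x) -> P b.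
Proof.
move=> ab Pa Pr Pl.
pose E := [set x | a <= x <= b /\ forall y, a <= y <= x -> P y].
have Ea : E a.
  by split=> [|y]; [rewrite lexx ab|rewrite -eq_le => /eqP <-].
have ubE : ubound E b by move=> x [/andP[]].
have supE : has_sup E by split; [exists a|exists b].
pose m := sup E.
have am : a <= m by apply: sup_upper_bound.
have mb : m <= b by apply: sup_le_ub => //; exists a.
have lt_m y : a <= y < m -> P y.
  rewrite -subr_gt0 => /andP[ay ym].
  have [z [zE Pz] yz] := sup_adherent ym supE.
  by apply: Pz; rewrite ay /= ltW // (le_lt_trans _ yz)// subKr.
have Pm : P m.
  move: am; rewrite le_eqVlt => /predU1P[<-//|am]; apply: Pl => //.
  by rewrite am.
have le_m y : a <= y <= m -> P y.
  move=> /andP[ay]; rewrite le_eqVlt => /predU1P[->//|ym].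
  by apply: lt_m; rewrite ay.
have [<-//|mb'] := eqVneq m b.
have {}mb : m < b by rewrite lt_neqAle mb'.
have [||y my Py] := Pr m => //; first by rewrite am.
pose z := Num.min y b.
have : E z.
  split; first by rewrite le_min (le_trans am (ltW my)) (le_trans am (ltW mb)) ge_min lexx orbT.
  move=> u /andP[au uz]; have [um|mu] := leP u m; first by apply: le_m; rewrite au.
  by apply: Py; rewrite mu (le_trans uz)// ge_min lexx.
move=> /(sup_upper_bound supE); rewrite -/m leNgt /z lt_min my mb //.
Qed.

Lemma local_lower_lipschitz (R : realType) (f : R -> R) (a b : R) : a <= b ->
  (forall x, a <= x <= b -> exists K d, [/\ 0 <= K, 0 < d & forall y z,
     a <= y -> y <= z -> z <= b -> x - d < y -> z < x + d ->
     - (K * (z - y)) <= f z - f y]) ->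
  exists2 K, 0 <= K & forall y z, a <= y -> y <= z -> z <= b ->
    - (K * (z - y)) <= f z - f y.
Proof.
move=> ab floc.
pose P x := exists2 K, 0 <= K & forall y z, a <= y -> y <= z -> z <= x ->
  - (K * (z - y)) <= f z - f y.
have chain u v K K' : 0 <= K -> 0 <= K' -> v <= b ->
  (forall y z, a <= y -> y <= z -> z <= u -> - (K * (z - y)) <= f z - f y) ->
  (forall y z, u <= y -> y <= z -> z <= v -> - (K' * (z - y)) <= f z - f y) ->
  P v.
  move=> K0 K'0 vb H1 H2; exists (K + K'); first by rewrite addr_ge0.
  move=> y z ay yz zv.
  have [zu|uz] := leP z u; first by have := H1 _ _ ay yz zu; nra.
  have [uy|yu] := leP u y; first by have := H2 _ _ uy yz zv; nra.
  have := H1 _ _ ay (ltW yu) (lexx u).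
  have := H2 _ _ (lexx u) (ltW uz) zv; nra.
apply: (@real_induction _ a b P) => //.
- exists 0 => // y z ay yz za; have -> : y = z by apply/le_anti; lra.
  by rewrite !subrr mul0r oppr0.
- move=> x /andP[ax xb] /(_ x); rewrite lexx ax => /(_ isT) [K K0 HK].
  have [|K' [d [K'0 d0 H]]] := floc x; first by rewrite ax ltW.
  exists (Num.min (x + d / 2) b); first by rewrite lt_min xb andbT ltrDl divr_gt0.
  move=> z; rewrite le_min => /and3P[xz zd zb].
  apply: (chain x _ _ _ K0 K'0 zb HK) => u v xu uv vz.
  by apply: H; lra.
- move=> x /andP[ax xb] PP.
  have [|K' [d [K'0 d0 H]]] := floc x; first by rewrite xb ltW.
  pose y := Num.max a (x - d / 2).
  have yx : y < x by rewrite /y gt_max ax; lra.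
  have ay : a <= y by rewrite le_max lexx.
  have dy : x - d / 2 <= y by rewrite le_max lexx orbT.
  have [|K K0 HK] := PP y; first by rewrite ay.
  apply: (chain y _ _ _ K0 K'0 xb HK) => u v xu uv vz.
  by apply: H; lra.
Qed.

Section monotone.
Context (R : realType).
Notation mu := (@lebesgue_measure R).

Lemma nondecreasing_ae_dini (f : R -> R) (a b : R) : a <= b ->
  (forall x, a <= x <= b -> exists K d, [/\ 0 <= K, 0 < d & forall y z,
     a <= y -> y <= z -> z <= b -> x - d < y -> z < x + d ->
     - (K * (z - y)) <= f z - f y]) ->
  {ae mu, forall x, x \in `]a, b[ -> forall e, 0 < e ->
     exists2 d, 0 < d & forall y, x < y -> y < x + d ->
       - (e * (y - x)) <= f y - f x} ->
  f a <= f b.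
Proof.
move=> ab floc [N0' [mN' N0'0 NP']].
have [N [mN N0 NP]] : exists N : set R, [/\ measurable N, mu N = 0%E & ~` [set x |
    x \in `]a, b[ -> forall e, 0 < e -> exists2 d, 0 < d &
      forall y, x < y -> y < x + d -> - (e * (y - x)) <= f y - f x] `<=` N].
  by exists N0'.
move: mN' N0'0 NP' => _ _ _.
have [K K0 HK] := local_lower_lipschitz ab floc.
have main e : 0 < e -> f a - K * e - e * (b - a) <= f b.
  move=> e0.
  have mNa : measurable (N `|` [set a]) by exact: measurableU.
  have Na0 : mu (N `|` [set a]) = 0%E.
    by rewrite measureU0 //; exact: lebesgue_measure_set1.
  have Naoo : (mu (N `|` [set a]) < +oo)%E by rewrite Na0 ltry.
  have [W [Wo NW We]] := lebesgue_regularity_outer mNa Naoo e0.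
  have mO : measurable W by exact: open_measurable.
  have {}We : (mu W < e%:E)%E.
    have : (mu W <= mu (N `|` [set a]) + mu (W `\` (N `|` [set a])))%E.
      rewrite -[X in (mu X <= _)%E](setDUK NW).
      by apply: measureU2 => //; exact: measurableD.
    by rewrite Na0 add0e => /le_lt_trans; apply.
  pose g x : R := fine (mu (W `&` `[a, x])).
  have mOI x : measurable (W `&` `[a, x]) by exact: measurableI.
  have Ofin x : mu (W `&` `[a, x]) \is a fin_num.
    rewrite ge0_fin_numE //; apply: le_lt_trans (lt_trans We (ltry _)).
    by apply: le_measure; rewrite ?in_setE //; exact: mOI.
  have gnd x y : x <= y -> g x <= g y.
    move=> xy; apply: fine_le => //; apply: le_measure; rewrite ?in_setE; try exact: mOI.
    by apply: setIS; apply: subset_itvl; rewrite bnd_simp.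
  have ga0 : 0 <= g a by exact: fine_ge0.
  have gb : g b <= e.
    rewrite -lee_fin fineK//; apply: le_trans (ltW We).
    by apply: le_measure; rewrite ?in_setE //; exact: mOI.
  have gO x y : a <= x -> x <= y -> `]x, y] `<=` W -> y - x <= g y - g x.
    move=> ax xy xyO; rewrite lerBrDl -lee_fin EFinD /g !fineK //.
    have -> : (y - x)%:E = mu `]x, y].
      rewrite lebesgue_measure_itv /= lte_fin.
      by case: ltgtP xy => // -> _; rewrite subrr.
    rewrite -measureU //; [apply: le_measure; rewrite ?in_setE|exact: mOI|].
    - by apply: measurableU => //; exact: mOI.
    - exact: mOI.
    - move=> z [[Oz]|].
        by rewrite /= !in_itv /= => /andP[az zx]; split => //; rewrite az (le_trans zx).
      move=> zxy; split; first exact: xyO.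
      by move: zxy; rewrite /= !in_itv /= => /andP[xz ->]; rewrite (le_trans ax (ltW xz)).
    - apply/seteqP; split => // z [[_ /=]]; rewrite !in_itv /= => /andP[_ zx] /andP[xz _].
      by move: (le_lt_trans zx xz); rewrite ltxx.
  pose h x := f x + K * g x + e * (x - a).
  suff : h a <= h b by rewrite /h; nra.
  apply: (@real_induction _ a b (fun x => h a <= h x)) => //.
  - move=> x /andP[ax xb] /(_ x); rewrite lexx ax => /(_ isT) hx.
    have [xO|xO] := pselect (W x).
      have /nbhs_ballP[d /= d0 dO] := open_nbhs_nbhs (conj Wo xO).
      exists (Num.min b (x + d / 2)); first by rewrite lt_min xb ltrDl divr_gt0.
      move=> z; rewrite le_min => /and3P[xz zb zd]; apply: le_trans hx _; rewrite /h.
      have := HK _ _ ax (ltW xz) zb.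
      have : z - x <= g z - g x.
        apply: gO => //; first exact: ltW.
        move=> u /=; rewrite in_itv /= => /andP[xu uz]; apply: dO.
        by rewrite /ball /= distrC ger0_norm; lra.
      nra.
    have xN : ~ N x by move=> Nx; apply: xO; apply: NW; left.
    have {}ax : a < x.
      rewrite lt_neqAle ax andbT; apply/eqP => ax'; apply: xO; apply: NW; right.
      by rewrite /= ax'.
    have [d d0 Hd] : exists2 d, 0 < d & forall y, x < y -> y < x + d ->
        - (e * (y - x)) <= f y - f x.
      apply: contrapT => nD; apply: xN; apply: NP => /= D; apply: nD; apply: D => //.
      by rewrite in_itv /= ax.
    exists (x + d / 2); first by rewrite ltrDl divr_gt0.
    move=> z /andP[xz zd]; apply: le_trans hx _; rewrite /h.
    have := Hd z xz; have := gnd _ _ (ltW xz); nra.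
  - move=> x /andP[ax xb] PP; apply/ler_addgt0Pr => q q0.
    pose d := q / (K + 1).
    have d0 : 0 < d by rewrite divr_gt0// ltr_wpDl.
    pose y := Num.max a (x - d).
    have yx : y < x by rewrite /y gt_max ax; lra.
    have ay : a <= y by rewrite le_max lexx.
    have dy : x - d <= y by rewrite le_max lexx orbT.
    have := PP y; rewrite ay yx => /(_ isT) /le_trans; apply; rewrite /h.
    have := HK _ _ ay (ltW yx) xb; have := gnd _ _ (ltW yx).
    have : K * (x - y) <= q.
      apply: (@le_trans _ _ (K * d)); first by rewrite ler_wpM2l//; lra.
      have -> : q = (K + 1) * d by rewrite /d mulrC divfK// gt_eqF// ltr_wpDl.
      nra.
    nra.
apply/ler_addgt0Pr => q q0.
pose e := q / (K + (b - a) + 1).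
have D0 : 0 < K + (b - a) + 1 by rewrite ltr_wpDl// addr_ge0// subr_ge0.
have e0 : 0 < e by rewrite divr_gt0.
have := main e e0.
have : q = (K + (b - a) + 1) * e by rewrite /e mulrC divfK// gt_eqF.
nra.
Qed.

Lemma ae_itv_exists (a b : R) (P : R -> Prop) : a < b ->
  {ae mu, forall s, s \in `]a, b[ -> P s} -> exists2 s, s \in `]a, b[ & P s.
Proof.
move=> ab H; have [N [mN N0 HN]] : exists N : set R, [/\ measurable N,
    mu N = 0%E & ~` [set s | s \in `]a, b[ -> P s] `<=` N] := H.
apply: contrapT => nP.
have sub : `]a, b[%classic `<=` N.
  by move=> s sab; apply: HN => /= Ps; apply: nP; exists s => //; exact: Ps.
pose I : set R := `]a, b[%classic.
have mI : measurable I by exact: measurable_itv.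
have : (mu I <= mu N)%E.
  by apply: le_measure; rewrite ?in_setE.
rewrite /I lebesgue_measure_itv /= lte_fin ab N0 -EFinB lee_fin; lra.
Qed.

End monotone.

Section rademacher.
Context (R : realType).
Notation mu := (@lebesgue_measure R).

Lemma lipschitz_stieltjes_dominated (h : cumulative R R) (L : R) : 0 < L ->
  (forall x y, x <= y -> h y - h x <= L * (y - x)) ->
  forall A, mu A = 0%E -> lebesgue_stieltjes_measure h A = 0%E.
Proof.
move=> L0 hL A A0; apply/eqP; rewrite eq_le; apply/andP; split; last first.
  exact: mu_ext_ge0.
apply/lee_addgt0Pr => e e0; rewrite add0e.
have /ereal_inf_lt[_ [B [mB AB] <-] Be] : (mu A < (e / L)%:E)%E.
  by rewrite A0 lte_fin divr_gt0.
apply: (@le_trans _ _ (\sum_(0 <= k <oo) wlength h (B k))%E).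
  by apply: ereal_inf_lbound; exists B.
apply: (@le_trans _ _ (\sum_(0 <= k <oo) (L%:E * wlength idfun (B k)))%E).
  apply: lee_nneseries => [k _ _|k _]; first exact: wlength_ge0.
  have /ocitvP[->|[[x y] /= xy ->]] := mB k; first by rewrite !wlength0 mule0.
  by rewrite !wlength_itv_bnd ?(ltW xy)// lee_fin hL // ltW.
rewrite nneseriesZl => [|k _]; last exact: wlength_ge0.
apply: (@le_trans _ _ (L%:E * (e / L)%:E)%E).
  by apply: lee_wpmul2l; [rewrite lee_fin ltW|exact: ltW].
by rewrite -EFinM mulrC divfK ?gt_eqF.
Qed.

Lemma nondecreasing_lipschitz_ae_derivable (h : R -> R) (a b L : R) :
  a < b -> 0 < L -> (forall x y, x <= y -> h x <= h y) ->
  (forall x y, x <= y -> h y - h x <= L * (y - x)) ->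
  {ae mu, forall x, x \in `]a, b[ -> derivable h x 1}.
Proof.
move=> ab L0 hnd hL.
have hrc : right_continuous h.
  apply: right_continuousW => x; apply/cvgrPdist_le => e e0.
  near=> y; have [xy|yx] := leP x y.
    rewrite distrC ger0_norm ?subr_ge0 ?hnd//; apply: le_trans (hL _ _ xy) _.
    rewrite -ler_pdivlMl// mulrC -[leLHS]ger0_norm ?subr_ge0// distrC.
    by near: y; apply: (@cvgr_dist_le _ _ _ _ _ id); [exact: cvg_id|exact: divr_gt0].
  rewrite ger0_norm ?subr_ge0 ?hnd ?(ltW yx)//; apply: le_trans (hL _ _ (ltW yx)) _.
  rewrite -ler_pdivlMl// mulrC -[leLHS]ger0_norm ?subr_ge0 ?(ltW yx)//.
  by near: y; apply: (@cvgr_dist_le _ _ _ _ _ id); [exact: cvg_id|exact: divr_gt0].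
pose hm := isCumulative.Build R _ R h hnd hrc.
pose hc : cumulative R R := HB.pack h hm.
pose nu : {measure set (measurableTypeR R) -> \bar R} := lebesgue_stieltjes_measure hc.
have nuE x y : x <= y -> nu `]x, y]%classic = (h y - h x)%:E.
  move=> xy; transitivity (wlength hc `]x, y]%classic); last by rewrite wlength_itv_bnd.
  by apply: measurable_mu_extE; exact: is_ocitv.
have mI : measurable (`]a, b]%classic : set (measurableTypeR R)) by exact: measurable_itv.
have nuI : (nu `]a, b]%classic < +oo)%E by rewrite nuE ?ltry ?ltW.
pose nu' : {finite_measure set (measurableTypeR R) -> \bar R} := mfrestr mI nuI.
(* By Radon-Nikodym h is then, up to a constant, an indefinite integral. *)
have dom : nu' `<< mu.
  apply/null_content_dominatesP => A mA A0.
  apply: (@lipschitz_stieltjes_dominated hc L) => //.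
  apply/eqP; rewrite eq_le measure_ge0 andbT -A0; apply: le_measure; rewrite ?in_setE//.
  exact: measurableI.
have [g [g0 gfin gint gE]] := radon_nikodym_sigma_finite dom.
pose f := fine \o g.
have fE : EFin \o f = g by apply/funext => x /=; rewrite fineK.
have gi (K : set R) : measurable K -> mu.-integrable K g.
  by move=> mK; apply: integrableS gint.
have Fint y : mu.-integrable `]-oo, y] (EFin \o f) by rewrite fE; exact: gi.
have floc : locally_integrable [set: R] f.
  split; [|exact: openT|].
    apply/measurable_EFinP. rewrite fE; exact: (measurable_int _ gint).
  move=> K _ /compact_measurable mK.
  by have /integrableP[_] : mu.-integrable K (EFin \o f) by rewrite fE; exact: gi.
have := @FTC1Ny R f Fint floc; apply: filterS; first exact: (ae_filter_ringOfSetsType mu).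
move=> x [DF _].
rewrite in_itv /= => /andP[ax xb].
have : derivable (fun y : R => (\int[mu]_(t in [set` `]-oo, y]]) f t)%R + h a) x 1.
  by apply: derivableD => //; exact: derivable_cst.
apply: near_eq_derivable; near=> y.
have ay : a < y by near: y; exact: lt_nbhsr.
have yb : y < b by near: y; exact: lt_nbhsl.
suff -> : (\int[mu]_(t in [set` `]-oo, y]]) f t)%R = h y - h a by rewrite subrK.
rewrite /Rintegral; under eq_integral do rewrite -[(f _)%:E]/((EFin \o f) _) fE.
rewrite -gE //= /mfrestr /mrestr.
rewrite (_ : _ `&` _ = `]a, y]%classic) ?nuE ?ltW//.
apply/seteqP; split => z /=; rewrite !in_itv /=; first by move=> [-> /andP[->]].
by move=> /andP[-> zy]; split=> //; rewrite (le_trans zy (ltW yb)).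
Unshelve. all: by end_near. Qed.

Lemma lipschitz_ae_derivable (f : R -> R) (a b K : R) : a < b -> 0 <= K ->
  (forall x y, a <= x -> x <= y -> y <= b -> `|f y - f x| <= K * (y - x)) ->
  {ae mu, forall x, x \in `]a, b[ -> derivable f x 1}.
Proof.
move=> ab K0 fK.
(* Extended by constants and corrected by a linear term, f is nondecreasing. *)
pose c x := Num.max a (Num.min x b).
pose h x := f (c x) + (K + 1) * c x.
have cin x : a <= c x <= b.
  by rewrite /c le_max lexx /= ge_max (ltW ab) /= ge_min lexx orbT.
have cnd x y : x <= y -> c x <= c y /\ c y - c x <= y - x.
  rewrite /c /Num.max /Num.min => xy.
  by case: (ltP x b) => ?; case: (ltP y b) => ?; do ![case: ltP => ?]; split; lra.
have hf x y : x <= y -> `|f (c y) - f (c x)| <= K * (c y - c x).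
  by move=> xy; have [? ?] := cnd _ _ xy; apply: fK => //;
     [have /andP[] := cin x|have /andP[] := cin y].
have hnd x y : x <= y -> h x <= h y.
  move=> xy; have := hf _ _ xy; have [? ?] := cnd _ _ xy.
  rewrite /h ler_norml => /andP[]; nra.
have L0 : 0 < K + K + 1 by lra.
have hL x y : x <= y -> h y - h x <= (K + K + 1) * (y - x).
  move=> xy; have := hf _ _ xy; have [? ?] := cnd _ _ xy.
  rewrite /h ler_norml => /andP[]; nra.
have := nondecreasing_lipschitz_ae_derivable ab L0 hnd hL.
apply: filterS; first exact: (ae_filter_ringOfSetsType mu).
move=> x + xab => /(_ xab) dh.
move: xab; rewrite in_itv /= => /andP[ax xb].
have : derivable (fun y : R => h y - (K + 1) * y) x 1.
  exact: derivableB.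
apply: near_eq_derivable; near=> y.
have ay : a < y by near: y; exact: lt_nbhsr.
have yb : y < b by near: y; exact: lt_nbhsl.
rewrite /h (_ : c y = y) ?addrK// /c min_l ?max_r ?ltW//.
Unshelve. all: by end_near. Qed.

End rademacher.

Lemma within_itv_cvg (R : realType) (f : R -> R) (a b x e : R) :
  {within `[a, b], continuous f} -> a <= x <= b -> 0 < e ->
  exists2 d, 0 < d & forall y, a <= y <= b -> `|y - x| < d -> `|f y - f x| <= e.
Proof.
move=> cf xab e0.
have xI : (`[a, b]%classic : set R) x by rewrite /= in_itv.
move/subspace_continuousP : cf => /(_ _ xI) /cvgrPdist_le /(_ _ e0).
move=> /nbhs_ballP[d /= d0 Hd]; exists d => // y yab yx.
by rewrite distrC; apply: Hd; rewrite /= ?in_itv // /ball /= distrC.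
Qed.

Lemma count_lt_strict (R : realType) (D : seq R) (x z : R) : x \in D -> x < z ->
  (count (fun d => d < x)%R D < count (fun d => d < z)%R D)%N.
Proof.
move=> xD xz.
have mono (s : seq R) : (count (fun d => d < x)%R s <= count (fun d => d < z)%R s)%N.
  by apply: sub_count => d /= dx; exact: lt_trans xz.
elim: D xD => //= d D IH; rewrite inE => /predU1P[<-|/IH H].
  by rewrite ltxx xz add0n add1n ltnS.
rewrite -addnS; apply: leq_add H; case: ltP => //= dx.
by rewrite (lt_trans dx xz).
Qed.

Lemma nondecreasing_right_dini (R : realType) (f : R -> R) (a b : R) (D : seq R) :
  a <= b -> {within `[a, b], continuous f} ->
  (forall x, a <= x -> x < b -> x \notin D -> forall e, 0 < e ->
     exists2 d, 0 < d & forall y, x < y -> y < x + d -> y <= b ->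
       - (e * (y - x)) <= f y - f x) ->
  f a <= f b.
Proof.
move=> ab cf H; apply/ler_addgt0Pr => q q0.
pose m : R := (size D)%:R.
have m0 : 0 <= m by [].
pose e := q / (b - a + m + 1).
have D0 : 0 < b - a + m + 1 by rewrite ltr_wpDl // addr_ge0 // subr_ge0.
have e0 : 0 < e by rewrite divr_gt0.
(* The jumps of e * N pay for the exceptional points. *)
pose N (x : R) : R := (count (fun d => d < x) D)%:R.
have Nnd x y : x <= y -> N x <= N y.
  by move=> xy; rewrite ler_nat; apply: sub_count => d /= dx; exact: lt_le_trans xy.
suff : f a - e * (b - a) - e * N b <= f b.
  have : N b <= m by rewrite ler_nat count_size.
  have : q = (b - a + m + 1) * e by rewrite /e mulrC divfK // gt_eqF.
  nra.
apply: (@real_induction _ a b (fun x => f a - e * (x - a) - e * N x <= f x)) => //.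
- by rewrite subrr mulr0 subr0 gerBl mulr_ge0 // ltW.
- move=> x /andP[ax xb] /(_ x); rewrite lexx ax => /(_ isT) hx.
  have [xD|xD] := boolP (x \in D).
    have xab : a <= x <= b by rewrite ax ltW.
    have [d d0 Hd] := within_itv_cvg cf xab e0.
    exists (Num.min (x + d / 2) b); first by rewrite lt_min xb ltrDl divr_gt0.
    move=> z; rewrite le_min => /and3P[xz zd zb].
    have : N x + 1 <= N z.
      by rewrite /N natr1 ler_nat; exact: count_lt_strict.
    have := Hd z; rewrite (le_trans ax (ltW xz)) zb => /(_ isT).
    rewrite gtr0_norm ?subr_gt0 // => /(_ _).
    have zxd : z - x < d by lra.
    by move=> /(_ zxd); rewrite ler_norml => /andP[]; nra.
  have [d d0 Hd] := H x ax xb xD e e0.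
  exists (Num.min (x + d / 2) b); first by rewrite lt_min xb ltrDl divr_gt0.
  move=> z; rewrite le_min => /and3P[xz zd zb].
  by have := Hd z xz; have := Nnd x z (ltW xz); nra.
- move=> x /andP[ax xb] Hx; apply/ler_addgt0Pr => r r0.
  have xab : a <= x <= b by rewrite (ltW ax).
  have [d d0 Hd] := within_itv_cvg cf xab r0.
  pose y := Num.max a (x - d / 2).
  have yx : y < x by rewrite /y gt_max ax; lra.
  have ay : a <= y by rewrite le_max lexx.
  have dy : x - d / 2 <= y by rewrite le_max lexx orbT.
  have := Hx y; rewrite ay yx => /(_ isT).
  have yd : x - y < d by lra.
  have := Nnd y x (ltW yx).
  have := Hd y; rewrite ay (ltW (lt_le_trans yx xb)) => /(_ isT).
  by rewrite ltr0_norm ?subr_lt0 // opprB => /(_ yd); rewrite ler_norml => /andP[]; nra.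
Qed.

Lemma continuous_primitive (R : realType) (N : R -> R) (a b : R) : a < b ->
  continuous N -> exists h : R -> R,
    (forall s, a <= s <= b -> derivable h s 1 /\ h^`()%classic s = N s) /\
    (\int[lebesgue_measure]_(s in `[a, b]) (N s)%:E = (h b - h a)%:E)%E.
Proof.
move=> ab cN.
pose h s := (\int[lebesgue_measure]_(t in [set` `[a - 1, s]]) (N t))%R.
have Hh s : a <= s <= b -> derivable h s 1 /\ h^`()%classic s = N s.
  move=> /andP[as_ sb].
  apply: (@continuous_FTC1_closed _ N (a - 1) s (b + 1)).
  - lra.
  - apply: continuous_compact_integrable; first exact: segment_compact.
    exact: continuous_subspaceT.
  - lra.
  - exact: cN.
exists h; split => //.
apply: continuous_FTC2 => //; first exact: continuous_subspaceT.
- have ch x : a <= x <= b -> h x @[x --> x] --> h x.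
    move=> /Hh[dh _]; apply: differentiable_continuous; exact/derivable1_diffP.
  split.
  + by move=> x; rewrite in_itv /= => /andP[ax xb]; have [] := Hh x; rewrite ?ltW.
  + by apply: cvg_at_right_filter; apply: ch; rewrite lexx ltW.
  + by apply: cvg_at_left_filter; apply: ch; rewrite lexx ltW.
- by move=> x; rewrite in_itv /= => /andP[ax xb]; have [] := Hh x; rewrite ?ltW.
Qed.

(** * Products with a line *)

Lemma continuous_pair_at (T U V : topologicalType) (f : T -> U) (g : T -> V) x :
  {for x, continuous f} -> {for x, continuous g} ->
  {for x, continuous (fun y => (f y, g y))}.
Proof. by move=> cf cg; apply: (cvg_pair cf cg). Qed.

Lemma open_setM2 (T S : topologicalType) (A : set T) (B : set S) :
  open A -> open B -> open (A `*` B).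
Proof.
move=> Ao Bo; rewrite (_ : A `*` B = (fst @^-1` A) `&` (snd @^-1` B)) //.
by apply: openI; apply: open_comp => // -[x y] _; [exact: cvg_fst|exact: cvg_snd].
Qed.

Lemma tube_finite_cover (T : ptopologicalType) (S : topologicalType) (K : set T)
    (U : set (set (T * S))) (x : S) :
  compact K -> (forall A, U A -> open A) -> \bigcup_(A in U) A = setT ->
  exists W, [/\ open W, W x & exists D : set (set (T * S)),
    [/\ finite_set D, D `<=` U & K `*` W `<=` \bigcup_(A in D) A]].
Proof.
move=> cK Uo Ucov.
have H (t : T) : exists PA : set T * (set S * set (T * S)),
    [/\ open PA.1, PA.1 t, nbhs x PA.2.1, U PA.2.2 & PA.1 `*` PA.2.1 `<=` PA.2.2].
  have [A UA Atx] : (\bigcup_(A in U) A) (t, x) by rewrite Ucov.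
  have [[P Q] /= [nP nQ] PQA] := open_nbhs_nbhs (conj (Uo _ UA) Atx).
  exists (P°, (Q, A)); split => //=; first exact: open_interior.
  by apply: subset_trans PQA => -[u v] /= [/interior_subset Pu Qv].
have [f Hf] := choice H.
have := cK; rewrite compact_cover => /(_ T setT (fun t => (f t).1)).
case=> [t _|t Kt|F _ KF]; [by have [] := Hf t|by exists t => //; have [] := Hf t|].
exists ((\bigcap_(t in [set` F]) (f t).2.1)°); split.
- exact: open_interior.
- by apply: filter_bigI => t _; have [] := Hf t.
- exists ((fun t => (f t).2.2) @` [set` F]); split.
  + exact/finite_image/finite_fset.
  + by move=> _ [t _ <-]; have [] := Hf t.
  + move=> [t y] /= [Kt /interior_subset Wy].
    have [u Fu fut] := KF _ Kt; exists (f u).2.2; first by exists u.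
    by have [_ _ _ _] := Hf u; apply; split => //; exact: Wy.
Qed.

Lemma paracompact_prod_line (R : realType) (S : topologicalType) :
  paracompact S -> paracompact (R^o * S)%type.
Proof.
move=> pS U Uo Ucov.
pose K (n : nat) : set R^o := `[- n.+1%:R, n.+1%:R]%classic.
have cK n : compact (K n) by exact: segment_compact.
pose good n (W : set S) := open W /\ exists D : set (set (R^o * S)),
    [/\ finite_set D, D `<=` U & K n `*` W `<=` \bigcup_(A in D) A].
have Hn n : exists V : set (set S), [/\ forall B, V B -> open B,
    \bigcup_(B in V) B = setT, forall B, V B -> exists2 A, good n A & B `<=` A
    & locally_finite V].
  apply: pS => [A []//|]; apply/seteqP; split => // x _.
  have [W [Wo Wx HD]] := tube_finite_cover x (cK n) Uo Ucov.
  by exists W.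
have [V HV] := choice Hn.
have Dn (p : nat * set S) : exists D : set (set (R^o * S)), V p.1 p.2 ->
    [/\ finite_set D, D `<=` U & K p.1 `*` p.2 `<=` \bigcup_(A in D) A].
  have [Vp|] := pselect (V p.1 p.2); last by exists set0.
  have [_ _ Vref _] := HV p.1; have [A [_ [D [fD DU AD]]] pA] := Vref _ Vp.
  exists D => _; split => //; apply: subset_trans AD => -[t x] /= [Kt px].
  by split => //; exact: pA.
have [D HD] := choice Dn.
pose I (n : nat) : set R^o := (fun t : R^o => `|t|) @^-1` [set` `]n%:R - 1, n.+1%:R[].
have Io n : open (I n).
  by apply: open_comp; [move=> t _; exact: norm_continuous|exact: interval_open].
have IK n : I n `<=` K n.
  move=> t; rewrite /I /K /= !in_itv /= ltr_norml => /and3P[_ ? ?].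
  by apply/andP; split; exact: ltW.
pose C n B A : set (R^o * S) := (I n `*` B) `&` A.
exists [set X | exists n B A, [/\ V n B, D (n, B) A & X = C n B A]]; split.
- move=> _ [n [B [A [VB DA ->]]]]; apply: openI.
    by apply: open_setM2 => //; have [VO _ _ _] := HV n; exact: VO.
  by apply: Uo; have [_ DU _] := HD (n, B) VB; exact: DU.
- apply/seteqP; split => // -[t x] _.
  pose n := Num.truncn `|t|.
  have It : I n t.
    have /andP[h1 h2] := truncn_itv (normr_ge0 t).
    by rewrite /I /= in_itv /= h2 andbT (lt_le_trans _ h1)// ltrBlDr ltrDl.
  have [_ Vcov _ _] := HV n.
  have [B VB Bx] : (\bigcup_(B in V n) B) x by rewrite Vcov.
  have [_ _ /(_ (t, x))] := HD (n, B) VB; case=> [|A DA Atx].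
    by split => //; exact: IK.
  by exists (C n B A) => //; exists n, B, A.
- move=> _ [n [B [A [VB DA ->]]]]; exists A; last by move=> ? [].
  by have [_ DU _] := HD (n, B) VB; exact: DU.
- move=> [t x].
  pose m := (Num.truncn `|t|).+3.
  have /choice[N HN] (n : nat) : exists N, nbhs x N /\
      finite_set [set B | V n B /\ B `&` N !=set0].
    by have [_ _ _ /(_ x)[N ? ?]] := HV n; exists N.
  exists ([set s : R^o | `|s| < `|t| + 1] `*` \bigcap_(n in `I_m) N n).
    exists ([set s : R^o | `|s| < `|t| + 1], \bigcap_(n in `I_m) N n) => //; split => /=.
      have /cvgr_lt : (fun s : R^o => `|s|) @ t --> `|t| by exact: norm_continuous.
      by apply; rewrite ltrDl.
    have /finite_fsetP[F FE] := finite_II m; rewrite FE; apply: filter_bigI => n _.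
    by have [] := HN n.
  pose E n := [set B | V n B /\ B `&` N n !=set0].
  apply: (@sub_finite_set _ _ (\bigcup_(n in `I_m) \bigcup_(B in E n) (C n B @` D (n, B)))).
    move=> _ [[n [B [A [VB DA ->]]]] [[s y] /= [[[Is By] _] [st Ny]]]].
    have nm : `I_m n.
      rewrite /= /m -(ltr_nat R) -addn3 natrD.
      have /andP[_] := truncn_itv (normr_ge0 t); rewrite -natr1 /I /= in_itv /= in Is *; case/andP: Is; lra.
    exists n => //; exists B; last by exists A.
    by split => //; exists y; split => //; exact: Ny.
  apply: bigcup_finite => // n _; apply: bigcup_finite; first by have [] := HN n.
  by move=> B [VB _]; apply: finite_image; have [] := HD (n, B) VB.
Qed.

Lemma hausdorff_space_prod (T S : topologicalType) :
  hausdorff_space T -> hausdorff_space S -> hausdorff_space (T * S)%type.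
Proof.
move=> hT hS [t x] [s y] H; congr pair.
- apply: hT => A B nA nB; have [] := H (A `*` setT) (B `*` setT).
  + by exists (A, setT) => //; split => //; exact: filterT.
  + by exists (B, setT) => //; split => //; exact: filterT.
  + by move=> [u v] [[Au _] [Bu _]]; exists u.
- apply: hS => A B nA nB; have [] := H (setT `*` A) (setT `*` B).
  + by exists (setT, A) => //; split => //; exact: filterT.
  + by exists (setT, B) => //; split => //; exact: filterT.
  + by move=> [u v] [[_ Av] [_ Bv]]; exists v.
Qed.

Lemma connected_prod_line (R : realType) (S : topologicalType) :
  connected [set: S] -> connected [set: (R^o * S)%type].
Proof.
move=> cS.
have cl (t : R) : connected [set p : R^o * S | p.1 = t].
  rewrite (_ : [set _ | _] = (fun x : S => ((t : R^o), x)) @` setT); last first.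
    by apply/seteqP; split => [[u v] /= <-|_ [v _ <-]//]; exists v.
  apply: connected_continuous_connected => //.
  by apply: continuous_subspaceT => x; apply: continuous_pair_at; [exact: cvg_cst|exact: cvg_id].
have ch (x : S) : connected [set p : R^o * S | p.2 = x].
  rewrite (_ : [set _ | _] = (fun u : R^o => (u, x)) @` setT); last first.
    by apply/seteqP; split => [[u v] /= <-|_ [v _ <-]//]; exists u.
  apply: connected_continuous_connected.
    by apply/connected_intervalP => ? ? _ _ ? _.
  by apply: continuous_subspaceT => u; apply: continuous_pair_at; [exact: cvg_id|exact: cvg_cst].
have [[x0 _]|] := pselect ([set: S] !=set0); last first.
  move=> S0; rewrite (_ : [set: R^o * S] = set0); first exact: connected0.
  by apply/seteqP; split => // -[u v] _; apply: S0; exists v.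
rewrite (_ : [set: R^o * S] =
  \bigcup_(t in [set: R]) ([set p : R^o * S | p.2 = x0] `|` [set p : R^o * S | p.1 = t])); last first.
  by apply/seteqP; split => // -[t x] _; exists t => //; right.
apply: bigcup_connected.
  by exists (0, x0) => t _; left.
move=> t _; apply: connectedU => //; exists (t, x0); split => //.
Qed.

Section differentiability.
Context (R : realType) (V W : normedModType R).
Implicit Types f g : V -> W.

Lemma diff_eps f x (df : {linear V -> W}) : continuous df ->
  (forall e, 0 < e -> \forall h \near (0 : V), `|f (h + x) - (f x + df h)| <= e * `|h|) ->
  differentiable f x /\ 'd f x = df :> (V -> W).
Proof.
move=> cdf H.
have E : f \o shift x = cst (f x) + df +o_ (0 : V) id by apply/eqaddoP.
have D := diff_unique cdf E.
by split => //; apply/diff_locallyP; rewrite D.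
Qed.

Lemma differentiable_eps f x : differentiable f x ->
  forall e, 0 < e ->
    \forall h \near (0 : V), `|f (h + x) - (f x + 'd f x h)| <= e * `|h|.
Proof. by move=> /diff_locallyP[_ /eqaddoP]. Qed.

Lemma near_eq_differentiable f g x : {near x, f =1 g} ->
  differentiable f x -> differentiable g x /\ 'd g x = 'd f x :> (V -> W).
Proof.
move=> fg df; apply: diff_eps; first exact: diff_continuous.
move=> e e0; have := differentiable_eps df e0.
have fgx := nbhs_singleton fg.
have {}fg : \forall h \near (0 : V), f (h + x) = g (h + x).
  have : {for 0, continuous (fun h : V => h + x)}.
    by apply: continuousD; [exact: cvg_id|exact: cst_continuous].
  by rewrite /prop_for /continuous_at /= add0r => /(_ _ fg).
by apply: filterS2 fg => h ->; rewrite fgx.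
Qed.

Lemma eq_Ck k (U : set V) f g : open U -> (forall x, U x -> f x = g x) ->
  Ck k U f -> Ck k U g.
Proof.
move=> Uo.
have near_U h h' : (forall x, U x -> h x = h' x) -> forall x, U x -> {near x, h =1 h'}.
  move=> hh x Ux; have := open_nbhs_nbhs (conj Uo Ux).
  by apply: filterS => y; exact: hh.
elim: k f g => [|k IH] f g fg /=.
  move=> cf x Ux; rewrite /prop_for /continuous_at -fg//.
  by apply: cvg_trans (cf x Ux); apply: near_eq_cvg; apply: near_U => // y /fg.
move=> [df Hf]; split=> [x Ux|v].
  by have [] := near_eq_differentiable (near_U _ _ _ fg _ Ux) (df x Ux).
by apply: IH (Hf v) => x Ux; apply: near_eq_derive; exact: near_U.
Qed.

Lemma Ck_cst k (U : set V) (c : W) : Ck k U (fun=> c).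
Proof.
elim: k c => [|k IH] c /=; first by move=> x _; exact: cvg_cst.
split=> [x _|v]; first exact: differentiable_cst.
have -> : (fun x : V => 'D_v (fun=> c) x) = (fun=> 0 : W) by apply/funext => x; exact: derive_cst.
exact: IH.
Qed.

Lemma Ck_cstD k (U : set V) c f : open U -> Ck k U f -> Ck k U (fun x => c + f x).
Proof.
move=> Uo; case: k => [|k] /=.
  by move=> cf x /cf cfx; apply: cvgD => //; exact: cvg_cst.
move=> [df Hf]; split=> [x /df dfx|v].
  by apply: differentiableD => //; exact: differentiable_cst.
apply: eq_Ck (Hf v) => // x /df dfx.
rewrite (_ : (fun x => c + f x) = cst c + f) // deriveD //.
- by rewrite derive_cst add0r.
- exact: diff_derivable.
Qed.

End differentiability.

Section product_differentiability.
Context (R : realType) (V W W' : normedModType R).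

Lemma Ck_pair k (U : set V) (f : V -> W) (g : V -> W') : open U ->
  Ck k U f -> Ck k U g -> Ck k U (fun x => (f x, g x)).
Proof.
move=> Uo; elim: k f g => [|k IH] f g /=.
  by move=> cf cg x Ux; apply: continuous_pair_at; [exact: cf|exact: cg].
move=> [df Hf] [dg Hg]; split=> [x Ux|v].
  by apply: differentiable_pair; [exact: df|exact: dg].
apply: eq_Ck (IH _ _ (Hf v) (Hg v)) => // x Ux.
have dfx := df x Ux; have dgx := dg x Ux.
by rewrite !deriveE ?diff_pair//; exact: differentiable_pair.
Qed.

Lemma is_diff_fst (p : V * W) : is_diff p (fst : V * W -> V) fst.
Proof.
have lin_fst : linear (fst : V * W -> V) by move=> ???.
pose L := GRing.isLinear.Build _ _ _ _ _ lin_fst.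
pose fstL : {linear (V * W)%type -> V} := HB.pack (fst : V * W -> V) L.
have [? ?] : differentiable (fst : V * W -> V) p /\ 'd (fst : V * W -> V) p = fstL :> (_ -> _).
  apply: diff_eps => [q|e e0]; first exact: cvg_fst.
  near=> h; have -> : (h + p).1 - (p.1 + fstL h) = 0 by rewrite [(h + p).1]addrC; exact: subrr.
  by rewrite normr0 mulr_ge0 // ltW.
by apply: DiffDef.
Unshelve. all: by end_near. Qed.

Lemma is_diff_snd (p : V * W) : is_diff p (snd : V * W -> W) snd.
Proof.
have lin_snd : linear (snd : V * W -> W) by move=> ???.
pose L := GRing.isLinear.Build _ _ _ _ _ lin_snd.
pose sndL : {linear (V * W)%type -> W} := HB.pack (snd : V * W -> W) L.
have [? ?] : differentiable (snd : V * W -> W) p /\ 'd (snd : V * W -> W) p = sndL :> (_ -> _).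
  apply: diff_eps => [q|e e0]; first exact: cvg_snd.
  near=> h; have -> : (h + p).2 - (p.2 + sndL h) = 0 by rewrite [(h + p).2]addrC; exact: subrr.
  by rewrite normr0 mulr_ge0 // ltW.
by apply: DiffDef.
Unshelve. all: by end_near. Qed.

Lemma Ck_fst k (U : set (V * W)) : Ck k U (fst : V * W -> V).
Proof.
case: k => [|k] /=; first by move=> p _; exact: cvg_fst.
have D p := is_diff_fst p.
split=> [p _|v]; first by have [] := D p.
have -> : (fun p : V * W => 'D_v fst p) = (fun=> v.1); last exact: Ck_cst.
by apply/funext => p; rewrite deriveE ?(diff_val (is_diff_def := D p))//; have [] := D p.
Qed.

Lemma diff_comp_snd (f : W -> W') (p : (V * W)%type) : differentiable f (p.2) ->
  differentiable (f \o snd) p /\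
  'd (f \o snd) p = (fun h => 'd f (p.2) h.2) :> (V * W -> W').
Proof.
move=> df; have [ds Ds] := is_diff_snd p.
by split; [exact: differentiable_comp|rewrite diff_comp// Ds].
Qed.

Lemma Ck_comp_snd k (U : set W) (f : W -> W') : open U ->
  Ck k U f -> Ck k [set p : V * W | U p.2] (f \o snd).
Proof.
move=> Uo.
have Uo' : open [set p : V * W | U p.2].
  rewrite (_ : [set _ | _] = setT `*` U); first exact/open_setM2/Uo/openT.
  by apply/seteqP; split => [[u v] //=|[u v] []].
elim: k f => [|k IH] f /=.
  by move=> cf p Up; apply: continuous_comp; [exact: cvg_snd|exact: cf].
move=> [df Hf]; split=> [p /df/diff_comp_snd[]//|v].
exact: eq_Ck (IH _ (Hf v.2)).
Qed.

End product_differentiability.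

Lemma within_open_continuous (T U : topologicalType) (D : set T) (f : T -> U) :
  open D -> ({within D, continuous f} <-> forall x, D x -> {for x, continuous f}).
Proof.
move=> Do; rewrite continuous_open_subspace //; split=> H x.
  by move=> Dx; apply: H; exact: mem_set.
by move=> /set_mem; exact: H.
Qed.

Section charts.
Context (R : realType) (E : normedModType R) (S : topologicalType) (A : atlas E S).

Lemma open_chart_image (i : chart_index A) (U : set S) :
  is_chart i -> open U -> U `<=` dom i -> open (phi i @` U).
Proof.
move=> [_ oi K _ cpsi] Uo UD; have {}cpsi := (within_open_continuous _ oi).1 cpsi.
rewrite openE => _ [p Up <-]; rewrite /interior.
have pi : (phi i @` dom i) (phi i p) by exists p => //; exact: UD.
have nU : nbhs (psi i (phi i p)) U.
  by rewrite K; [exact: open_nbhs_nbhs|exact: UD].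
have := cpsi _ pi _ nU; have := open_nbhs_nbhs (conj oi pi).
apply: filterS2 => x [q Dq <-]; rewrite /= K// => Uq; by exists q.
Qed.

End charts.

Section product_manifold.
Context (R : realType) (E : normedModType R) (S : topologicalType) (A : atlas E S).
Notation A' := (product_atlas A).

Lemma open_preimage_snd (T : topologicalType) (U : set T) :
  open U -> open [set p : R^o * T | U p.2].
Proof. by move=> Uo; apply: (open_comp _ Uo) => -[x y] _; exact: cvg_snd. Qed.

Lemma product_chart_image (i : chart_index A) (U : set S) :
  @phi _ _ _ A' i @` [set p : R^o * S | U p.2] = [set x : R^o * E | (phi i @` U) x.2].
Proof.
apply/seteqP; split => [_ [p Up <-]|[t x] /= [p Up <-]]; first by exists p.2.
by exists (t, p).
Qed.

Lemma product_is_chart (i : chart_index A) : is_chart i -> @is_chart _ _ _ A' i.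
Proof.
move=> [oD oI K cphi cpsi].
have cph := (within_open_continuous _ oD).1 cphi.
have cps := (within_open_continuous _ oI).1 cpsi.
have oD' : open (@dom _ _ _ A' i) by exact: open_preimage_snd.
have oI' : open (@phi _ _ _ A' i @` @dom _ _ _ A' i).
  by rewrite product_chart_image; exact: open_preimage_snd.
split => //.
- by move=> [t p] /= Dp; rewrite K.
- apply/within_open_continuous => // -[t p] /= Dp.
  apply: (@continuous_pair_at (R^o * S)%type R^o E fst (phi i \o snd)); first exact: cvg_fst.
  by apply: continuous_comp; [exact: cvg_snd|exact: cph].
- apply/within_open_continuous => // -[t x]; rewrite product_chart_image /= => Ix.
  apply: (@continuous_pair_at (R^o * E)%type R^o S fst (psi i \o snd)); first exact: cvg_fst.
  by apply: continuous_comp; [exact: cvg_snd|exact: cps].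
Qed.

Hypothesis hS : smooth_manifold A.

Lemma open_transition_domain (i j : chart_index A) :
  open (phi i @` (dom i `&` dom j)).
Proof.
have [_ [hc _ _]] := hS; have [oi _ _ _ _] := hc i; have [oj _ _ _ _] := hc j.
apply: open_chart_image; [exact: hc|exact: openI|exact: subIsetl].
Qed.

Lemma product_smooth_manifold : smooth_manifold A'.
Proof.
have [[hausS connS parS] [hc cat tr]] := hS; split; split.
- exact: (hausdorff_space_prod (@norm_hausdorff _ R^o) hausS).
- exact: connected_prod_line.
- exact: paracompact_prod_line.
- by move=> i; exact/product_is_chart/hc.
- by move=> p; exact: cat.
- move=> i j k; rewrite (product_chart_image i (@dom _ _ _ A i `&` @dom _ _ _ A j)).
  have oU := open_transition_domain i j.
  apply: (@Ck_pair R (R^o * E)%type R^o E k _ fst ((@phi _ _ _ A j \o @psi _ _ _ A i) \o snd)).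
  + exact: open_preimage_snd.
  + exact: Ck_fst.
  + by apply: Ck_comp_snd => //; exact: tr.
Qed.

Lemma transition_differentiable (i j : chart_index A) (p : S) :
  dom i p -> dom j p -> differentiable (phi j \o psi i) (phi i p).
Proof.
move=> ip jp; have [_ [_ _ tr]] := hS; have [+ _] := tr i j 1%N.
by apply; exists p.
Qed.

Lemma product_transition_diff (i j : chart_index A) (p : R^o * S) u :
  dom i p.2 -> dom j p.2 ->
  @transition_diff _ _ _ A' i j p u = (u.1, transition_diff i j p.2 u.2).
Proof.
move=> ip jp; rewrite /transition_diff.
have [d1 D1] := is_diff_fst (@phi _ _ _ A' i p).
have d2 := transition_differentiable ip jp.
have [d3 D3] := @diff_comp_snd _ R^o _ _ (@phi _ _ _ A j \o @psi _ _ _ A i) (@phi _ _ _ A' i p) d2.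
have := diff_pair d1 d3; rewrite D1 D3 => ->//.
Qed.

Lemma product_of_chart (i : chart_index A) (p : R^o * S) u : dom i p.2 ->
  @of_chart _ _ _ A' i p u = (u.1, of_chart i p.2 u.2).
Proof. by move=> ip; have [_ [_ cat _]] := hS; apply: product_transition_diff; [exact: ip|exact: cat]. Qed.

Lemma product_to_chart (i : chart_index A) (p : R^o * S) u : dom i p.2 ->
  @to_chart _ _ _ A' i p u = (u.1, to_chart i p.2 u.2).
Proof. by move=> ip; have [_ [_ cat _]] := hS; apply: product_transition_diff; [exact: cat|exact: ip]. Qed.

Lemma to_chart0 (i : chart_index A) (p : S) : to_chart i p 0 = 0.
Proof. by rewrite /to_chart /transition_diff linear0. Qed.

End product_manifold.

Section orthonormal.
Context (R : realType) (n : nat) (b : 'rV[R]_n -> 'rV[R]_n -> R).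
Hypothesis bsym : symmetric_bilinear b.
Hypothesis bpos : forall v, v != 0 -> 0 < b v v.

Lemma sbfPl c u v w : b (c *: u + v) w = c * b u w + b v w.
Proof. by have [+ _] := bsym; apply. Qed.

Lemma sbfC u v : b u v = b v u.
Proof. by have [_ +] := bsym; apply. Qed.

Lemma sbf0l w : b 0 w = 0.
Proof. by have := sbfPl 1 0 0 w; rewrite scale1r addr0 mul1r => /eqP; rewrite -subr_eq subrr => /eqP. Qed.

Lemma sbfDl u v w : b (u + v) w = b u w + b v w.
Proof. by rewrite -[u]scale1r sbfPl mul1r scale1r. Qed.

Lemma sbfZl c u w : b (c *: u) w = c * b u w.
Proof. by rewrite -[c *: u]addr0 sbfPl sbf0l addr0. Qed.

Lemma sbfZr c u w : b u (c *: w) = c * b u w.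
Proof. by rewrite sbfC sbfZl sbfC. Qed.

Lemma sbfDr u v w : b u (v + w) = b u v + b u w.
Proof. by rewrite sbfC sbfDl !(sbfC _ u). Qed.

Lemma sbf_suml (I : Type) (r : seq I) (P : pred I) (F : I -> 'rV[R]_n) w :
  b (\sum_(i <- r | P i) F i) w = \sum_(i <- r | P i) b (F i) w.
Proof. by elim/big_ind2: _ => [|x y u v <- <-|//]; rewrite ?sbf0l ?sbfDl. Qed.

Lemma orthonormal_family m : (m <= n)%N -> exists e : nat -> 'rV[R]_n,
  forall i j, (i < m)%N -> (j < m)%N -> b (e i) (e j) = (i == j)%:R.
Proof.
elim: m => [_|m IH mn]; first by exists (fun=> 0).
have [e He] := IH (ltnW mn).
pose M : 'M[R]_(m, n) := \matrix_(i < m) e i.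
have [v vM] : exists v : 'rV[R]_n, ~~ (v <= M)%MS.
  apply: contrapT => H.
  have : (1%:M <= M)%MS.
    apply/row_subP => i; apply: contrapT => /negP Hi; apply: H.
    by exists (row i 1%:M).
  rewrite sub1mx /row_full => /eqP rM; have := rank_leq_row M.
  by rewrite rM leqNgt mn.
pose w := v - \sum_(i < m) b v (e i) *: e i.
have w0 : w != 0.
  apply: contra vM; rewrite subr_eq0 => /eqP ->.
  apply: summx_sub => i _; apply: scalemx_sub.
  by rewrite (_ : e i = row i M) ?row_sub // rowK.
have we j : (j < m)%N -> b w (e j) = 0.
  move=> jm; rewrite /w sbfDl -scaleN1r sbfZl sbf_suml.
  rewrite (bigD1 (Ordinal jm)) //= sbfZl He // eqxx big1 ?addr0 => [|i].
    by rewrite mulr1 mulN1r subrr.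
  by rewrite -val_eqE /= => ij; rewrite sbfZl He // (negbTE ij) mulr0.
have bw := bpos w0; have sw : Num.sqrt (b w w) != 0 by rewrite gt_eqF// sqrtr_gt0.
exists (fun i => if i == m then (Num.sqrt (b w w))^-1 *: w else e i) => i j.
rewrite !ltnS => im jm.
have lt k : (k <= m)%N -> k != m -> (k < m)%N by rewrite ltn_neqAle => -> ->.
have [im'|nim] := eqVneq i m; have [jm'|njm] := eqVneq j m.
- rewrite im' jm' eqxx sbfZl sbfZr -[X in _ * (_ * X)]sqr_sqrtr ?ltW//.
  by rewrite expr2 mulKf// mulVf.
- by rewrite im' eq_sym (negbTE njm) sbfZl we ?mulr0 // lt.
- by rewrite jm' (negbTE nim) sbfC sbfZl we ?mulr0 // lt.
- by apply: He; exact: lt.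
Qed.

Lemma orthonormal_basis : exists e : 'I_n -> 'rV[R]_n,
  (forall i j, b (e i) (e j) = (i == j)%:R) /\
  forall v, exists c : 'I_n -> R, v = \sum_i c i *: e i.
Proof.
have [e He] := orthonormal_family (leqnn n).
exists (fun i => e i); split=> [i j|v]; first by rewrite He.
pose M : 'M[R]_n := \matrix_(i < n) e i.
have Mfree : row_free M.
  rewrite -kermx_eq0; apply/eqP/row_matrixP => i; rewrite row0.
  set c := row i _; have cM : c *m M = 0 by apply/sub_kermxP; exact: row_sub.
  apply/rowP => j; rewrite [RHS]mxE.
  have : b (c *m M) (e j) = c 0 j.
    rewrite mulmx_sum_row sbf_suml (bigD1 j) //= rowK sbfZl He // eqxx mulr1.
    rewrite big1 ?addr0 // => k kj; rewrite rowK sbfZl He //.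
    by rewrite (_ : (k : nat) == j = false) ?mulr0 //; apply/negbTE.
  by rewrite cM sbf0l => <-.
have : (v <= M)%MS by apply: submx_full; rewrite row_full_unit -row_free_unit.
move=> /submxP[c ->]; exists (fun i => c 0 i).
by rewrite mulmx_sum_row; apply: eq_bigr => i _; rewrite rowK.
Qed.

End orthonormal.

Section product_spacetime.
Context (R : realType) (n : nat) (S : topologicalType).
Notation E := 'rV[R]_n.
Context (A : atlas E S) (sigma : S -> E -> E -> R).
Hypotheses (hS : smooth_manifold A) (hsigma : riemannian_metric A sigma).
Notation A' := (product_atlas A).

Definition scaled_product_metric (k : R) : R^o * S -> R^o * E -> R^o * E -> R :=
  fun p u v => - (k * (u.1 * v.1)) + sigma p.2 u.2 v.2.

Lemma product_metricE : product_metric sigma = scaled_product_metric 1.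
Proof.
by apply/funext => p; apply/funext => u; apply/funext => v;
  rewrite /scaled_product_metric mul1r.
Qed.

Lemma scaled_product_lorentzian k : 0 < k -> lorentzian_metric A' (scaled_product_metric k).
Proof.
move=> k0; have [[ssym ssm] spos] := hsigma; split.
  split=> [p|i u v].
    have [sl sc] := ssym p.2; rewrite /scaled_product_metric; split=> [c u v w|u v].
      rewrite sl /=; change (c *: u.1) with (c * u.1); ring.
    by rewrite (mulrC u.1) sc.
  move=> m; rewrite (@product_chart_image _ _ _ A i (@dom _ _ _ A i)).
  have [_ [hc _ _]] := hS; have [_ oI K _ _] := hc i.
  have := @Ck_comp_snd _ R^o _ _ m _ _ oI (ssm i u.2 v.2 m).
  move=> /(Ck_cstD (- (k * (u.1 * v.1)) : R^o) (open_preimage_snd oI)).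
  apply: eq_Ck => [|[t x] /= [p ip px]]; first exact: open_preimage_snd.
  by rewrite /scaled_product_metric /= !product_of_chart //= -px K.
move=> p; have [sl sc] := ssym p.2.
have [e [eo eb]] := orthonormal_basis (ssym p.2) (spos p.2).
pose e' (i : 'I_n.+1) : R^o * E :=
  if unlift ord_max i is Some j then (0, e j) else ((Num.sqrt k)^-1, 0).
have sk0 : Num.sqrt k != 0 by rewrite gt_eqF ?sqrtr_gt0.
exists n, e'; split=> [[v1 v2]|i j].
  have [c ->] := eb v2.
  exists (fun i => if unlift ord_max i is Some j then c j else Num.sqrt k * v1).
  rewrite big_ord_recr /= /e' unlift_none.
  have L i : unlift ord_max (widen_ord (leqnSn n) i) = Some i.
    rewrite (_ : widen_ord _ i = lift ord_max i) ?liftK //.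
    by apply/val_inj; rewrite /= /bump leqNgt ltn_ord.
  under [X in _ = X + _]eq_bigr => i _ do rewrite L.
  have fst_sum (F : 'I_n -> R^o * E) : (\sum_i F i).1 = \sum_i (F i).1.
    by elim/big_ind2: _ => [//|x u y v <- <- //|//].
  have snd_sum (F : 'I_n -> R^o * E) : (\sum_i F i).2 = \sum_i (F i).2.
    by elim/big_ind2: _ => [//|x u y v <- <- //|//].
  apply: injective_projections.
    rewrite [RHS]/= fst_sum [X in _ = X + _]big1 ?add0r => [|i _]; last exact: scaler0.
    by rewrite [_ *: _]mulrAC mulfV ?mul1r.
  by rewrite [RHS]/= snd_sum scaler0 addr0.
rewrite /scaled_product_metric /e'.
case: (unliftP ord_max i) => [i'|] ->; case: (unliftP ord_max j) => [j'|] ->;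
  rewrite ?liftK ?unlift_none /=.
- rewrite mul0r mulr0 oppr0 add0r eo (inj_eq lift_inj).
  by case: eqVneq => // _; rewrite eq_sym (negbTE (neq_lift _ _)).
- rewrite mul0r mulr0 oppr0 add0r (sbfC (ssym p.2)) (sbf0l (ssym p.2)).
  by rewrite eq_sym (negbTE (neq_lift _ _)).
- by rewrite mulr0 mulr0 oppr0 add0r (sbf0l (ssym p.2)) (negbTE (neq_lift _ _)).
- rewrite eqxx (sbf0l (ssym p.2)) addr0 -invfM -expr2 sqr_sqrtr ?ltW//.
  by rewrite mulfV ?gt_eqF.
Qed.

Lemma product_spacetime : spacetime A' (product_metric sigma) (@partial_t R E S).
Proof.
split.
- exact: product_smooth_manifold.
- by rewrite product_metricE; exact: scaled_product_lorentzian.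
- move=> i; have [_ [hc _ _]] := hS; have [oD _ _ _ _] := product_is_chart (hc i).
  apply/within_open_continuous => // p Dp.
  rewrite /prop_for /continuous_at product_to_chart // to_chart0.
  apply: cvg_near_cst.
  have := open_nbhs_nbhs (conj oD Dp).
  by apply: filterS => q Dq; rewrite product_to_chart // to_chart0.
- move=> p; split; first by apply/eqP => -[/eqP]; rewrite oner_eq0.
  have [[ssym _] _] := hsigma.
  by rewrite /product_metric /= (sbf0l (ssym p.2)) addr0 mulr1 oppr_lt0.
Qed.

End product_spacetime.

(** * Length of curves in charts *)

Section form_norm.
Context (R : realType) (n : nat) (b : 'rV[R]_n -> 'rV[R]_n -> R).
Hypothesis bsym : symmetric_bilinear b.
Hypothesis bpos : forall v, v != 0 -> 0 < b v v.

Definition form_norm (v : 'rV[R]_n) : R := Num.sqrt (b v v).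

Lemma form_ge0 v : 0 <= b v v.
Proof. by have [->|/bpos/ltW//] := eqVneq v 0; rewrite (sbf0l bsym). Qed.

Lemma sqr_form_norm v : form_norm v ^+ 2 = b v v.
Proof. by rewrite sqr_sqrtr ?form_ge0. Qed.

Lemma form_norm_ge0 v : 0 <= form_norm v.
Proof. exact: sqrtr_ge0. Qed.

Lemma form_norm0 : form_norm 0 = 0.
Proof. by rewrite /form_norm (sbf0l bsym) sqrtr0. Qed.

Lemma form_normZ c v : form_norm (c *: v) = `|c| * form_norm v.
Proof.
rewrite /form_norm (sbfZl bsym) (sbfZr bsym) mulrA -expr2.
by rewrite sqrtrM ?sqr_ge0 // sqrtr_sqr.
Qed.

Lemma form_cauchy_schwarz u v : b u v <= form_norm u * form_norm v.
Proof.
have [->|v0] := eqVneq v 0.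
  by rewrite (sbfC bsym) (sbf0l bsym) form_norm0 mulr0.
have bv := bpos v0; set t := b u v / b v v.
have := form_ge0 (u + (- t) *: v).
rewrite (sbfDl bsym) !(sbfDr bsym) !(sbfZl bsym) !(sbfZr bsym) (sbfC bsym v u) => H.
have {}H : b u v ^+ 2 <= b u u * b v v.
  have tE : t * b v v = b u v by rewrite divfK ?gt_eqF.
  have : 0 <= (b u u - t * b u v) * b v v by apply: mulr_ge0; [nra|exact: ltW].
  by rewrite mulrBl mulrAC tE -expr2 subr_ge0.
apply: le_trans (ler_norm _) _.
by rewrite -sqrtr_sqr -sqrtrM ?form_ge0 // ler_wsqrtr.
Qed.

Lemma form_normD u v : form_norm (u + v) <= form_norm u + form_norm v.
Proof.
rewrite -[leRHS]ger0_norm ?addr_ge0 ?form_norm_ge0 // -sqrtr_sqr.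
rewrite {1}/form_norm ler_wsqrtr // (sbfDl bsym) !(sbfDr bsym).
have := form_cauchy_schwarz u v; rewrite sqrrD !sqr_form_norm (sbfC bsym v u); nra.
Qed.

Lemma form_normN v : form_norm (- v) = form_norm v.
Proof. by rewrite -scaleN1r form_normZ normrN1 mul1r. Qed.

Lemma form_norm_distD u v w : form_norm (u - w) <= form_norm (u - v) + form_norm (v - w).
Proof. by apply: le_trans (form_normD _ _); rewrite addrA subrK. Qed.

Lemma form_expansion u v :
  b u v = \sum_i \sum_j u 0 i * v 0 j * b (delta_mx 0 i) (delta_mx 0 j).
Proof.
rewrite {1}(row_sum_delta u) (sbf_suml bsym); apply: eq_bigr => i _.
rewrite (sbfZl bsym) (sbfC bsym) {1}(row_sum_delta v) (sbf_suml bsym) mulr_sumr.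
by apply: eq_bigr => j _; rewrite (sbfZl bsym) (sbfC bsym) mulrA.
Qed.

Lemma rV_coord_le (v : 'rV[R]_n) i : `|v 0 i| <= `|v|.
Proof.
rewrite -[leRHS]/(mx_norm v) mx_normrE.
exact: (le_bigmax _ (fun ij : 'I_1 * 'I_n => `|v ij.1 ij.2|) (0, i)).
Qed.

Lemma form_norm_upper : exists2 C, 0 < C & forall v, form_norm v <= C * `|v|.
Proof.
pose C2 := \sum_i \sum_j `|b (delta_mx 0 i) (delta_mx 0 j)|.
have C20 : 0 <= C2 by apply: sumr_ge0 => i _; apply: sumr_ge0.
exists (Num.sqrt C2 + 1); first by rewrite ltr_wpDl ?sqrtr_ge0.
move=> v; apply: (@le_trans _ _ (Num.sqrt C2 * `|v|)); last by rewrite ler_wpM2r // lerDl.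
rewrite -[X in _ * X]ger0_norm // -sqrtr_sqr -sqrtrM // ler_wsqrtr // form_expansion.
rewrite mulr_suml; apply: ler_sum => i _; rewrite mulr_suml; apply: ler_sum => j _.
apply: le_trans (ler_norm _) _; rewrite normrM mulrC ler_wpM2l // normrM expr2.
by apply: ler_pM => //; exact: rV_coord_le.
Qed.

Lemma form_norm_lower : exists2 C, 0 < C & forall v, `|v| <= C * form_norm v.
Proof.
have [e [eo eb]] := orthonormal_basis bsym bpos.
exists (\sum_i `|e i| + 1); first by rewrite ltr_wpDl ?sumr_ge0.
move=> v; apply: (@le_trans _ _ ((\sum_i `|e i|) * form_norm v)); last first.
  by rewrite ler_wpM2r ?form_norm_ge0 // lerDl.
have [c vE] := eb v.
have cE i : `|c i| <= form_norm v.
  have cb : b v (e i) = c i.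
    rewrite vE (sbf_suml bsym) (bigD1 i) //= (sbfZl bsym) eo eqxx mulr1.
    by rewrite big1 ?addr0 // => j ji; rewrite (sbfZl bsym) eo (negbTE ji) mulr0.
  have ei1 : form_norm (e i) = 1 by rewrite /form_norm eo eqxx sqrtr1.
  have h1 := form_cauchy_schwarz v (e i).
  have := form_cauchy_schwarz (- v) (e i); rewrite form_normN -scaleN1r (sbfZl bsym).
  by rewrite ei1 cb in h1 *; rewrite ler_norml; lra.
rewrite {1}vE mulr_suml; apply: le_trans (ler_norm_sum _ _ _) _.
by apply: ler_sum => i _; rewrite normrZ mulrC ler_wpM2l.
Qed.

End form_norm.

Lemma derive1_eps (R : realType) (V : normedModType R) (f : R^o -> V) s :
  derivable f s 1 -> forall e, 0 < e -> exists2 d, 0 < d &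
    forall y, `|y - s| < d -> `|f y - f s - (y - s) *: f^`()%classic s| <= e * `|y - s|.
Proof.
move=> df e e0; have dF : differentiable f s by apply/derivable1_diffP.
have := differentiable_eps dF e0; rewrite deriv1E // => /nbhs_ballP[d /= d0 Hd].
exists d => // y yd; have := Hd (y - s); rewrite /ball /= sub0r normrN => /(_ yd).
by rewrite subrK opprD addrA.
Qed.

Section local_geometry.
Context (R : realType) (n : nat) (S : topologicalType).
Notation E := 'rV[R]_n.
Context (A : atlas E S) (sigma : S -> E -> E -> R).
Hypotheses (hS : smooth_manifold A) (hsigma : riemannian_metric A sigma).

Definition tangent_norm (p : S) (v : E) : R := form_norm (sigma p) v.

Definition speed (c : R -> S) (s : R) : R := tangent_norm (c s) (velocity A c s).

Definition chart_metric (i : chart_index A) (x u v : E) : R :=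
  sigma (psi i x) (of_chart i (psi i x) u) (of_chart i (psi i x) v).

Let ssym p : symmetric_bilinear (sigma p).
Proof. by have [[+ _] _] := hsigma; apply. Qed.

Let spos p v : v != 0 -> 0 < sigma p v v.
Proof. by have [_ +] := hsigma; apply. Qed.

Let dom_at p : dom (chart_at A p) p.
Proof. by have [_ [_ + _]] := hS; apply. Qed.

Let isch i : is_chart (A := A) i.
Proof. by have [_ [+ _ _]] := hS; apply. Qed.

Lemma chart_cancel (i : chart_index A) p : dom i p -> psi i (phi i p) = p.
Proof. by have [_ _ + _ _] := isch i; apply. Qed.

Lemma open_dom (i : chart_index A) : open (dom i).
Proof. by have [] := isch i. Qed.

Lemma nbhs_dom (i : chart_index A) p : dom i p -> nbhs p (dom i).
Proof. by move=> ip; apply: open_nbhs_nbhs; split => //; exact: open_dom. Qed.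

Lemma open_codom (i : chart_index A) : open (phi i @` dom i).
Proof. by have [] := isch i. Qed.

Lemma phi_continuous (i : chart_index A) p : dom i p -> {for p, continuous (phi i)}.
Proof.
move=> ip; have [_ _ _ cphi _] := isch i.
exact: (within_open_continuous _ (@open_dom i)).1.
Qed.

Lemma psi_continuous (i : chart_index A) x :
  (phi i @` dom i) x -> {for x, continuous (psi i)}.
Proof.
move=> ix; have [_ _ _ _ cpsi] := isch i.
exact: ((within_open_continuous (psi i) (@open_codom i)).1 cpsi).
Qed.

Lemma of_chart_at p v : of_chart (chart_at A p) p v = v.
Proof.
rewrite /of_chart /transition_diff; set i := chart_at A p.
have : {near phi i p, id =1 phi i \o psi i}.
  have : nbhs (phi i p) (phi i @` dom i).
    by apply: open_nbhs_nbhs; split; [exact: open_codom|exists p => //; exact: dom_at].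
  by apply: filterS => _ [q iq <-] /=; rewrite chart_cancel.
move=> /near_eq_differentiable /(_ _)[|_ ->]; first exact: ex_diff.
by rewrite (@diff_val _ _ _ _ _ _ _ (is_diff_id (phi i p))).
Qed.

Lemma chart_metric_sym (i : chart_index A) x : symmetric_bilinear (chart_metric i x).
Proof.
split=> [c u v w|u v]; last exact: (sbfC (ssym _)).
rewrite /chart_metric; have -> : of_chart i (psi i x) (c *: u + v) =
    c *: of_chart i (psi i x) u + of_chart i (psi i x) v.
  by rewrite /of_chart /transition_diff linearP.
by rewrite (sbfPl (ssym _)).
Qed.

Lemma chart_metric_ge0 (i : chart_index A) x v : 0 <= chart_metric i x v v.
Proof. exact: (form_ge0 (ssym _) (@spos _)). Qed.

Lemma chart_metric_at p u v :
  chart_metric (chart_at A p) (phi (chart_at A p) p) u v = sigma p u v.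
Proof. by rewrite /chart_metric chart_cancel // !of_chart_at. Qed.

Lemma chart_metric_continuous (i : chart_index A) u v x : (phi i @` dom i) x ->
  {for x, continuous (fun y => chart_metric i y u v : R^o)}.
Proof. by have [[_ +] _] := hsigma => /(_ i u v 0%N); apply. Qed.

Lemma chart_metric_compare p e : 0 < e -> exists2 r, 0 < r &
  forall x, ball (phi (chart_at A p) p) r x -> (phi (chart_at A p) @` dom (chart_at A p)) x /\
  forall v, (1 - e) * tangent_norm p v <= form_norm (chart_metric (chart_at A p) x) v /\
            form_norm (chart_metric (chart_at A p) x) v <= (1 + e) * tangent_norm p v.
Proof.
move=> e0; set i := chart_at A p; set x0 := phi i p.
have [C C0 HC] := form_norm_lower (ssym p) (@spos p).
pose d (j : 'I_n) : E := delta_mx 0 j.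
pose N : R := (n * n)%:R.
pose eta := e / (N * C ^+ 2 + 1).
have D0 : 0 < N * C ^+ 2 + 1 by rewrite ltr_wpDl // mulr_ge0 ?sqr_ge0.
have eta0 : 0 < eta by rewrite divr_gt0.
have ix0 : (phi i @` dom i) x0 by exists p => //; exact: dom_at.
have nx0 : nbhs x0 (phi i @` dom i).
  by apply: open_nbhs_nbhs; split => //; exact: open_codom.
have close : \forall x \near x0, forall jk : 'I_n * 'I_n,
    `|chart_metric i x0 (d jk.1) (d jk.2) - chart_metric i x (d jk.1) (d jk.2)| <= eta.
  apply: (@filter_forall _ _ (fun (jk : 'I_n * 'I_n) x =>
    `|chart_metric i x0 (d jk.1) (d jk.2) - chart_metric i x (d jk.1) (d jk.2)| <= eta) _ (nbhs_filter x0)) => jk.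
  have /cvgrPdist_le : (fun y => chart_metric i y (d jk.1) (d jk.2) : R^o) @ x0 -->
     (chart_metric i x0 (d jk.1) (d jk.2) : R^o) by exact: chart_metric_continuous.
  by apply.
have /nbhs_ballP[r /= r0 Hr] := @filterI _ _ (nbhs_filter x0) _ _ nx0 close.
exists r => // x /Hr[ix Hx]; split => // v.
have g0E u w : chart_metric i x0 u w = sigma p u w by exact: chart_metric_at.
have bnd : `|chart_metric i x v v - sigma p v v| <= e * sigma p v v.
  rewrite -[X in `|_ - X|]g0E (form_expansion (chart_metric_sym i x)) (form_expansion (chart_metric_sym i x0)).
  rewrite -sumrB; apply: le_trans (ler_norm_sum _ _ _) _.
  apply: (@le_trans _ _ (\sum_(j < n) \sum_(k < n) eta * `|v| ^+ 2)).
    apply: ler_sum => j _; rewrite -sumrB; apply: le_trans (ler_norm_sum _ _ _) _.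
    apply: ler_sum => k _; rewrite -mulrBr normrM mulrC; apply: ler_pM => //.
      by rewrite distrC; exact: (Hx (j, k)).
    by rewrite normrM expr2; apply: ler_pM => //; exact: rV_coord_le.
  rewrite !sumr_const !card_ord -mulrnA -mulr_natr -/N.
  have : `|v| ^+ 2 <= C ^+ 2 * sigma p v v.
    rewrite -(sqr_form_norm (ssym p) (@spos p)) -exprMn.
    by apply: lerXn2r; rewrite ?nnegrE ?mulr_ge0 ?form_norm_ge0 ?(ltW C0) ?normr_ge0.
  have eE : eta * (N * C ^+ 2 + 1) = e by rewrite divfK ?gt_eqF.
  have N0 : 0 <= N by []; have s0 := form_ge0 (ssym p) (@spos p) v.
  have := ltW eta0; move: eE N0 s0; move: (C ^+ 2) (`|v| ^+ 2) (sigma p v v).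
  move=> C2 v2 s <- N0 s0 et0 H.
  apply: (@le_trans _ _ (eta * N * (C2 * s))).
    by rewrite mulrAC ler_wpM2l // mulr_ge0.
  nra.
have sg0 := form_ge0 (ssym p) (@spos p) v.
have tE : tangent_norm p v ^+ 2 = sigma p v v by exact: (sqr_form_norm (ssym p) (@spos p)).
have cg0 := chart_metric_ge0 i x v.
have t0 : 0 <= tangent_norm p v by exact: form_norm_ge0.
move: bnd; rewrite ler_norml => /andP[b1 b2]; split.
  have [e1|e1] := leP 1 e.
    by apply: le_trans (form_norm_ge0 _ _); nra.
  rewrite -[leLHS]ger0_norm; last by rewrite mulr_ge0 //; lra.
  by rewrite -sqrtr_sqr ler_wsqrtr // exprMn tE; nra.
rewrite -[leRHS]ger0_norm; last by rewrite mulr_ge0 //; lra.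
by rewrite -sqrtr_sqr ler_wsqrtr // exprMn tE; nra.
Qed.

Lemma chart_curve_derivable (i j : chart_index A) (c : R -> S) s :
  {for s, continuous c} -> dom i (c s) -> dom j (c s) ->
  derivable (phi i \o c : R^o -> E) s 1 ->
  derivable (phi j \o c : R^o -> E) s 1 /\
  derive1 (phi j \o c : R^o -> E) s =
    transition_diff i j (c s) (derive1 (phi i \o c : R^o -> E) s).
Proof.
move=> cc ic jc /derivable1_diffP df.
have dt := transition_differentiable hS ic jc.
have nE : {near (s : R^o), (phi j \o psi i) \o (phi i \o c) =1 phi j \o c}.
  have cn : \forall r \near s, dom i (c r) := cc _ (nbhs_dom ic).
  apply: filterS cn => r /= icr.
  by rewrite chart_cancel.
have dc : differentiable ((phi j \o psi i) \o (phi i \o c) : R^o -> E) s.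
  exact: (differentiable_comp df dt).
have [dj Dj] := near_eq_differentiable nE dc; split; first exact/derivable1_diffP.
have e1 := derive1E' dj; have e2 := derive1E' df; have e3 := diff_comp df dt.
apply: (etrans e1); rewrite /transition_diff.
apply: etrans (congr1 (fun v => 'd (phi j \o psi i) (phi i (c s)) v) (esym e2)).
exact: (congr1 (fun F => F 1) (etrans Dj e3)).
Qed.

Lemma velocity_chart (i : chart_index A) (c : R -> S) s :
  {for s, continuous c} -> dom i (c s) -> derivable (phi i \o c : R^o -> E) s 1 ->
  derivable (phi (chart_at A (c s)) \o c : R^o -> E) s 1 /\
  speed c s = form_norm (chart_metric i (phi i (c s))) (derive1 (phi i \o c : R^o -> E) s).
Proof.
move=> cc ic dc.
have [d D] := chart_curve_derivable cc ic (dom_at (c s)) dc; split => //.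
by rewrite /speed /velocity D /tangent_norm /form_norm /chart_metric chart_cancel.
Qed.

End local_geometry.

Section curves.
Context (R : realType) (n : nat) (S : topologicalType).
Notation E := 'rV[R]_n.
Context (A : atlas E S) (sigma : S -> E -> E -> R).
Hypotheses (hS : smooth_manifold A) (hsigma : riemannian_metric A sigma).
Notation tnorm := (tangent_norm sigma).
Notation spd := (speed A sigma).
Notation coord c s := (phi (chart_at A (c s)) \o c : R^o -> E).

Let ssym p : symmetric_bilinear (sigma p).
Proof. by have [[+ _] _] := hsigma; apply. Qed.

Let spos p v : v != 0 -> 0 < sigma p v v.
Proof. by have [_ +] := hsigma; apply. Qed.

Let dom_at p : dom (chart_at A p) p.
Proof. by have [_ [_ + _]] := hS; apply. Qed.

Lemma tnorm_ge0 p v : 0 <= tnorm p v. Proof. exact: form_norm_ge0. Qed.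

Lemma tnormD p u v : tnorm p (u + v) <= tnorm p u + tnorm p v.
Proof. exact: (form_normD (ssym p) (@spos p)). Qed.

Lemma tnormZ p c v : tnorm p (c *: v) = `|c| * tnorm p v.
Proof. exact: (form_normZ (ssym p)). Qed.

Lemma tnormN p v : tnorm p (- v) = tnorm p v.
Proof. exact: (form_normN (ssym p)). Qed.

Lemma tnorm0 p : tnorm p 0 = 0.
Proof. exact: (form_norm0 (ssym p)). Qed.

Lemma tnorm_upper p : exists2 C, 0 < C & forall v, tnorm p v <= C * `|v|.
Proof. exact: (form_norm_upper (ssym p)). Qed.

Lemma tnorm_lower p : exists2 C, 0 < C & forall v, `|v| <= C * tnorm p v.
Proof. exact: (form_norm_lower (ssym p) (@spos p)). Qed.

Lemma speed_ge0 c s : 0 <= spd c s. Proof. exact: tnorm_ge0. Qed.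

(* A form of "1-Lipschitz with respect to arc length" that is local and only
   compares values with the one at the centre p, which is what a derivative
   along a curve through p sees. *)
Definition calibrated (F : S -> R) := forall p e, 0 < e -> exists2 U, nbhs p U &
  forall y, U y ->
    `|F y - F p| <= (1 + e) * tnorm p (phi (chart_at A p) y - phi (chart_at A p) p).

Lemma calibrated_continuous F : calibrated F -> continuous F.
Proof.
move=> cF p; apply/cvgrPdist_le => e e0.
have [U nU HU] := cF p 1 ltr01; have [C C0 HC] := tnorm_upper p.
have e1 : 0 < e / (2 * C) by rewrite divr_gt0 ?mulr_gt0.
have /cvgrPdist_le /(_ _ e1) Hphi := phi_continuous hS (dom_at p).
apply: filterS2 nU Hphi => x Ux Hx; rewrite distrC; apply: le_trans (HU _ Ux) _.
have -> : e = (1 + 1) * (C * (e / (2 * C))) by field; rewrite gt_eqF.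
by rewrite ler_wpM2l //; apply: le_trans (HC _) _; rewrite ler_wpM2l ?(ltW C0) // distrC.
Qed.

Lemma calibrated_dini F c s : calibrated F -> {for s, continuous c} ->
  derivable (coord c s) s 1 -> forall e, 0 < e ->
  exists2 d, 0 < d & forall y, `|y - s| < d ->
    `|F (c y) - F (c s)| <= (spd c s + e) * `|y - s|.
Proof.
move=> cF cc dc e e0; set p := c s.
have [C C0 HC] := tnorm_upper p; have sp0 := speed_ge0 c s.
pose e1 := Num.min 1 (e / (spd c s + 2 * C)).
have D0 : 0 < spd c s + 2 * C by rewrite ltr_wpDl // mulr_gt0.
have e10 : 0 < e1 by rewrite lt_min ltr01 divr_gt0.
have e11 : e1 <= 1 by rewrite ge_min lexx.
have e12 : e1 * (spd c s + 2 * C) <= e by rewrite -ler_pdivlMr // ge_min lexx orbT.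
have [U nU HU] := cF p e1 e10.
have [d1 d10 Hd1] := derive1_eps dc e10.
have /nbhs_ballP[d2 /= d20 Hd2] : \forall y \near s, U (c y) := cc _ nU.
exists (Num.min d1 d2); first by rewrite lt_min d10.
move=> y; rewrite lt_min => /andP[/Hd1 y1 y2].
have Uy : U (c y) by apply: Hd2; rewrite /ball /= distrC.
apply: le_trans (HU _ Uy) _.
set w := velocity A c s in y1 *.
have -> : phi (chart_at A p) (c y) - phi (chart_at A p) p =
   (phi (chart_at A p) (c y) - phi (chart_at A p) p - (y - s) *: w) + (y - s) *: w.
  by rewrite subrK.
have h1 := tnormD p (phi (chart_at A p) (c y) - phi (chart_at A p) p - (y - s) *: w) ((y - s) *: w).
have h2 := HC (phi (chart_at A p) (c y) - phi (chart_at A p) p - (y - s) *: w).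
have h0 : tnorm p w = spd c s by [].
rewrite tnormZ h0 in h1.
have h3 : C * `|phi (chart_at A p) (c y) - phi (chart_at A p) p - (y - s) *: w| <=
  C * (e1 * `|y - s|) by rewrite ler_wpM2l // ltW.
apply: (@le_trans _ _ ((1 + e1) * ((spd c s + C * e1) * `|y - s|))).
  apply: ler_wpM2l; first by rewrite addr_ge0 // ltW.
  by move: h1 h2 h3; set u := phi _ _ - _ - _; nra.
rewrite mulrA ler_wpM2r //.
have : 0 <= C * e1 * (1 - e1) by rewrite !mulr_ge0 ?subr_ge0 // ltW.
by move: (spd c s) sp0 e10 e11 e12 => sp; nra.
Qed.

(* h is an arc length function of c; the Lipschitz bound and the finite set D of
   exceptions replace the integral of the speed. *)
Definition length_primitive (c : R -> S) (a b : R) (h : R -> R) :=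
  [/\ a < b, {within `[a, b], continuous c},
      exists2 K, 0 <= K & forall x y, a <= x -> x <= y -> y <= b ->
        0 <= h y - h x <= K * (y - x)
    & exists D : seq R, forall s, a < s -> s < b -> s \notin D ->
        [/\ derivable (coord c s) s 1, derivable h s 1 & h^`()%classic s = spd c s]].

Lemma continuous_at_interior (T : topologicalType) (c : R -> T) a b s :
  {within `[a, b], continuous c} -> a < s -> s < b -> {for s, continuous c}.
Proof.
move=> cc as_ sb.
have cc' : {within `]a, b[, continuous c}.
  by apply: continuous_subspaceW cc; exact: subset_itv_oo_cc.
have oI : open (`]a, b[%classic : set R) by exact: interval_open.
by apply: ((within_open_continuous _ oI).1 cc'); rewrite /= in_itv /= as_.
Qed.

Lemma lipschitz_within_continuous (h : R -> R) a b K : 0 <= K ->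
  (forall x y, a <= x -> x <= y -> y <= b -> `|h y - h x| <= K * (y - x)) ->
  {within `[a, b], continuous h}.
Proof.
move=> K0 HK; apply/subspace_continuousP => x; rewrite /= in_itv /= => /andP[ax xb].
apply/cvgrPdist_le => e e0; rewrite near_withinE.
have d0 : 0 < e / (K + 1) by rewrite divr_gt0 // ltr_wpDl.
apply/nbhs_ballP; exists (e / (K + 1)) => //= y; rewrite /ball /= => xy.
rewrite in_itv /= => /andP[ay yb].
have : (K + 1) * `|x - y| <= e by rewrite mulrC -ler_pdivlMr ?ltr_wpDl // ltW.
have := normr_ge0 (x - y).
have [yx|xy'] := leP y x.
  by have := HK _ _ ay yx xb; rewrite (ger0_norm (_ : 0 <= x - y)) ?subr_ge0 //; nra.
have := HK _ _ ax (ltW xy') yb; rewrite (distrC (h x)) (ltr0_norm (_ : x - y < 0)) ?subr_lt0 //.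
nra.
Qed.

Lemma primitive_continuous c a b h : length_primitive c a b h ->
  {within `[a, b], continuous h}.
Proof.
move=> [ab _ [K K0 HK] _]; apply: (lipschitz_within_continuous K0) => x y ax xy yb.
by have /andP[h0 hK] := HK x y ax xy yb; rewrite ger0_norm.
Qed.

Lemma length_primitiveS c a b h a' b' : a <= a' -> a' < b' -> b' <= b ->
  length_primitive c a b h -> length_primitive c a' b' h.
Proof.
move=> aa ab' bb [ab cc [K K0 HK] [D HD]]; split => //.
- apply: continuous_subspaceW cc => x /=; rewrite !in_itv /= => /andP[a'x xb'].
  by rewrite (le_trans aa) // (le_trans xb').
- exists K => // x y ax xy yb; apply: HK => //; [exact: le_trans ax|exact: le_trans bb].
- exists D => s as_ sb; apply: HD; [exact: le_lt_trans as_|exact: lt_le_trans bb].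
Qed.

Lemma calibrated_le F c a b h : calibrated F -> length_primitive c a b h ->
  F (c b) - F (c a) <= h b - h a.
Proof.
move=> cF lp; have ch := primitive_continuous lp; case: lp => ab cc [K K0 HK] [D HD].
suff : h a - F (c a) <= h b - F (c b) by lra.
apply: (@nondecreasing_right_dini _ (fun s => h s - F (c s)) a b (a :: D)).
- exact: ltW.
- move=> x; apply: cvgB; first exact: ch.
  by apply: continuous_comp; [exact: cc|exact: calibrated_continuous].
- move=> x ax xb; rewrite inE negb_or eq_sym => /andP[nax nD] e e0.
  have {}ax : a < x by rewrite lt_neqAle nax.
  have [dc dh hE] := HD x ax xb nD.
  have e2 : 0 < e / 2 by rewrite divr_gt0.
  have [d1 d10 H1] := calibrated_dini cF (continuous_at_interior cc ax xb) dc e2.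
  have [d2 d20 H2] := derive1_eps dh e2.
  exists (Num.min d1 d2); first by rewrite lt_min d10.
  move=> y xy; rewrite -ltrBlDl lt_min => /andP[y1 y2] _.
  have yx0 : `|y - x| = y - x by rewrite gtr0_norm // subr_gt0.
  have := H1 y; have := H2 y; rewrite yx0 => /(_ y2) + /(_ y1).
  rewrite hE -[_ *: _]/((y - x) * spd c x) !ler_norml => /andP[? ?] /andP[? ?]; nra.
Qed.

Lemma primitive_unique c a b h1 h2 :
  length_primitive c a b h1 -> length_primitive c a b h2 -> h1 b - h1 a <= h2 b - h2 a.
Proof.
move=> lp1 lp2; have c1 := primitive_continuous lp1; have c2 := primitive_continuous lp2.
case: lp1 lp2 => ab cc _ [D1 HD1] [_ _ _ [D2 HD2]].
suff : h2 a - h1 a <= h2 b - h1 b by lra.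
apply: (@nondecreasing_right_dini _ (fun s => h2 s - h1 s) a b (a :: D1 ++ D2)).
- exact: ltW.
- by move=> x; apply: cvgB; [exact: c2|exact: c1].
- move=> x ax xb; rewrite inE mem_cat !negb_or eq_sym => /and3P[nax n1 n2] e e0.
  have {}ax : a < x by rewrite lt_neqAle nax.
  have [_ d1h h1E] := HD1 x ax xb n1; have [_ d2h h2E] := HD2 x ax xb n2.
  have e2 : 0 < e / 2 by rewrite divr_gt0.
  have [d1 d10 H1] := derive1_eps d1h e2.
  have [d2 d20 H2] := derive1_eps d2h e2.
  exists (Num.min d1 d2); first by rewrite lt_min d10.
  move=> y xy; rewrite -ltrBlDl lt_min => /andP[y1 y2] _.
  have yx0 : `|y - x| = y - x by rewrite gtr0_norm // subr_gt0.
  have := H1 y; have := H2 y; rewrite yx0 => /(_ y2) + /(_ y1).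
  rewrite h1E h2E -[_ *: _]/((y - x) * spd c x) !ler_norml => /andP[? ?] /andP[? ?]; nra.
Qed.

End curves.

Lemma continuous_sum_at (R : realType) (T : topologicalType) (I : finType)
    (F : I -> T -> R) (s : T) :
  (forall i, {for s, continuous (F i)}) -> {for s, continuous (fun r => \sum_i F i r)}.
Proof. by move=> cF; apply: cvg_big => [|i _]; [exact: add_continuous|exact: cF]. Qed.

Section piecewise.
Context (R : realType) (n : nat) (S : topologicalType).
Notation E := 'rV[R]_n.
Context (A : atlas E S) (sigma : S -> E -> E -> R).
Hypotheses (hS : smooth_manifold A) (hsigma : riemannian_metric A sigma).
Notation spd := (speed A sigma).
Notation coord c s := (phi (chart_at A (c s)) \o c : R^o -> E).
Notation mu := (@lebesgue_measure R).

Let dom_at p : dom (chart_at A p) p.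
Proof. by have [_ [_ + _]] := hS; apply. Qed.

Lemma C1_at_derivable (c : R -> S) s : C1_at A c s -> derivable (coord c s) s 1.
Proof.
move=> [_ [N nN [dN _]]]; apply/derivable1_diffP.
by apply: dN; exact: nbhs_singleton.
Qed.

Lemma chart_metric_form_norm_continuous (i : chart_index A) (x w : R -> E) s :
  (phi i @` dom i) (x s) -> {for s, continuous x} -> {for s, continuous w} ->
  {for s, continuous (fun r => form_norm (chart_metric sigma i (x r)) (w r) : R)}.
Proof.
move=> ixs cx cw.
apply: (@continuous_comp _ _ _ (fun r => chart_metric sigma i (x r) (w r) (w r) : R) (@Num.sqrt R)); last first.
  exact: sqrt_continuous.
have -> : (fun r => chart_metric sigma i (x r) (w r) (w r)) =
    (fun r => \sum_j \sum_k w r 0 j * w r 0 k *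
       chart_metric sigma i (x r) (delta_mx 0 j) (delta_mx 0 k)).
  by apply/funext => r; rewrite {1}(form_expansion (chart_metric_sym hsigma i (x r))).
have cwj j : {for s, continuous (fun r => w r 0 j : R)}.
  by apply: (@continuous_comp _ _ _ w (fun M : E => M 0 j)) => //; exact: coord_continuous.
apply: continuous_sum_at => j; apply: continuous_sum_at => k.
apply: cvgM; first by apply: cvgM; exact: cwj.
apply: (@continuous_comp _ _ _ x (fun y => chart_metric sigma i y (delta_mx 0 j) (delta_mx 0 k) : R)) => //.
exact: chart_metric_continuous.
Qed.

Lemma C1_at_speed_continuous (c : R -> S) s : C1_at A c s -> {for s, continuous (spd c)}.
Proof.
move=> [cc [N nN [dN DN]]]; set i := chart_at A (c s).
pose f := phi i \o c : R^o -> E.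
have nd : \forall r \near s, dom i (c r) := cc _ (nbhs_dom hS (dom_at (c s))).
have Hr : \forall r \near s, spd c r =
    form_norm (chart_metric sigma i (phi i (c r))) (derive1 f r).
  have nd' : \forall r \near s, \forall r' \near r, dom i (c r') by exact/near_join.
  near=> r.
  have Nr : N r by near: r.
  have dr : dom i (c r) by near: r; exact: nd.
  have dfr := dN r Nr.
  have cr : {for r, continuous c}.
    have nr : \forall r' \near r, psi i (f r') = c r'.
      have nr0 : \forall r' \near r, dom i (c r') by near: r; exact: nd'.
      apply: filterS nr0 => r' /= dr'.
      by rewrite /f /= (chart_cancel hS).
    rewrite /prop_for /continuous_at -(nbhs_singleton nr).
    apply: cvg_trans (near_eq_cvg nr) _.
    apply: (@continuous_comp _ _ _ f (psi i)); first exact: differentiable_continuous.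
    by apply: (psi_continuous hS); exists (c r).
  have dr1 : derivable f r 1 by apply/derivable1_diffP.
  by have [_ ->] := velocity_chart sigma hS cr dr dr1.
rewrite /prop_for /continuous_at (nbhs_singleton Hr).
have Hr' : \forall r \near s,
    form_norm (chart_metric sigma i (phi i (c r))) (derive1 f r) = spd c r.
  by apply: filterS Hr => r ->.
apply: cvg_trans (near_eq_cvg Hr') _.
apply: (@chart_metric_form_norm_continuous i (phi i \o c) (derive1 f)).
- by exists (c s) => //; exact: dom_at.
- by apply: continuous_comp => //; exact: (phi_continuous hS (dom_at (c s))).
- rewrite (_ : derive1 f = (fun r => 'D_1 f r)); last by apply/funext => r; rewrite derive1E.
  by apply: DN; exact: nbhs_singleton.
Unshelve. all: by end_near. Qed.

Lemma near_eq_velocity (c c' : R -> S) s : {near s, c =1 c'} ->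
  [/\ derivable (coord c s) s 1 -> derivable (coord c' s) s 1 & spd c s = spd c' s].
Proof.
move=> cc; have cs := nbhs_singleton cc.
have nf : {near (s : R^o), coord c s =1 coord c' s}.
  by apply: filterS cc => r /= ->; rewrite cs.
split; first exact: near_eq_derivable.
have e : velocity A c s = velocity A c' s.
  by rewrite /velocity !derive1E; exact: (near_eq_derive _ nf).
by rewrite /speed e cs.
Qed.

Lemma C1_curve_primitive (c : R -> S) a b : a < b -> C1_curve A c a b ->
  exists h, [/\ length_primitive A sigma c a b h,
    measurable_fun `[a, b] (spd c) & curve_length A sigma c a b = (h b - h a)%:E].
Proof.
move=> ab [c' Hc'].
have C1c' s : a <= s <= b -> C1_at A c' s by move=> sab; have [] := Hc' s; rewrite ?in_itv.
have cE s : a <= s <= b -> c' s = c s by move=> sab; have [] := Hc' s; rewrite ?in_itv.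
pose k (x : R) := Num.max a (Num.min x b).
have kin x : a <= k x <= b.
  by rewrite /k le_max lexx /= ge_max (ltW ab) /= ge_min lexx orbT.
have kE x : a <= x <= b -> k x = x by rewrite /k => /andP[? ?]; rewrite min_l ?max_r.
have ck : continuous k.
  have H : continuous ((cst a : R -> R^o) \max ((id : R -> R^o) \min cst b)).
    move=> x; apply: continuous_max; first exact: cvg_cst.
    by apply: continuous_min; [exact: cvg_id|exact: cvg_cst].
  exact: H.
pose N x := spd c' (k x).
have cN : continuous N.
  move=> x; apply: continuous_comp; first exact: ck.
  exact/C1_at_speed_continuous/C1c'/kin.
have [h [Hh hN]] := continuous_primitive ab cN.
have nc s : a < s -> s < b -> {near s, c' =1 c}.
  move=> as_ sb; near=> r; apply: cE; apply/andP; split; apply: ltW; near: r.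
    exact: lt_nbhsr.
  exact: lt_nbhsl.
have spE s : a < s -> s < b -> spd c s = N s.
  move=> as_ sb; have [_ <-] := near_eq_velocity (nc _ as_ sb).
  by rewrite /N kE // !ltW.
have mN : measurable_fun setT N by exact: continuous_measurable_fun.
have moo : measurable_fun `]a, b[ (spd c).
  apply: (@eq_measurable_fun _ _ _ _ _ N).
    by move=> s /set_mem; rewrite /= in_itv /= => /andP[? ?]; rewrite spE.
  exact: measurable_funTS.
exists h; split.
- split => //.
  + apply/subspace_continuousP => s; rewrite /= in_itv /= => sab.
    have [cc' _] := C1c' s sab.
    change (c @ within `[a, b]%classic (nbhs s) --> c s).
    rewrite -(cE s sab); 
    have cc2 : c' @ within `[a, b]%classic (nbhs s) --> c' s.
      by apply: cvg_within_filter; exact: cc'.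
    apply: (cvg_trans _ cc2).
    apply: near_eq_cvg; rewrite near_withinE; apply: nearW => r.
    by rewrite /= in_itv /= => /cE.
  + have [m _ Hm] := EVT_max (ltW ab) (continuous_subspaceT cN).
    exists (N m); first exact: speed_ge0.
    have dh x : x \in `]a, b[ -> derivable h x 1.
      by rewrite in_itv /= => /andP[ax xb]; have [] := Hh x; rewrite ?ltW.
    have hE x : x \in `]a, b[ -> h^`()%classic x = N x.
      by rewrite in_itv /= => /andP[ax xb]; have [] := Hh x; rewrite ?ltW.
    have ch : {within `[a, b], continuous h}.
      apply: derivable_within_continuous => x; rewrite in_itv /= => xab.
      by have [] := Hh x xab.
    move=> x y ax xy yb; apply/andP; split.
      rewrite subr_ge0; apply: (ger0_derive1_ndecr dh _ ch) => // z zab.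
      by rewrite hE //; exact: speed_ge0.
    pose h2 z := N m * z - h z.
    have dh2 z : z \in `]a, b[ -> is_derive (z : R^o) 1 h2 (N m - N z).
      move=> zab; have dz := dh z zab.
      apply: is_deriveB; last by apply: DeriveDef => //; rewrite -derive1E hE.
      by apply: is_derive_eq; rewrite [_ *: _]mulr1.
    suff : h2 x <= h2 y by rewrite /h2; lra.
    apply: (@ger0_derive1_ndecr _ h2 a b) => //.
    * by move=> z /dh2 [].
    * move=> z zab; have [_ dz] := dh2 z zab; rewrite derive1E dz subr_ge0.
      by apply: Hm; apply: subset_itv_oo_cc zab.
    * move=> z; apply: cvgB; last exact: ch.
      apply: (continuous_subspaceT (f := fun z : R => N m * z)) => u.
      by apply: cvgMl_tmp; exact: cvg_id.
  + exists [::] => s as_ sb _; have sab : a <= s <= b by rewrite !ltW.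
    have [d _] := near_eq_velocity (nc _ as_ sb); have [dh hE] := Hh s sab.
    by split => //; [exact/d/C1_at_derivable/C1c'|rewrite hE spE].
- exact: measurable_fun_itv_cc moo.
- rewrite -hN /curve_length.
  rewrite (integral_itv_bndoo true false); last exact/measurable_EFinP.
  rewrite [RHS](integral_itv_bndoo true false); last first.
    by apply/measurable_EFinP; exact: measurable_funTS.
  by apply: eq_integral => s /set_mem; rewrite /= in_itv /= => /andP[? ?]; rewrite -spE.
Unshelve. all: by end_near. Qed.

End piecewise.

(** * The Riemannian distance *)

Lemma continuous_affine (R : realType) (al be x : R) :
  {for x, continuous (fun s : R => al * s + be)}.
Proof.
apply: (@continuousD _ _ _ (fun s : R => al * s) (cst be)); last exact: cst_continuous.
by apply: (@continuousM _ _ (cst al) id); [exact: cst_continuous|exact: cvg_id].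
Qed.

Section affine_reparametrization.
Context (R : realType) (V : normedModType R) (f : R^o -> V) (al be : R).
Notation g := (fun s : R^o => f (al * s + be)).

Lemma affine_growth_rate (v x : R^o) :
  (fun h : R => h^-1 *: ((g \o shift x) (h *: v) - g x)) =
  (fun h : R => h^-1 *: ((f \o shift (al * x + be : R^o)) (h *: (al * v : R^o)) - f (al * x + be))).
Proof.
apply/funext => h /=.
by rewrite mulrDr [h *: v]/(h * v) [h *: (al * v)]/(h * (al * v)) mulrCA addrA.
Qed.

Lemma affine_derive (v x : R^o) : 'D_v g x = 'D_(al * v : R^o) f (al * x + be).
Proof. by rewrite /derive affine_growth_rate. Qed.

Lemma affine_derivable (v x : R^o) :
  derivable f (al * x + be) (al * v : R^o) -> derivable g x v.
Proof. by rewrite /derivable affine_growth_rate. Qed.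

End affine_reparametrization.

Section joining.
Context (R : realType) (n : nat) (S : topologicalType).
Notation E := 'rV[R]_n.
Context (A : atlas E S) (sigma : S -> E -> E -> R).
Hypotheses (hS : smooth_manifold A) (hsigma : riemannian_metric A sigma).
Notation spd := (speed A sigma).
Notation tnorm := (tangent_norm sigma).
Notation coord c s := (phi (chart_at A (c s)) \o c : R^o -> E).
Notation mu := (@lebesgue_measure R).
Notation lprim := (length_primitive A sigma).

Let dom_at p : dom (chart_at A p) p.
Proof. by have [_ [_ + _]] := hS; apply. Qed.

Lemma length_primitive_glue c a m b h1 h2 : lprim c a m h1 -> lprim c m b h2 ->
  lprim c a b (fun s => if s <= m then h1 s else h2 s - h2 m + h1 m).
Proof.
move=> [am c1 [K1 K10 H1] [D1 HD1]] [mb c2 [K2 K20 H2] [D2 HD2]].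
have ab := lt_trans am mb; split => //.
- have -> : `[a, b]%classic = `[a, m]%classic `|` `[m, b]%classic :> set R.
    apply/seteqP; split => x /=; rewrite !in_itv /=.
      by move=> /andP[? ?]; case: (leP x m) => ?; [left|right]; apply/andP; split; lra.
    by move=> [|] /andP[? ?]; apply/andP; split; lra.
  by apply: withinU_continuous => //; exact: interval_closed.
- exists (K1 + K2); first exact: addr_ge0.
  move=> x y ax xy yb; have [ym|my] := leP y m.
    rewrite (le_trans xy ym); have /andP[-> h] := H1 x y ax xy ym; apply: le_trans h _.
    by rewrite ler_wpM2r ?subr_ge0 // lerDl.
  have [xm|mx] := leP x m.
    have /andP[g1 g2] := H1 x m ax xm (lexx m).
    have /andP[g3 g4] := H2 m y (lexx m) (ltW my) yb.
    by apply/andP; split; nra.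
  have /andP[g3 g4] := H2 x y (ltW mx) xy yb.
  by apply/andP; split; nra.
- exists (m :: D1 ++ D2) => s as_ sb; rewrite inE mem_cat !negb_or => /and3P[nm n1 n2].
  have [sm|ms|/eqP sm] := ltgtP s m; last by rewrite sm in nm.
    have [d dh hE] := HD1 s as_ sm n1.
    have nE : {near (s : R^o), h1 =1 (fun s => if s <= m then h1 s else h2 s - h2 m + h1 m)}.
      by near=> r; rewrite ltW //; near: r; exact: lt_nbhsl.
    split; [exact: d|exact: near_eq_derivable dh|].
    by rewrite -hE !derive1E; apply/esym; exact: near_eq_derive.
  have [d dh hE] := HD2 s ms sb n2.
  pose h3 s := h2 s - h2 m + h1 m.
  have nE : {near (s : R^o), h3 =1 (fun s => if s <= m then h1 s else h2 s - h2 m + h1 m)}.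
    by near=> r; rewrite leNgt (_ : m < r) //; near: r; exact: lt_nbhsr.
  have d3 : is_derive (s : R^o) 1 h3 (spd c s).
    rewrite -[spd c s]addr0 -[X in X + 0]addr0; apply: is_deriveD.
    by apply: is_deriveD; apply: DeriveDef => //; rewrite -derive1E.
  have [d3h d3E] := d3.
  split; [exact: d|exact: near_eq_derivable d3h|].
  by rewrite -d3E derive1E; apply/esym; exact: near_eq_derive.
Unshelve. all: by end_near. Qed.

Lemma curve_length_glue (c : R -> S) (a m b : R) : a <= m -> m <= b ->
  measurable_fun `[a, m] (spd c) -> measurable_fun `[m, b] (spd c) ->
  measurable_fun `[a, b] (spd c) /\
  curve_length A sigma c a b = (curve_length A sigma c a m + curve_length A sigma c m b)%E.
Proof.
move=> am mb m1 m2.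
have U : `[a, b]%classic = `[a, m]%classic `|` `]m, b]%classic :> set R.
  apply/seteqP; split => x /=; rewrite !in_itv /=.
    by move=> /andP[? ?]; case: (leP x m) => ?; [left|right]; apply/andP; split; lra.
  by move=> [|] /andP[? ?]; apply/andP; split; lra.
have m2' : measurable_fun `]m, b] (spd c) by exact/measurable_fun_itv_obnd_cbndP.
have m12 : measurable_fun (`[a, m] `|` `]m, b]) (spd c).
  by apply/measurable_funU => //; exact: measurable_itv.
split; first by rewrite U.
rewrite /curve_length U ge0_integral_setU //=.
- by congr (_ + _)%E; apply: integral_itv_obnd_cbnd; exact/measurable_EFinP.
- exact/measurable_EFinP.
- apply/disj_setPRL => x /=; rewrite !in_itv /= => /andP[mx _].
  by apply/negP; rewrite negb_and -!ltNge mx orbT.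
Qed.

Lemma piecewise_primitive c a b : piecewise_C1_curve A c a b ->
  exists h, lprim c a b h /\ curve_length A sigma c a b = (h b - h a)%:E.
Proof.
move=> [k [s [[k0 sa sb sS] HC]]].
suff H j : (j < k)%N -> exists h, [/\ lprim c a (s j.+1) h,
    measurable_fun `[a, s j.+1] (spd c) &
    curve_length A sigma c a (s j.+1) = (h (s j.+1) - h a)%:E].
  have kk : (k.-1 < k)%N by rewrite prednK.
  by have [h] := H _ kk; rewrite prednK // sb => -[h1 _ h2]; exists h.
elim: j => [|j IH] jk.
  by rewrite -sa; apply: C1_curve_primitive => //; [exact: sS|exact: HC].
have [h1 [l1 m1 L1]] := IH (ltnW jk).
have [h2 [l2 m2 L2]] := C1_curve_primitive hS hsigma (sS _ jk) (HC _ jk).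
have [am _ _ _] := l1.
have [m12 L12] := curve_length_glue (ltW am) (ltW (sS _ jk)) m1 m2.
exists (fun x => if x <= s j.+1 then h1 x else h2 x - h2 (s j.+1) + h1 (s j.+1)).
split => //; first exact: length_primitive_glue.
rewrite L12 L1 L2 -EFinD leNgt sS //= (ltW am); congr (_%:E); ring.
Qed.

Lemma piecewise_length c a b h : piecewise_C1_curve A c a b -> lprim c a b h ->
  curve_length A sigma c a b = (h b - h a)%:E.
Proof.
move=> pc lp; have [h' [lp' ->]] := piecewise_primitive pc; congr (_%:E).
by apply/le_anti; rewrite (primitive_unique lp lp') (primitive_unique lp' lp).
Qed.

Lemma primitive_le c a b h B : lprim c a b h ->
  (forall s, a < s -> s < b -> spd c s <= B) -> h b - h a <= B * (b - a).
Proof.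
move=> lp HB; have ch := primitive_continuous lp; case: lp => ab cc _ [D HD].
suff : B * a - h a <= B * b - h b by lra.
apply: (@nondecreasing_right_dini _ (fun s => B * s - h s) a b (a :: D)).
- exact: ltW.
- move=> x; apply: cvgB; last exact: ch.
  apply: (continuous_subspaceT (f := fun z : R => B * z)) => u.
  by apply: cvgMl_tmp; exact: cvg_id.
- move=> x ax xb; rewrite inE negb_or eq_sym => /andP[nax nD] e e0.
  have {}ax : a < x by rewrite lt_neqAle nax.
  have [dc dh hE] := HD x ax xb nD.
  have [d d0 H] := derive1_eps dh e0.
  exists d => // y xy; rewrite -ltrBlDl => y1 _.
  have yx0 : `|y - x| = y - x by rewrite gtr0_norm // subr_gt0.
  have := H y; have := HB x ax xb; rewrite yx0 => Bx /(_ y1).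
  rewrite hE -[_ *: _]/((y - x) * spd c x) ler_norml => /andP[? ?]; nra.
Qed.

Lemma eq_length_primitive (c c' : R -> S) (a b : R) h : (forall s, a <= s <= b -> c s = c' s) ->
  lprim c a b h -> lprim c' a b h.
Proof.
move=> cc [ab c0 HK [D HD]]; split => //.
  apply: subspace_eq_continuous c0 => s /set_mem; rewrite /= in_itv /= => /cc.
  exact.
exists D => s as_ sb nD; have [d dh hE] := HD s as_ sb nD.
have nE : {near s, c =1 c'}.
  near=> r; apply: cc; apply/andP; split; apply: ltW; near: r.
    exact: lt_nbhsr.
  exact: lt_nbhsl.
have [dd sE] := near_eq_velocity A sigma nE.
by split; [exact: dd|exact: dh|exact: etrans hE sE].
Unshelve. all: by end_near. Qed.

Lemma eq_C1_curve (c c' : R -> S) (a b : R) : (forall s, a <= s <= b -> c s = c' s) ->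
  C1_curve A c a b -> C1_curve A c' a b.
Proof.
move=> cc [c0 H]; exists c0 => s sab; have [e C1] := H s sab; split => //.
by rewrite e; apply: cc; move: sab; rewrite in_itv.
Qed.

Lemma affine_C1 (f : R^o -> E) (al be : R) (N : set R^o) : Ck 1 N f ->
  Ck 1 ((fun s => al * s + be) @^-1` N : set R^o) (fun s => f (al * s + be)).
Proof.
move=> [df Hf].
have ca (x : R) : {for x, continuous (fun s : R => al * s + be)}.
  exact: continuous_affine.
split.
  move=> x Nx; apply: (@differentiable_comp _ _ _ _ (fun s : R^o => al * s + be : R^o) f).
    exact/derivable1_diffP.
  exact: df.
move=> v.
have -> : (fun x => 'D_v (fun s => f (al * s + be)) x) =
    (fun x : R^o => 'D_(al * v : R^o) f (al * x + be)).
  by apply/funext => x; exact: affine_derive.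
move=> x Nx; apply: (@continuous_comp _ _ _ (fun s : R^o => al * s + be : R^o) ('D_(al * v) f)).
  exact: ca.
exact: Hf.
Qed.

Lemma affine_C1_at (c : R -> S) (al be s : R) : C1_at A c (al * s + be) ->
  C1_at A (fun r => c (al * r + be)) s.
Proof.
have ca : {for s, continuous (fun r : R => al * r + be)}.
  exact: continuous_affine.
move=> [cc [N nN CN]]; split; first exact: (continuous_comp ca cc).
by exists ((fun r => al * r + be) @^-1` N); [exact: ca|exact: (@affine_C1 (phi (chart_at A (c (al * s + be))) \o c) al be N CN)].
Qed.

Lemma affine_speed (c : R -> S) (al be s : R) : `|al| = 1 ->
  derivable (coord c (al * s + be)) (al * s + be) 1 ->
  derivable (coord (fun r => c (al * r + be)) s) s 1 /\
  spd (fun r => c (al * r + be)) s = spd c (al * s + be).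
Proof.
move=> al1 dc; set f := coord c (al * s + be).
have df : differentiable f (al * s + be) by exact/derivable1_diffP.
have da : derivable f (al * s + be) (al : R^o) by exact: diff_derivable.
split; first by apply: (@affine_derivable _ _ f al be 1 s); rewrite mulr1.
have vE : velocity A (fun r => c (al * r + be)) s = al *: velocity A c (al * s + be).
  have e1 : velocity A (fun r => c (al * r + be)) s = 'D_(al * 1 : R^o) f (al * s + be).
    by apply: etrans (affine_derive f al be 1 s); rewrite -derive1E.
  have e2 : velocity A c (al * s + be) = 'D_1 f (al * s + be) by rewrite -derive1E.
  have e3 : 'D_(al * 1 : R^o) f (al * s + be) = 'd f (al * s + be) (al *: (1 : R^o)).
    by rewrite (deriveE _ df).
  have e4 : 'D_1 f (al * s + be) = 'd f (al * s + be) (1 : R^o) by exact: deriveE.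
  by rewrite e1 e3 e2 e4 linearZ.
by rewrite /speed vE (tnormZ hsigma) al1 mul1r.
Qed.


Lemma affine_C1_curve (c : R -> S) al be a b a' b' :
  (forall s, a' <= s <= b' -> a <= al * s + be <= b) ->
  C1_curve A c a b -> C1_curve A (fun r => c (al * r + be)) a' b'.
Proof.
move=> H [c' Hc']; exists (fun r => c' (al * r + be)) => s; rewrite in_itv /= => /H sab.
have [|e C1] := Hc' (al * s + be); first by rewrite in_itv.
by split; [exact: e|exact: affine_C1_at].
Qed.

Lemma affine_length_primitive (c : R -> S) al be a b a' b' h : `|al| = 1 -> a' < b' ->
  (forall s, a' <= s <= b' -> a <= al * s + be <= b) ->
  (forall s, a' < s < b' -> a < al * s + be < b) ->
  lprim c a b h ->
  lprim (fun r => c (al * r + be)) a' b' (fun r => al * h (al * r + be)).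
Proof.
move=> al1 ab' Hc Ho [ab cc [K K0 HK] [D HD]].
have alE : al = 1 \/ al = -1.
  by move/eqP: al1; rewrite eqr_norml ler01 andbT => /orP[] /eqP; [left|right].
have al2 : al * al = 1 by case: alE => ->; rewrite ?mulrNN mulr1.
split => //.
- apply/subspace_continuousP => s; rewrite /= in_itv /= => /Hc sab P nP.
  have sI : (`[a, b]%classic : set R) (al * s + be) by rewrite /= in_itv.
  move/subspace_continuousP : cc => /(_ _ sI P nP) nQ.
  change (nbhs s [set r | (`[a', b']%classic : set R) r -> P (c (al * r + be))]).
  have nQ' : nbhs s [set r | (`[a, b]%classic : set R) (al * r + be) -> P (c (al * r + be))].
    exact: (@continuous_affine R al be s _ nQ).
  by apply: filterS nQ' => r /= Q; rewrite in_itv /= => /Hc rab; apply: Q; rewrite in_itv.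
- exists K => // x y ax xy yb.
  have /Hc/andP[x1 x2] : a' <= x <= b' by rewrite ax (le_trans xy).
  have /Hc/andP[y1 y2] : a' <= y <= b' by rewrite yb (le_trans ax).
  case: alE => al_1.
    rewrite al_1 !mul1r in x1 x2 y1 y2 *.
    have /andP[h1 h2] : 0 <= h (y + be) - h (x + be) <= K * (y + be - (x + be)).
      by apply: HK => //; lra.
    by rewrite h1 /=; nra.
  rewrite al_1 !mulN1r in x1 x2 y1 y2 *.
  have /andP[h1 h2] : 0 <= h (- x + be) - h (- y + be) <= K * (- x + be - (- y + be)).
    by apply: HK => //; lra.
  by apply/andP; split; nra.
- exists [seq al * (d - be) | d <- D] => s as_ sb nD.
  have /Ho/andP[s1 s2] : a' < s < b' by rewrite as_.
  have nD' : al * s + be \notin D.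
    apply: contra nD => sD; apply/mapP; exists (al * s + be) => //.
    by rewrite addrK mulrA al2 mul1r.
  have [d dh hE] := HD _ s1 s2 nD'.
  have [d' sE] := affine_speed al1 d.
  have dh' : differentiable (h : R^o -> R^o) (al * s + be) by exact/derivable1_diffP.
  have dg : derivable (fun r : R^o => h (al * r + be) : R^o) s 1.
    apply: (@affine_derivable _ R^o h al be 1 s); exact: diff_derivable.
  have dgE : 'D_1 (fun r : R^o => h (al * r + be) : R^o) s = al * spd c (al * s + be).
    apply: etrans (@affine_derive _ R^o h al be 1 s) _.
    have e1 : 'D_(al * 1 : R^o) (h : R^o -> R^o) (al * s + be) =
        'd (h : R^o -> R^o) (al * s + be) (al *: (1 : R^o)) by rewrite (deriveE _ dh').
    by rewrite e1 linearZ -hE (derive1E' dh').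
  have Hd : is_derive (s : R^o) 1 (al *: (fun r : R^o => h (al * r + be) : R^o)) (al *: (al * spd c (al * s + be) : R^o)).
    by apply: is_deriveZ; apply: DeriveDef.
  have [Hd1 Hd2] := Hd.
  split; [exact: d'|exact: Hd1|].
  by rewrite derive1E; apply: etrans Hd2 _; rewrite [_ *: _]mulrA al2 mul1r sE.
Qed.

Lemma length_primitive_ge0 c a b h : lprim c a b h -> 0 <= h b - h a.
Proof. by move=> [ab _ [K _ HK] _]; have /andP[] := HK a b (lexx a) (ltW ab) (lexx b). Qed.

Definition joins (p q : S) (l : R) := exists c a b h,
  [/\ piecewise_C1_curve A c a b, c a = p, c b = q, lprim c a b h & l = h b - h a].

Lemma joins_ge0 p q l : joins p q l -> 0 <= l.
Proof. by move=> [c [a [b [h [_ _ _ lp ->]]]]]; exact: length_primitive_ge0 lp. Qed.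

Lemma riemannian_distanceE p q :
  riemannian_distance A sigma p q = ereal_inf [set l%:E | l in joins p q].
Proof.
rewrite /riemannian_distance; congr ereal_inf; apply/seteqP; split.
  move=> _ [c [a [b [pc ca cb ->]]]].
  have [h [lp ->]] := piecewise_primitive pc.
  by exists (h b - h a) => //; exists c, a, b, h.
move=> _ [l [c [a [b [h [pc ca cb lp ->]]]]] <-].
by exists c, a, b; split => //; rewrite (piecewise_length pc lp).
Qed.

Lemma joins_sym p q l : joins p q l -> joins q p l.
Proof.
move=> [c [a [b [h [[k [s [[k0 sa sb sS] HC]]] ca cb lp ->]]]]].
have [ab _ _ _] := lp.
have N1 : `|-1 : R| = 1 by rewrite normrN1.
exists (fun r => c (-1 * r + (a + b))), a, b, (fun r => -1 * h (-1 * r + (a + b))); split.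
- exists k, (fun i => a + b - s (k - i)%N); split.
    split => //; first by rewrite subn0 sb addrK.
      by rewrite subnn sa addrAC subrr add0r.
    move=> i ik; rewrite ltrD2l ltrN2.
    have -> : (k - i = (k - i.+1).+1)%N by rewrite subnS prednK // subn_gt0.
    by apply: sS; rewrite subnS prednK ?subn_gt0 // leq_subr.
  move=> i ik; have e : (k - i = (k - i.+1).+1)%N by rewrite subnS prednK // subn_gt0.
  have kik : (k - i.+1 < k)%N by rewrite -e leq_subr.
  apply: affine_C1_curve (HC _ kik) => r; rewrite -e; lra.
- by have -> : -1 * a + (a + b) = b by ring.
- by have -> : -1 * b + (a + b) = a by ring.
- by apply: (affine_length_primitive N1 ab _ _ lp) => r; lra.
- rewrite (_ : -1 * b + (a + b) = a); last by lra.
  rewrite (_ : -1 * a + (a + b) = b); last by lra.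
  by lra.
Qed.

Lemma partition_le (a b : R) k s i j : interval_partition a b k s ->
  (i <= j)%N -> (j <= k)%N -> s i <= s j.
Proof.
move=> [_ _ _ sS]; elim: j => [|j IH]; first by rewrite leqn0 => /eqP ->.
rewrite leq_eqVlt => /predU1P[->//|ij] jk.
by apply: le_trans (IH ij (ltnW jk)) (ltW (sS _ jk)).
Qed.

Lemma joins_trans p q r l1 l2 : joins p q l1 -> joins q r l2 -> joins p r (l1 + l2).
Proof.
move=> [c1 [a1 [b1 [h1 [[k1 [s1 [[k10 s1a s1b s1S] HC1]]] c1a c1b lp1 ->]]]]].
move=> [c2 [a2 [b2 [h2 [[k2 [s2 [[k20 s2a s2b s2S] HC2]]] c2a c2b lp2 ->]]]]].
have [ab1 _ _ _] := lp1; have [ab2 _ _ _] := lp2.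
pose be := a2 - b1; pose b := b2 - be.
have E1 : `|1 : R| = 1 by rewrite normr1.
have bb : b1 < b by rewrite /b /be; lra.
pose c x := if x <= b1 then c1 x else c2 (1 * x + be).
have cc1 x : a1 <= x <= b1 -> c1 x = c x by rewrite /c => /andP[_ ->].
have cc2 x : b1 <= x <= b -> c2 (1 * x + be) = c x.
  move=> /andP[b1x _]; rewrite /c; case: leP => // xb1.
  have -> : x = b1 by apply/le_anti; rewrite xb1.
  have -> : 1 * b1 + be = a2 by rewrite /be; ring.
  by rewrite c1b.
have lp2' : lprim (fun x => c2 (1 * x + be)) b1 b (fun x => 1 * h2 (1 * x + be)).
  by apply: (affine_length_primitive E1 bb _ _ lp2) => x; rewrite /be /b /be; lra.
have lp := length_primitive_glue (eq_length_primitive cc1 lp1) (eq_length_primitive cc2 lp2').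
exists c, a1, b, (fun s => if s <= b1 then h1 s else 1 * h2 (1 * s + be) - 1 * h2 (1 * b1 + be) + h1 b1).
split => //.
- have ip1 : interval_partition a1 b1 k1 s1 by [].
  have ip2 : interval_partition a2 b2 k2 s2 by [].
  exists (k1 + k2)%N, (fun i => if (i <= k1)%N then s1 i else s2 (i - k1)%N - be).
  have E2 i : (k1 <= i)%N ->
      (if (i <= k1)%N then s1 i else s2 (i - k1)%N - be) = s2 (i - k1)%N - be.
    move=> k1i; case: leqP => // ik1; have -> : i = k1 by apply/eqP; rewrite eqn_leq ik1.
    by rewrite subnn s1b s2a /be; lra.
  split.
    split.
    + by rewrite addn_gt0 k10.
    + by rewrite leq0n.
    + by rewrite E2 ?leq_addr // addKn s2b.
    + move=> i ik; have [ik1|k1i] := ltnP i k1; first by rewrite (ltnW ik1); exact: s1S.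
      rewrite (E2 i) // subSn // ltrD2r; apply: s2S.
      by rewrite ltn_subLR.
  move=> i ik; have [ik1|k1i] := ltnP i k1.
    rewrite (ltnW ik1); apply: eq_C1_curve (HC1 _ ik1) => x /andP[x1 x2]; apply: cc1.
    by rewrite -s1a -s1b (le_trans (partition_le ip1 (leq0n i) (ltnW ik1)) x1)
      (le_trans x2 (partition_le ip1 ik1 (leqnn k1))).
  have ik2 : (i - k1 < k2)%N by rewrite ltn_subLR.
  rewrite (E2 i) // subSn //.
  apply: (@eq_C1_curve (fun x => c2 (1 * x + be))).
    move=> x /andP[x1 x2]; apply: cc2.
    have := partition_le ip2 (leq0n (i - k1)) (ltnW ik2); rewrite s2a.
    have := partition_le ip2 ik2 (leqnn k2); rewrite s2b.
    by move=> ? ?; apply/andP; split; rewrite /b /be in x1 x2 *; lra.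
  apply: affine_C1_curve (HC2 _ ik2) => x /andP[x1 x2]; apply/andP; split; lra.
- by rewrite -cc1 ?lexx ?ltW // .
- rewrite -cc2 ?lexx ?ltW //.
  by have -> : 1 * b + be = b2 by rewrite /b; ring.
- rewrite (ltW ab1) leNgt bb /=.
  rewrite (_ : 1 * b + be = b2); last by rewrite /b; lra.
  by rewrite (_ : 1 * b1 + be = a2); [lra|rewrite /be; lra].
Qed.

Lemma joins_refl p : joins p p 0.
Proof.
have C1c : C1_curve A (fun=> p) 0 1.
  exists (fun=> p) => s _; split => //; split; first exact: cst_continuous.
  by exists setT; [exact: filterT|exact: Ck_cst].
have pc : piecewise_C1_curve A (fun=> p) 0 1.
  exists 1%N, (fun i => i%:R); split; last by case.
  by split => //; case.
have [h [lp _]] := piecewise_primitive pc.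
exists (fun=> p), 0, 1, h; split => //.
apply/le_anti; rewrite (length_primitive_ge0 lp) /=.
have := primitive_le (B := 0) lp; rewrite mul0r; apply => s _ _.
rewrite /speed /velocity (_ : derive1 _ s = 0) ?(tnorm0 hsigma) //.
exact: derive1_cst.
Qed.

End joining.

Section distance.
Context (R : realType) (n : nat) (S : topologicalType).
Notation E := 'rV[R]_n.
Context (A : atlas E S) (sigma : S -> E -> E -> R).
Hypotheses (hS : smooth_manifold A) (hsigma : riemannian_metric A sigma).
Notation spd := (speed A sigma).
Notation tnorm := (tangent_norm sigma).
Notation coord c s := (phi (chart_at A (c s)) \o c : R^o -> E).
Notation lprim := (length_primitive A sigma).
Notation jn := (joins A sigma).
Notation ph p := (phi (chart_at A p)).

Let dom_at p : dom (chart_at A p) p.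
Proof. by have [_ [_ + _]] := hS; apply. Qed.

Lemma chart_section (i : chart_index A) x : (phi i @` dom i) x ->
  dom i (psi i x) /\ phi i (psi i x) = x.
Proof. by move=> [q iq <-]; rewrite (chart_cancel hS). Qed.

Lemma line_derive (f : E -> E) (x w : E) (v s : R^o) :
  'D_v (fun r : R^o => f (x + r *: w)) s = 'D_((v : R) *: w) f (x + s *: w).
Proof.
rewrite /derive; suff -> : (fun h : R => h^-1 *: (((fun r : R^o => f (x + r *: w)) \o shift s) (h *: v)
    - f (x + s *: w))) =
  (fun h : R => h^-1 *: ((f \o shift (x + s *: w)) (h *: ((v : R) *: w)) - f (x + s *: w))) by [].
apply/funext => h /=; congr (_ *: (f _ - _)).
by rewrite [h *: v]/(h * v) scalerDl scalerA addrCA.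
Qed.

Lemma segment_C1 (i : chart_index A) (x w : E) s : (phi i @` dom i) (x + s *: w) ->
  C1_at A (fun r : R => psi i (x + r *: w)) s.
Proof.
move=> is_; set c := fun r : R => psi i (x + r *: w).
have cl (r : R) : {for r, continuous (fun r : R => x + r *: w)}.
  apply: (@continuousD _ _ _ (cst x) (fun r : R => r *: w)); first exact: cst_continuous.
  exact: scalel_continuous.
have dl (r : R^o) : differentiable (fun r : R^o => x + r *: w) r.
  by apply: differentiableD; [exact: differentiable_cst|exact: ex_diff].
split; first by apply: (continuous_comp (cl s)); exact: (psi_continuous hS).
set j := chart_at A (c s).
have [_ [_ _ tr]] := hS; have [dt Dt] := tr i j 1%N.
have oU := open_transition_domain hS i j.
exists ((fun r : R => x + r *: w) @^-1` (phi i @` (dom i `&` dom j))).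
  apply: cl; apply: open_nbhs_nbhs; split => //.
  have [d1 d2] := chart_section is_.
  by exists (c s) => //; split => //; exact: dom_at.
split=> [r Nr|v].
  apply: (@differentiable_comp _ _ _ _ (fun r : R^o => x + r *: w) (phi j \o psi i)).
    exact: dl.
  exact: dt.
have -> : (fun r : R^o => 'D_v (phi j \o c : R^o -> E) r) =
    (fun r => 'D_((v : R) *: w) (phi j \o psi i) (x + (r : R) *: w)).
  by apply/funext => r; exact: line_derive.
move=> r Nr; apply: (@continuous_comp _ _ _ (fun r : R => x + r *: w) ('D_((v : R) *: w) (phi j \o psi i))).
  exact: cl.
exact: Dt.
Qed.

Lemma ball_convex (x0 x y : E) (r s : R) : ball x0 r x -> ball x0 r y -> 0 <= s <= 1 ->
  ball x0 r (x + s *: (y - x)).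
Proof.
rewrite -!ball_normE /= => xr yr /andP[s0 s1].
have -> : x0 - (x + s *: (y - x)) = (1 - s) *: (x0 - x) + s *: (x0 - y).
  have -> : x0 - y = (x0 - x) + (x - y) by rewrite addrA subrK.
  by rewrite (scalerDr s (x0 - x) (x - y)) [RHS]addrA -scalerDl subrK scale1r opprD -scalerN opprB addrA.
apply: le_lt_trans (ler_normD _ _) _; rewrite !normrZ !ger0_norm ?subr_ge0 //.
have [->|s0'] := eqVneq s 0; first by rewrite subr0 mul1r mul0r addr0.
have {}s0 : 0 < s by rewrite lt_neqAle eq_sym s0'.
have : s * `|x0 - y| < s * r by rewrite ltr_pM2l.
have : (1 - s) * `|x0 - x| <= (1 - s) * r by rewrite ler_wpM2l ?subr_ge0 // ltW.
lra.
Qed.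

Lemma segment_joins p e : 0 < e -> exists2 U, nbhs p U & forall y z, U y -> U z ->
  dom (chart_at A p) y /\
  exists2 l, jn y z l & l <= (1 + e) * tnorm p (ph p z - ph p y).
Proof.
move=> e0; have [r r0 Hr] := chart_metric_compare hS hsigma p e0; set i := chart_at A p in Hr *.
exists (dom i `&` phi i @^-1` ball (phi i p) r).
  apply: filterI; first exact/(nbhs_dom hS)/dom_at.
  by apply: (phi_continuous hS (dom_at p)); exact: nbhsx_ballx.
move=> y z [iy by_] [iz bz]; split => //.
set x := phi i y; set w := phi i z - x; pose c s := psi i (x + s *: w).
have xb s : 0 <= s <= 1 -> ball (phi i p) r (x + s *: w) by exact: ball_convex.
have C1c : C1_curve A c 0 1.
  exists c => s; rewrite in_itv /= => s01; split => //.
  by apply: segment_C1; have [] := Hr _ (xb _ s01).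
have [h [lp _ _]] := C1_curve_primitive hS hsigma ltr01 C1c.
have pc : piecewise_C1_curve A c 0 1.
  exists 1%N, (fun i => i%:R); split; last by case.
  by split => //; case.
exists (h 1 - h 0).
  exists c, 0, 1, h; split => //.
    by rewrite /c scale0r addr0 /x (chart_cancel hS).
  by rewrite /c scale1r /w addrC subrK (chart_cancel hS).
rewrite -[leRHS]mulr1 -[X in _ * X]subr0; apply: (primitive_le lp) => s s0 s1.
have s01 : 0 <= s <= 1 by rewrite !ltW.
have [is_ cmp] := Hr _ (xb _ s01); have [ic iE] := chart_section is_.
have nE : {near (s : R^o), (fun r : R^o => x + r *: w) =1 phi i \o c}.
  near=> u; rewrite /= /c; have [|_ ->//] := chart_section (i := i) (x := x + u *: w).
  have [] := Hr (x + u *: w) => //; apply: xb; apply/andP; split; apply: ltW; near: u.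
    exact: lt_nbhsr.
  exact: lt_nbhsl.
have dl : is_derive (s : R^o) 1 (fun r : R^o => x + r *: w) w.
  rewrite -[w in X in is_derive _ _ _ X]add0r; apply: is_deriveD.
  apply: DeriveDef; first exact/derivable1_diffP/ex_diff.
  by rewrite deriveE // diff_val scale1r.
have [dl1 dl2] := dl.
have d := near_eq_derivable nE dl1.
have dE : derive1 (phi i \o c : R^o -> E) s = w.
  by rewrite derive1E -dl2; apply/esym; exact: near_eq_derive.
have cc : {for s, continuous c}.
  have [C1s _] : C1_at A c s by apply: segment_C1.
  exact: C1s.
have [_ ->] := velocity_chart sigma hS cc ic d.
by rewrite dE /c iE; have [] := cmp w.
Unshelve. all: by end_near. Qed.

End distance.

Section distance_function.
Context (R : realType) (n : nat) (S : topologicalType).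
Notation E := 'rV[R]_n.
Context (A : atlas E S) (sigma : S -> E -> E -> R).
Hypotheses (hS : smooth_manifold A) (hsigma : riemannian_metric A sigma).
Notation spd := (speed A sigma).
Notation tnorm := (tangent_norm sigma).
Notation lprim := (length_primitive A sigma).
Notation jn := (joins A sigma).
Notation ph p := (phi (chart_at A p)).

Let dom_at p : dom (chart_at A p) p.
Proof. by have [_ [_ + _]] := hS; apply. Qed.

Lemma joins_connected p q : exists l, jn p q l.
Proof.
have [[_ conn _] _] := hS.
pose B := [set q | exists l, jn p q l].
have BT : B = setT.
  apply: conn.
  - by exists p, 0; exact: joins_refl.
  - exists B; last by rewrite setTI.
    rewrite openE => z [l pz]; have [U nU HU] := segment_joins hS hsigma z ltr01.
    have Uz := nbhs_singleton nU.
    apply: filterS nU => w Uw; have [_ [l' zw _]] := HU _ _ Uz Uw.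
    by exists (l + l'); exact: (joins_trans hsigma pz zw).
  - exists B; last by rewrite setTI.
    move=> z Bz; have [U nU HU] := segment_joins hS hsigma z ltr01.
    have [w [[l pw] Uw]] := Bz _ nU; have [_ [l' wz _]] := HU _ _ Uw (nbhs_singleton nU).
    by exists (l + l'); exact: (joins_trans hsigma pw wz).
by have : B q by rewrite BT.
Qed.

Definition dist (p q : S) : R := inf [set l | jn p q l].

Let jn_lb p q : has_lbound [set l | jn p q l].
Proof. by exists 0 => l; exact: joins_ge0. Qed.

Let jn_ne p q : [set l | jn p q l] !=set0.
Proof. exact: joins_connected. Qed.

Lemma dist_le p q l : jn p q l -> dist p q <= l.
Proof. by move=> pq; apply: (ge_inf (jn_lb p q)). Qed.

Lemma le_dist p q m : (forall l, jn p q l -> m <= l) -> m <= dist p q.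
Proof. by move=> H; apply: (lb_le_inf (jn_ne p q)). Qed.

Lemma dist_lt p q l : dist p q < l -> exists2 l', jn p q l' & l' < l.
Proof. exact: (inf_lt (jn_ne p q)). Qed.

Lemma riemannian_dist p q : riemannian_distance A sigma p q = (dist p q)%:E.
Proof. by rewrite (riemannian_distanceE hS hsigma) (ereal_inf_EFin (jn_lb p q) (jn_ne p q)). Qed.

Lemma dist_ge0 p q : 0 <= dist p q.
Proof. by apply: le_dist => l; exact: joins_ge0. Qed.

Lemma dist_refl p : dist p p = 0.
Proof. by apply/le_anti; rewrite dist_ge0 andbT; apply/dist_le/joins_refl. Qed.

Lemma dist_sym p q : dist p q = dist q p.
Proof.
by apply/le_anti/andP; split; apply: le_dist => l /(joins_sym hsigma)/dist_le.
Qed.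

Lemma dist_triangle p q r : dist p r <= dist p q + dist q r.
Proof.
rewrite -lerBlDr; apply: le_dist => l pq; rewrite lerBlDr -lerBlDl.
by apply: le_dist => l' qr; rewrite lerBlDl; exact/dist_le/(joins_trans hsigma pq qr).
Qed.

Lemma segment_dist p e : 0 < e -> exists2 U, nbhs p U & forall y z, U y -> U z ->
  dom (chart_at A p) y /\ dist y z <= (1 + e) * tnorm p (ph p z - ph p y).
Proof.
move=> /(segment_joins hS hsigma p)[U nU HU]; exists U => // y z Uy Uz.
by have [iy [l /dist_le yz lz]] := HU y z Uy Uz; split => //; exact: le_trans lz.
Qed.

Lemma dist_lipschitz q y z : `|dist q z - dist q y| <= dist y z.
Proof.
have := dist_triangle q y z; have := dist_triangle q z y; rewrite (dist_sym z y).
by rewrite ler_norml => ? ?; apply/andP; split; lra.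
Qed.

Lemma calibrated_dist q : calibrated A sigma (dist q).
Proof.
move=> p e e0; have [U nU HU] := segment_dist p e0; exists U => // y Uy.
apply: le_trans (dist_lipschitz _ _ _) _.
by have [] := HU _ _ (nbhs_singleton nU) Uy.
Qed.

Lemma transition_diffK (i j : chart_index A) q w : dom i q -> dom j q ->
  transition_diff i j q (transition_diff j i q w) = w.
Proof.
move=> iq jq; have d1 := transition_differentiable hS jq iq.
have d2 := transition_differentiable hS iq jq.
have e : (phi i \o psi j) (phi j q) = phi i q by rewrite /= (chart_cancel hS).
have d2' : differentiable (phi j \o psi i) ((phi i \o psi j) (phi j q)) by rewrite e.
have oU := open_transition_domain hS j i.
have nE : {near phi j q, (phi j \o psi i) \o (phi i \o psi j) =1 id}.
  have : nbhs (phi j q) (phi j @` (dom j `&` dom i)).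
    by apply: open_nbhs_nbhs; split => //; exists q.
  by apply: filterS => _ [z [jz iz] <-] /=; rewrite !(chart_cancel hS).
have [_ D] := near_eq_differentiable nE (differentiable_comp d1 d2').
have e1 : 'd (@id E) (phi j q) w = w by rewrite diff_val.
rewrite -[RHS]e1 D (diff_comp d1 d2').
by rewrite /transition_diff /= -[in LHS]e.
Qed.

Lemma calibrated_truncated_chart p e : 0 < e -> e < 1 -> exists W, exists2 rho, 0 < rho &
  [/\ open W, W p, W `<=` dom (chart_at A p) &
   forall y, W y -> tnorm p (ph p y - ph p p) < rho -> forall z l, jn y z l ->
     (W z -> (1 - e) * Num.min (tnorm p (ph p z - ph p y)) rho <= l) /\
     (~ W z -> (1 - e) * rho <= l)].
Proof.
move=> e0 e1; have [r r0 Hr] := chart_metric_compare hS hsigma p e0.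
set i := chart_at A p in Hr *.
have [C C0 HC] := tnorm_lower hsigma p.
pose rho := r / (4 * C).
have rho0 : 0 < rho by rewrite divr_gt0 // mulr_gt0.
have rhoE : C * (2 * rho) = r / 2 by rewrite /rho; field; rewrite gt_eqF.
pose W := dom i `&` phi i @^-1` ball (phi i p) r.
have oW : open W.
  rewrite openE => z [iz bz]; apply: filterI; first exact: (nbhs_dom hS).
  apply: (phi_continuous hS iz); apply: open_nbhs_nbhs; split => //; exact: ball_open.
have Wp : W p by split; [exact: dom_at|exact: ballxx].
exists W, rho => //; split => //; first by move=> z [].
move=> y Wy yrho.
(* Truncated at rho, the norm in the chart extends continuously to S. *)
pose F z := (1 - e) * (if `[< W z >] then Num.min (tnorm p (phi i z - phi i y)) rho else rho).
suff cF : calibrated A sigma F.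
  move=> z l [c [a [b [h [_ ca cb lp ->]]]]].
  have Fy : F y = 0 by rewrite /F asboolT // subrr (tnorm0 hsigma) min_l ?mulr0 // ltW.
  have := calibrated_le hS hsigma cF lp; rewrite ca cb Fy subr0 /F => H.
  by split => Wz; move: H; [rewrite asboolT|rewrite asboolF].
move=> q d d0; set j := chart_at A q.
have [Wq|nWq] := pselect (W q); last first.
  pose Bc := closed_ball (phi i p) (r / 2).
  have sub : Bc `<=` phi i @` dom i.
    move=> x; rewrite /Bc closed_ballE ?divr_gt0 // /closed_ball_ /= => xr.
    have [] // := Hr x; rewrite -ball_normE /=; apply: le_lt_trans xr _; lra.
  have cBc : compact Bc.
    apply: bounded_closed_compact; last exact: closed_ball_closed.
    exists (`|phi i p| + r); split; first exact: num_real.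
    move=> M Mr x; rewrite /Bc closed_ballE ?divr_gt0 // /closed_ball_ /= => xr.
    have -> : x = phi i p - (phi i p - x) by rewrite subKr.
    apply: le_trans (ler_normB _ _) _; lra.
  have cK : closed (psi i @` Bc).
    have [[haus _ _] _] := hS; apply: compact_closed => //.
    apply: continuous_compact => //; apply: continuous_in_subspaceT => x xB.
    by apply: (psi_continuous hS); apply: sub; exact: set_mem.
  have out z : ~ (psi i @` Bc) z -> F z = (1 - e) * rho.
    move=> nz; rewrite /F; case: asboolP => // -[iz bz]; rewrite min_r // leNgt.
    apply/negP => zy; apply: nz; exists (phi i z); last by rewrite (chart_cancel hS).
    rewrite /Bc closed_ballE ?divr_gt0 // /closed_ball_ /= distrC.
    apply: le_trans (HC _) _; rewrite -rhoE ler_wpM2l ?(ltW C0) //.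
    apply: le_trans (form_norm_distD _ _ _ (phi i y) _) _.
      by have [[+ _] _] := hsigma; apply.
      by have [_ +] := hsigma; apply.
    rewrite -/(tnorm p _) -/(tnorm p _); lra.
  exists (~` (psi i @` Bc)).
    apply: open_nbhs_nbhs; split; first exact: closed_openC.
    move=> [x Bx xq]; apply: nWq; rewrite -xq.
    have [ix xE] := chart_section hS (sub _ Bx); split => //; rewrite /= xE.
    move: Bx; rewrite /Bc closed_ballE ?divr_gt0 // /closed_ball_ /= -ball_normE /= => xr.
    by apply: le_lt_trans xr _; lra.
  move=> z nz; rewrite (out z nz) (out q).
    by rewrite subrr normr0 mulr_ge0 ?tnorm_ge0 // addr_ge0 // ltW.
  move=> [x Bx xq]; apply: nWq; rewrite -xq.
  have [ix xE] := chart_section hS (sub _ Bx); split => //; rewrite /= xE.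
  move: Bx; rewrite /Bc closed_ballE ?divr_gt0 // /closed_ball_ /= -ball_normE /= => xr.
  by apply: le_lt_trans xr _; lra.
have [iq bq] := Wq.
have [_ cmp] := Hr _ bq.
have [Cu Cu0 HCu] := tnorm_upper hsigma p.
have [Cl Cl0 HCl] := tnorm_lower hsigma q.
have dt := transition_differentiable hS (dom_at q) iq.
have eta0 : 0 < d / (Cu * Cl) by rewrite divr_gt0 // mulr_gt0.
have Hd := differentiable_eps dt eta0.
pose w z := phi j z - phi j q.
have nw : \forall z \near q, `|phi i z - phi i q - transition_diff j i q (w z)| <= d / (Cu * Cl) * `|w z|.
  have cw : w z @[z --> q] --> (0 : E).
    rewrite -(subrr (phi j q)); apply: cvgB; last exact: cvg_cst.
    exact: (phi_continuous hS (dom_at q)).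
  have := cw _ Hd; apply: filterS2 (nbhs_dom hS (dom_at q)) => z jz /=.
  rewrite /w subrK /= (chart_cancel hS) // (chart_cancel hS) ?dom_at //.
  by rewrite opprD addrA.
exists (W `&` [set z | `|phi i z - phi i q - transition_diff j i q (w z)| <= d / (Cu * Cl) * `|w z|]).
  by apply: filterI => //; apply: open_nbhs_nbhs.
move=> z [Wz Hz]; rewrite /F !asboolT // -mulrBr normrM (ger0_norm (_ : 0 <= 1 - e)); last by lra.
set u := transition_diff j i q (w z) in Hz.
have t1 : tnorm p (phi i z - phi i q) <= tnorm p u + d * tnorm q (w z).
  rewrite -[X in tnorm p X](subrK u) addrC; apply: le_trans (tnormD hsigma _ _ _) _.
  rewrite lerD2l; apply: le_trans (HCu _) _.
  apply: (@le_trans _ _ (Cu * (d / (Cu * Cl) * (Cl * tnorm q (w z))))).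
    rewrite ler_wpM2l ?(ltW Cu0) //; apply: le_trans Hz _.
    by rewrite ler_wpM2l ?(ltW eta0).
  by rewrite le_eqVlt; apply/orP; left; apply/eqP; field; rewrite !gt_eqF.
have t2 : (1 - e) * tnorm p u <= tnorm q (w z).
  have [+ _] := cmp u; move=> /le_trans; apply.
  rewrite /form_norm /chart_metric (chart_cancel hS) // /of_chart -/j transition_diffK //.
  exact: dom_at.
have t3 : `|Num.min (tnorm p (phi i z - phi i y)) rho - Num.min (tnorm p (phi i q - phi i y)) rho|
    <= tnorm p (phi i z - phi i q).
  have ssym : symmetric_bilinear (sigma p) by have [[+ _] _] := hsigma; apply.
  have spos : forall v, v != 0 -> 0 < sigma p v v by have [_ +] := hsigma; apply.
  have h1 := form_norm_distD ssym spos (phi i z) (phi i q) (phi i y).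
  have h2 := form_norm_distD ssym spos (phi i q) (phi i z) (phi i y).
  rewrite -[phi i q - phi i z]opprB (form_normN ssym) in h2.
  have h3 := tnorm_ge0 sigma p (phi i z - phi i q).
  move: h1 h2 h3; rewrite /tangent_norm ler_norml.
  by case: (leP _ rho) => ?; case: (leP _ rho) => ? ? ? ?; apply/andP; split; lra.
have w0 := tnorm_ge0 sigma q (w z).
have e1' : 0 <= 1 - e by lra.
apply: (@le_trans _ _ ((1 - e) * (tnorm p u + d * tnorm q (w z)))).
  by rewrite ler_wpM2l //; exact: le_trans t3 t1.
have := mulr_ge0 (mulr_ge0 (ltW e0) (ltW d0)) w0; rewrite -/(w z); nra.
Qed.

Lemma dist_lower p e : 0 < e -> e < 1 -> exists W, exists2 rho, 0 < rho &
  [/\ open W, W p, W `<=` dom (chart_at A p) &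
   forall y, W y -> tnorm p (ph p y - ph p p) < rho -> forall z,
     (W z -> (1 - e) * Num.min (tnorm p (ph p z - ph p y)) rho <= dist y z) /\
     (~ W z -> (1 - e) * rho <= dist y z)].
Proof.
move=> e0 e1; have [W [rho rho0 [oW Wp Wd H]]] := calibrated_truncated_chart p e0 e1.
exists W, rho => //; split => // y Wy yr z.
by split => Wz; apply: le_dist => l yz; have [h1 h2] := H y Wy yr z l yz; [exact: h1|exact: h2].
Qed.

Lemma near_tnorm p r : 0 < r -> \forall y \near p, tnorm p (ph p y - ph p p) < r.
Proof.
move=> r0; have [C C0 HC] := tnorm_upper hsigma p.
have /cvgrPdist_lt /(_ (r / C)) H := phi_continuous hS (dom_at p).
have := H (divr_gt0 r0 C0); apply: filterS => y; rewrite distrC => yr.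
by apply: le_lt_trans (HC _) _; rewrite mulrC -ltr_pdivlMr.
Qed.

Lemma dist_two_sided p e : 0 < e -> e < 1 -> exists2 U, nbhs p U & forall y z, U y -> U z ->
  [/\ dom (chart_at A p) y, (1 - e) * tnorm p (ph p z - ph p y) <= dist y z &
      dist y z <= (1 + e) * tnorm p (ph p z - ph p y)].
Proof.
move=> e0 e1; have [W [rho rho0 [oW Wp Wd H]]] := dist_lower p e0 e1.
have [U nU HU] := segment_dist p e0.
have r2 : 0 < rho / 2 by rewrite divr_gt0.
exists (U `&` W `&` [set y | tnorm p (ph p y - ph p p) < rho / 2]).
  apply: filterI; last exact: near_tnorm.
  by apply: filterI => //; apply: open_nbhs_nbhs.
move=> y z [[Uy Wy] yr] [[Uz Wz] zr].
have [iy up] := HU y z Uy Uz; split => //.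
have yr' : tnorm p (ph p y - ph p p) < rho by move: yr => /=; lra.
have [+ _] := H y Wy yr' z; move=> /(_ Wz); rewrite min_l //.
have ssym : symmetric_bilinear (sigma p) by have [[+ _] _] := hsigma; apply.
have spos : forall v, v != 0 -> 0 < sigma p v v by have [_ +] := hsigma; apply.
have := form_norm_distD ssym spos (ph p z) (ph p p) (ph p y).
rewrite -[ph p p - ph p y]opprB (form_normN ssym).
move: yr zr; rewrite /tangent_norm /=; lra.
Qed.

Lemma dist_nbhs p U : nbhs p U -> exists2 d, 0 < d & forall z, dist p z < d -> U z.
Proof.
move=> nU; have e0 : 0 < (2^-1 : R) by rewrite invr_gt0.
have e1 : 2^-1 < 1 :> R by rewrite invf_lt1 // ltr1n.
have [W [rho rho0 [oW Wp Wd H]]] := dist_lower p e0 e1.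
have [C C0 HC] := tnorm_lower hsigma p.
have ip : (phi (chart_at A p) @` dom (chart_at A p)) (ph p p) by exists p => //; exact: dom_at.
have := psi_continuous hS ip; rewrite /prop_for /continuous_at (chart_cancel hS) ?dom_at //.
move=> /(_ _ nU) /nbhs_ballP[r /= r0 Hr].
have rC : 0 < r / C by rewrite divr_gt0.
exists ((1 - 2^-1) * Num.min (r / C) rho).
  by rewrite mulr_gt0 ?subr_gt0 // lt_min rC.
move=> z zd; have p0 : tnorm p (ph p p - ph p p) < rho by rewrite subrr (tnorm0 hsigma).
have [HW nHW] := H p Wp p0 z.
have e2 : 0 < 1 - 2^-1 :> R by rewrite subr_gt0.
have [Wz|/nHW h] := pselect (W z); last first.
  by move: (le_lt_trans h zd); rewrite ltr_pM2l // lt_min ltxx andbF.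
have := le_lt_trans (HW Wz) zd; rewrite ltr_pM2l // lt_min => /andP[+ h2].
have tr : tnorm p (ph p z - ph p p) < rho by move: h2; rewrite gt_min ltxx orbF.
rewrite min_l ?(ltW tr) // => h1.
rewrite -(chart_cancel hS (Wd _ Wz)); apply: Hr; rewrite -ball_normE /= distrC.
by apply: le_lt_trans (HC _) _; rewrite mulrC -ltr_pdivlMr.
Qed.

Lemma dist_eq0 p q : dist p q = 0 -> p = q.
Proof.
move=> pq; have [[haus _ _] _] := hS; apply: haus => U V nU nV.
have [d d0 Hd] := dist_nbhs nU.
exists q; split; last exact: nbhs_singleton.
by apply: Hd; rewrite pq.
Qed.

End distance_function.

(** * Causal curves of the product *)

Lemma derivable1_pairP (R : realType) (V W : normedModType R) (f : R^o -> V) (g : R^o -> W)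
    (s : R^o) :
  (derivable (fun r => (f r, g r)) s 1 <-> derivable f s 1 /\ derivable g s 1) /\
  (derivable (fun r => (f r, g r)) s 1 ->
   derive1 (fun r => (f r, g r)) s = (derive1 f s, derive1 g s)).
Proof.
have H : derivable (fun r => (f r, g r)) s 1 <-> derivable f s 1 /\ derivable g s 1.
  split=> [|[]] /derivable1_diffP d1; last first.
    by move=> /derivable1_diffP d2; apply/derivable1_diffP; exact: differentiable_pair.
  have [d2 _] := is_diff_fst ((f s, g s) : V * W).
  have [d3 _] := is_diff_snd ((f s, g s) : V * W).
  split; apply/derivable1_diffP.
    exact: (differentiable_comp d1 d2).
  exact: (differentiable_comp d1 d3).
split=> // d; have [d1 d2] := H.1 d.
move/derivable1_diffP: d => d; move/derivable1_diffP: d1 => d1; move/derivable1_diffP: d2 => d2.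
by rewrite (derive1E' d) (derive1E' d1) (derive1E' d2) diff_pair.
Qed.

Lemma lipschitz_onP (R : realType) (V W : normedModType R) (f : V -> W) (D : set V) :
  [lipschitz f x | x in D] <->
  exists2 K, 0 <= K & forall x y, D x -> D y -> `|f x - f y| <= K * `|x - y|.
Proof.
split=> [[M [_ HM]]|[K K0 HK]].
  exists (`|M| + 1) => [|x y Dx Dy]; first by rewrite addr_ge0.
  have MM : M < `|M| + 1 by apply: le_lt_trans (ler_norm _) _; rewrite ltrDl.
  by have := HM _ MM (x, y); apply.
exists K; split; first exact: num_real.
move=> M KM [x y] [/= Dx Dy]; apply: le_trans (HK x y Dx Dy) _.
by rewrite ler_wpM2r // ltW.
Qed.

Lemma ae_impl (R : realType) (P Q : R -> Prop) : (forall s, P s -> Q s) ->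
  {ae @lebesgue_measure R, forall s, P s} -> {ae @lebesgue_measure R, forall s, Q s}.
Proof.
move=> PQ; apply: filterS PQ; exact: (ae_filter_ringOfSetsType (@lebesgue_measure R)).
Qed.

Section causal_coordinates.
Context (R : realType) (n : nat) (S : topologicalType).
Notation E := 'rV[R]_n.
Context (A : atlas E S) (sigma : S -> E -> E -> R).
Hypotheses (hS : smooth_manifold A) (hsigma : riemannian_metric A sigma).
Notation spd := (speed A sigma).
Notation A' := (product_atlas A).
Notation X := (@partial_t R E S).
Notation mu := (@lebesgue_measure R).
Notation d := (dist A sigma).

Definition locally_lipschitz_pair (c1 : R -> R) (c2 : R -> S) (a b : R) :=
  {within `[a, b], continuous c2} /\
  forall s, a <= s <= b -> exists N K, [/\ nbhs s N, 0 <= K &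
    forall r r', N r -> N r' -> a <= r <= b -> a <= r' <= b ->
    `|c1 r - c1 r'| <= K * `|r - r'| /\
    `|phi (chart_at A (c2 s)) (c2 r) - phi (chart_at A (c2 s)) (c2 r')| <= K * `|r - r'|].

Lemma locally_lipschitz_pair_continuous c1 c2 a b :
  locally_lipschitz_pair c1 c2 a b -> {within `[a, b], continuous c1}.
Proof.
move=> [_ Hc]; apply/subspace_continuousP => s; rewrite /= in_itv /= => sab.
have [N [K [nN K0 HK]]] := Hc s sab.
apply/cvgrPdist_le => e e0; rewrite near_withinE.
have e1 : 0 < e / (K + 1) by rewrite divr_gt0 // ltr_wpDl.
have nB : nbhs s (ball s (e / (K + 1))) by exact: nbhsx_ballx.
have Ns := nbhs_singleton nN.
apply: filterS2 nN nB => r Nr /=; rewrite -ball_normE /= => rs.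
rewrite in_itv /= => rab; have [h _] := HK s r Ns Nr sab rab.
apply: le_trans h _; have : (K + 1) * `|s - r| <= e by rewrite mulrC -ler_pdivlMr ?ltr_wpDl // ltW.
have := normr_ge0 (s - r); nra.
Qed.

Lemma locally_lipschitz_productP (c : R -> R^o * S) a b :
  locally_lipschitz_curve A' c a b <->
  locally_lipschitz_pair (fun s => (c s).1) (fun s => (c s).2) a b.
Proof.
split=> [[cc Hc]|[cc Hc]]; split.
- move=> x; apply: (@continuous_comp _ _ _ (c : subspace `[a, b] -> R^o * S) snd); first exact: cc.
  exact: cvg_snd.
- move=> s sab; have [|N nN /lipschitz_onP[K K0 HK]] := Hc s; first by rewrite in_itv.
  exists N, K; split => // r r' Nr Nr' rab r'ab.
  have Ir : (N `&` `[a, b]) r by split => //; rewrite /= in_itv.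
  have Ir' : (N `&` `[a, b]) r' by split => //; rewrite /= in_itv.
  by have := HK r r' Ir Ir'; rewrite /= prod_normE /= ge_max => /andP[].
- apply/subspace_continuousP => s; rewrite /= in_itv /= => sab.
  have sI : (`[a, b]%classic : set R) s by rewrite /= in_itv.
  have c2c : (fun s => (c s).2) @ within `[a, b] (nbhs s) --> (c s).2.
    by move/subspace_continuousP : cc => /(_ _ sI).
  have c1c : (fun s => (c s).1) @ within `[a, b] (nbhs s) --> (c s).1.
    have /subspace_continuousP/(_ _ sI) := locally_lipschitz_pair_continuous (conj cc Hc).
    exact.
  move=> P nP; have nP' : nbhs ((c s).1, (c s).2) P by rewrite -surjective_pairing.
  have H : nbhs s [set r | (`[a, b]%classic : set R) r -> P ((c r).1, (c r).2)] :=
    @cvg_pair _ _ _ _ _ _ (within_filter _ (nbhs_filter s)) (nbhs_filter _) (nbhs_filter _)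
      _ _ c1c c2c P nP'.
  change (nbhs s [set r | (`[a, b]%classic : set R) r -> P (c r)]).
  by apply: (@filterS _ _ (nbhs_filter s) _ _ _ H) => r /=; rewrite -surjective_pairing.
- move=> s; rewrite in_itv /= => sab; have [N [K [nN K0 HK]]] := Hc s sab.
  exists N => //; apply/lipschitz_onP; exists K => // r r' [Nr +] [Nr' +].
  rewrite /= !in_itv /= => rab r'ab; rewrite prod_normE /= ge_max.
  by have [-> ->] := HK r r' Nr Nr' rab r'ab.
Qed.

(* Future causality of (c1, c2) for - k dt^2 + sigma. *)
Definition causal_pair (k : R) (c1 : R -> R) (c2 : R -> S) (a b : R) :=
  [/\ a < b, locally_lipschitz_pair c1 c2 a b &
   {ae mu, forall s, s \in `]a, b[ ->
      [/\ derivable (c1 : R -> R^o) s 1, derivable (phi (chart_at A (c2 s)) \o c2 : R^o -> E) s 1,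
          0 < derive1 (c1 : R -> R^o) s
        & spd c2 s ^+ 2 <= k * derive1 (c1 : R -> R^o) s ^+ 2]}].

Let ssym p : symmetric_bilinear (sigma p).
Proof. by have [[+ _] _] := hsigma; apply. Qed.

Let spos p v : v != 0 -> 0 < sigma p v v.
Proof. by have [_ +] := hsigma; apply. Qed.

Lemma future_directedP k (p : R^o * S) (v : R^o * E) : 0 < k ->
  future_directed (scaled_product_metric sigma k) X p v <->
  0 < v.1 /\ tangent_norm sigma p.2 v.2 ^+ 2 <= k * v.1 ^+ 2.
Proof.
move=> k0; rewrite /future_directed /causal_vector /timelike /null_vector.
rewrite /scaled_product_metric /= (sbfC (ssym _) v.2 0) (sbf0l (ssym _)) addr0 mulr1.
rewrite oppr_lt0 pmulr_rgt0 // /tangent_norm (sqr_form_norm (ssym _) (@spos _)) -expr2.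
split=> [[[[_ h]|[_ h]] v0]|[v0 h]]; first by split => //; lra.
  by split => //; lra.
have vn0 : v != 0 by apply/eqP => v_0; rewrite v_0 ltxx in v0.
split => //; move: h; rewrite le_eqVlt => /predU1P[h|h].
  by right; split => //; rewrite h addNr.
by left; split => //; lra.
Qed.

Lemma product_velocity (c : R -> R^o * S) (s : R) :
  (derivable (@phi _ _ _ A' (@chart_at _ _ _ A' (c s)) \o c : R^o -> R^o * E) s 1 <->
   derivable (fun r => (c r).1 : R^o) s 1 /\
   derivable (phi (chart_at A (c s).2) \o (fun r => (c r).2) : R^o -> E) s 1) /\
  (derivable (@phi _ _ _ A' (@chart_at _ _ _ A' (c s)) \o c : R^o -> R^o * E) s 1 ->
   velocity A' c s = (derive1 (fun r => (c r).1 : R^o) s, velocity A (fun r => (c r).2) s)).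
Proof.
exact: (derivable1_pairP (fun r : R^o => (c r).1 : R^o)
  (phi (chart_at A (c s).2) \o (fun r => (c r).2) : R^o -> E) s).
Qed.

Lemma future_causalP k c a b : 0 < k ->
  future_causal_curve A' (scaled_product_metric sigma k) X c a b <->
  causal_pair k (fun s => (c s).1) (fun s => (c s).2) a b.
Proof.
move=> k0; split=> [] [ab llc ae]; split => //.
- exact/locally_lipschitz_productP.
- apply: ae_impl ae => s H sab; have [dc /(future_directedP _ _ k0)] := H sab.
  have [[+ _] +] := product_velocity c s; move=> /(_ dc)[d1 d2] /(_ dc) ->.
  by move=> [? ?].
- exact/locally_lipschitz_productP.
- apply: ae_impl ae => s H sab; have [d1 d2 c1 c2] := H sab.
  have [[_ +] +] := product_velocity c s; move=> /(_ (conj d1 d2)) dc /(_ dc) vE.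
  by split => //; apply/(future_directedP _ _ k0); rewrite vE.
Qed.

Lemma locally_lipschitz_pairN c1 c2 a b :
  locally_lipschitz_pair c1 c2 a b -> locally_lipschitz_pair (fun s => - c1 s) c2 a b.
Proof.
move=> [cc H]; split => // s /H[N [K [nN K0 HK]]]; exists N, K; split => // r r' Nr Nr' rab r'ab.
by rewrite -opprD normrN; exact: HK.
Qed.

Lemma past_causalP k c a b : 0 < k ->
  past_causal_curve A' (scaled_product_metric sigma k) X c a b <->
  causal_pair k (fun s => - (c s).1) (fun s => (c s).2) a b.
Proof.
move=> k0; split=> [] [ab llc ae]; split => //.
- exact/locally_lipschitz_pairN/locally_lipschitz_productP.
- apply: ae_impl ae => s H sab; have [dc /(future_directedP _ _ k0)] := H sab.
  have [[+ _] +] := product_velocity c s; move=> /(_ dc)[d1 d2] /(_ dc) ->.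
  rewrite /= (tnormN hsigma) => -[h1 h2].
  have Hd : is_derive (s : R^o) 1 (fun r => - (c r).1 : R^o) (- derive1 (fun r => (c r).1 : R^o) s).
    by apply: is_deriveN; apply: DeriveDef => //; rewrite -derive1E.
  have [dN dNE] := Hd.
  by split => //; rewrite derive1E dNE.
- apply/locally_lipschitz_productP; have := locally_lipschitz_pairN llc.
  by congr locally_lipschitz_pair; apply/funext => s; rewrite opprK.
- apply: ae_impl ae => s H sab; have [d1 d2 c1 c2] := H sab.
  have Hd : is_derive (s : R^o) 1 (fun r => (c r).1 : R^o) (- derive1 (fun r => - (c r).1 : R^o) s).
    have -> : (fun r => (c r).1 : R^o) = (fun r => - - (c r).1 : R^o) by apply/funext => r; rewrite opprK.
    by apply: is_deriveN; apply: DeriveDef => //; rewrite -derive1E.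
  have [dN dNE] := Hd.
  have [[_ +] +] := product_velocity c s; move=> /(_ (conj dN d2)) dc /(_ dc) vE.
  split => //; apply/(future_directedP _ _ k0); rewrite vE /= (tnormN hsigma) derive1E dNE opprK.
  by split.
Qed.

End causal_coordinates.

Lemma is_derive_affine (R : realType) (s a b : R) :
  is_derive (s : R^o) 1 (fun u : R^o => a * u + b : R^o) a.
Proof.
have : is_derive (s : R^o) 1 ((fun u : R^o => a *: u : R^o) + cst b) (a *: 1 + 0).
  by apply: is_deriveD.
by rewrite addr0 [_ *: _]mulr1.
Qed.

Section causal_estimates.
Context (R : realType) (n : nat) (S : topologicalType).
Notation E := 'rV[R]_n.
Context (A : atlas E S) (sigma : S -> E -> E -> R).
Hypotheses (hS : smooth_manifold A) (hsigma : riemannian_metric A sigma).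
Notation spd := (speed A sigma).
Notation tnorm := (tangent_norm sigma).
Notation d := (dist A sigma).
Notation ph p := (phi (chart_at A p)).

Let dom_at p : dom (chart_at A p) p.
Proof. by have [_ [_ + _]] := hS; apply. Qed.

Lemma causal_pair_nondecreasing k c1 c2 a b : causal_pair A sigma k c1 c2 a b ->
  forall x y, a <= x -> x <= y -> y <= b -> c1 x <= c1 y.
Proof.
move=> [ab [cc Hl] ae] x y ax xy yb; apply: nondecreasing_ae_dini => //.
- move=> s /andP[xs sy].
  have [|N [K [nN K0 HK]]] := Hl s; first by rewrite (le_trans ax) // (le_trans sy).
  have /nbhs_ballP[e /= e0 He] := nN; exists K, e; split => // u v xu uv vy ue ve.
  have Nu : N u by apply: He; rewrite /ball /= ltr_distlC; apply/andP; split; lra.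
  have Nv : N v by apply: He; rewrite /ball /= ltr_distlC; apply/andP; split; lra.
  have [||h _] := HK v u Nv Nu; [by apply/andP; split; lra..|].
  by move: h; rewrite (ger0_norm (_ : 0 <= v - u)) ?subr_ge0 // ler_norml => /andP[].
- apply: ae_impl ae => s H; rewrite in_itv /= => /andP[xs sy] e e0.
  have [|d1 _ dpos _] := H; first by rewrite in_itv /= (le_lt_trans ax) // (lt_le_trans sy).
  have [r r0 Hr] := derive1_eps d1 e0; exists r => // z sz zr.
  have zs : `|z - s| = z - s by rewrite gtr0_norm ?subr_gt0.
  have := Hr z; rewrite zs => /(_ _)H1.
  have : z - s < r by lra.
  move=> /H1; rewrite -[_ *: _]/((z - s) * _) ler_norml => /andP[h _].
  by move: dpos h; set D := derive1 _ _; nra.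
Qed.

Lemma causal_pair_time k c1 c2 a b : causal_pair A sigma k c1 c2 a b -> c1 a < c1 b.
Proof.
move=> cp; have nd := causal_pair_nondecreasing cp; have [ab _ ae] := cp.
rewrite ltNge; apply/negP => ba.
have cst x : a <= x -> x <= b -> c1 x = c1 a.
  move=> ax xb; apply/le_anti; rewrite (nd a x) // andbT.
  by apply: le_trans ba; exact: nd.
have [s + [_ _ + _]] := ae_itv_exists ab ae.
rewrite in_itv /= => /andP[as_ sb].
suff -> : derive1 (c1 : R -> R^o) s = 0 by rewrite ltxx.
rewrite derive1E -[RHS](derive_cst (c1 a : R^o) (s : R^o) 1).
apply: near_eq_derive; near=> z; apply: cst; apply: ltW; near: z.
  exact: lt_nbhsr.
exact: lt_nbhsl.
Unshelve. all: by end_near. Qed.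

Lemma within_nbhs_preimage (T : topologicalType) (c : R -> T) (a b s : R) U :
  {within `[a, b], continuous c} -> a <= s <= b -> nbhs (c s) U ->
  exists2 r, 0 < r & forall u, a <= u <= b -> `|u - s| < r -> U (c u).
Proof.
move=> cc sab nU; have sI : (`[a, b]%classic : set R) s by rewrite /= in_itv.
move/subspace_continuousP : cc => /(_ _ sI _ nU) /nbhs_ballP[r /= r0 Hr].
exists r => // u uab us; apply: Hr; last by rewrite /= in_itv.
by rewrite /ball /= distrC.
Qed.

Lemma causal_pair_dist c1 c2 a b : causal_pair A sigma 1 c1 c2 a b ->
  d (c2 a) (c2 b) <= c1 b - c1 a.
Proof.
move=> [ab [cc Hl] ae]; set q := c2 a.
suff : c1 a - d q (c2 a) <= c1 b - d q (c2 b) by rewrite (dist_refl hS hsigma); lra.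
apply: (@nondecreasing_ae_dini _ (fun s => c1 s - d q (c2 s))); first exact: ltW.
- move=> s sab; have [N [K [nN K0 HK]]] := Hl s sab.
  have [U nU HU] := segment_dist hS hsigma (c2 s) ltr01.
  have [C C0 HC] := tnorm_upper hsigma (c2 s).
  have [r r0 Hr] := within_nbhs_preimage cc sab nU.
  have /nbhs_ballP[e /= e0 He] := nN.
  exists (K + 2 * (C * K)), (Num.min r e); split.
  + by rewrite addr_ge0 // mulr_ge0 // mulr_ge0 // ltW.
  + by rewrite lt_min r0.
  move=> u v au uv vb us vs.
  have := us; rewrite ltrBlDl -ltrBlDr lt_min => /andP[us1 us2].
  have := vs; rewrite -ltrBlDl lt_min => /andP[vs1 vs2].
  have Nu : N u by apply: He; rewrite /ball /= ltr_distlC; apply/andP; split; lra.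
  have Nv : N v by apply: He; rewrite /ball /= ltr_distlC; apply/andP; split; lra.
  have uab : a <= u <= b by rewrite au (le_trans uv).
  have vab : a <= v <= b by rewrite vb (le_trans au).
  have Uu : U (c2 u) by apply: Hr => //; rewrite ltr_distlC; apply/andP; split; lra.
  have Uv : U (c2 v) by apply: Hr => //; rewrite ltr_distlC; apply/andP; split; lra.
  have [h1 h2] := HK v u Nv Nu vab uab.
  rewrite (ger0_norm (_ : 0 <= v - u)) ?subr_ge0 // in h1 h2.
  have [_ h3] := HU _ _ Uu Uv.
  have h4 := HC (ph (c2 s) (c2 v) - ph (c2 s) (c2 u)).
  have h5 := dist_lipschitz hS hsigma q (c2 u) (c2 v).
  have h6 : C * `|ph (c2 s) (c2 v) - ph (c2 s) (c2 u)| <= C * (K * (v - u)).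
    by rewrite ler_wpM2l // ltW.
  move: h1 h5 h3 h4 h6; rewrite !ler_norml => /andP[h1 _] /andP[h5 h5'].
  set Tn := tnorm _ _; set Nn := `| _ |; nra.
- apply: ae_impl ae => s H sab e e0; have [d1 d2 dpos sp] := H sab.
  move: sab; rewrite in_itv /= => /andP[as_ sb].
  have e2 : 0 < e / 2 by rewrite divr_gt0.
  have [r r0 Hr] := derive1_eps d1 e2.
  have [r' r'0 Hr'] := calibrated_dini hsigma (calibrated_dist hS hsigma q)
    (continuous_at_interior cc as_ sb) d2 e2.
  have spD : spd c2 s <= derive1 (c1 : R -> R^o) s.
    move: sp; rewrite mul1r ler_pXn2r // nnegrE ?(ltW dpos) //; exact: speed_ge0.
  exists (Num.min r r'); first by rewrite lt_min r0.
  move=> z sz; rewrite -ltrBlDl lt_min => /andP[zr zr'].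
  have zs : `|z - s| = z - s by rewrite gtr0_norm ?subr_gt0.
  have := Hr z; have := Hr' z; rewrite zs => /(_ zr') + /(_ zr).
  rewrite -[_ *: _]/((z - s) * _) !ler_norml => /andP[_ h1] /andP[h2 _].
  by move: spD h1 h2; set D := derive1 _ _; nra.
Qed.

Lemma dist_lipschitz_continuous c2 a b K : 0 <= K ->
  (forall x y, a <= x -> x <= y -> y <= b -> d (c2 x) (c2 y) <= K * (y - x)) ->
  {within `[a, b], continuous c2}.
Proof.
move=> K0 HK; apply/subspace_continuousP => s; rewrite /= in_itv /= => /andP[as_ sb] U nU.
have [r r0 Hr] := dist_nbhs hS hsigma nU.
have e0 : 0 < r / (K + 1) by rewrite divr_gt0 // ltr_wpDl.
change (nbhs s [set u | (`[a, b]%classic : set R) u -> U (c2 u)]).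
apply/nbhs_ballP; exists (r / (K + 1)) => //= u; rewrite /ball /= => us.
rewrite in_itv /= => /andP[au ub]; apply: Hr.
have : (K + 1) * `|s - u| < r by rewrite mulrC -ltr_pdivlMr ?ltr_wpDl.
have [uls|slu] := leP u s.
  have := HK u s au uls sb; rewrite (dist_sym hS hsigma) ger0_norm ?subr_ge0 //; nra.
have := HK s u as_ (ltW slu) ub; rewrite ltr0_norm ?subr_lt0 //; nra.
Qed.

Lemma dist_lipschitz_pair c1 c2 a b K : 0 <= K ->
  (forall x y, a <= x -> x <= y -> y <= b -> `|c1 y - c1 x| <= K * (y - x)) ->
  (forall x y, a <= x -> x <= y -> y <= b -> d (c2 x) (c2 y) <= K * (y - x)) ->
  locally_lipschitz_pair A c1 c2 a b.
Proof.
move=> K0 HK1 HK2; have cc := dist_lipschitz_continuous K0 HK2; split => // s sab.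
have h0 : 0 < (2^-1 : R) by rewrite invr_gt0.
have h1 : 2^-1 < 1 :> R by rewrite invf_lt1 // ltr1n.
have [U nU HU] := dist_two_sided hS hsigma (c2 s) h0 h1.
have [C C0 HC] := tnorm_lower hsigma (c2 s).
have [r r0 Hr] := within_nbhs_preimage cc sab nU.
exists (ball s r), (K + 2 * (C * K)); split; first exact: nbhsx_ballx.
  by rewrite addr_ge0 // mulr_ge0 // mulr_ge0 // ltW.
have main u v : ball s r u -> ball s r v -> a <= u <= b -> a <= v <= b -> u <= v ->
   `|c1 v - c1 u| <= (K + 2 * (C * K)) * (v - u) /\
   `|ph (c2 s) (c2 v) - ph (c2 s) (c2 u)| <= (K + 2 * (C * K)) * (v - u).
  move=> bu bv uab vab uv.
  have Uu : U (c2 u) by apply: Hr => //; rewrite distrC.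
  have Uv : U (c2 v) by apply: Hr => //; rewrite distrC.
  have [_ low _] := HU _ _ Uu Uv.
  have [au ub] := andP uab; have [av vb] := andP vab.
  have g1 := HK1 u v au uv vb; have g2 := HK2 u v au uv vb.
  have g3 := HC (ph (c2 s) (c2 v) - ph (c2 s) (c2 u)).
  have g4 : 0 <= C * K * (v - u) by rewrite mulr_ge0 ?subr_ge0 // mulr_ge0 // ltW.
  have g6 : 0 <= K * (v - u) by rewrite mulr_ge0 ?subr_ge0.
  split; first by nra.
  apply: le_trans g3 _; move: low; set t := tnorm _ _ => low.
  have tK : t <= 2 * (K * (v - u)) by lra.
  have := ler_wpM2l (ltW C0) tK; nra.
move=> u v bu bv uab vab; have [uv|vu] := leP u v.
  rewrite (distrC (c1 u)) (distrC (ph (c2 s) (c2 u))) (distrC u) (ger0_norm (_ : 0 <= v - u)) ?subr_ge0 //.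
  exact: main.
by rewrite (gtr0_norm (_ : 0 < u - v)) ?subr_gt0 //; apply: main => //; exact: ltW.
Qed.

Lemma ae_notin_seq (D : seq R) : {ae @lebesgue_measure R, forall s, s \notin D}.
Proof.
exists [set` D]; split.
- by apply: countable_measurable => //; exact/finite_set_countable/finite_seq.
- by apply: countable_lebesgue_measure0; exact/finite_set_countable/finite_seq.
- by move=> s /= /negP; rewrite negbK.
Qed.

Lemma causal_pair_of_joins p q l' l t : joins A sigma p q l' -> l' < l ->
  exists c1 c2 a b, [/\ causal_pair A sigma 1 c1 c2 a b,
    c1 a = t, c1 b = t + l, c2 a = p & c2 b = q].
Proof.
move=> [c [a [b [h [pc ca cb lp l'E]]]]] ll'.
have [ab cc [K K0 HK] [D HD]] := lp.
pose del := (l - l') / (b - a).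
have del0 : 0 < del by rewrite divr_gt0 ?subr_gt0.
have delE : del * (b - a) = l - l' by rewrite divfK // subr_eq0 gt_eqF.
pose c1 s := h s + (del * s + (t - h a - del * a)).
exists c1, c, a, b; split => //.
- split => //.
    apply: (@dist_lipschitz_pair _ _ _ _ (K + del)); first by rewrite addr_ge0 // ltW.
      move=> x y ax xy yb; have /andP[h1 h2] := HK x y ax xy yb.
      have : 0 <= del * (y - x) by rewrite mulr_ge0 ?subr_ge0 // ltW.
      by rewrite /c1 ler_norml => h3; apply/andP; split; nra.
    move=> x y ax; rewrite le_eqVlt => /predU1P[<- _|xy yb].
      by rewrite (dist_refl hS hsigma) subrr mulr0.
    have := calibrated_le hS hsigma (calibrated_dist hS hsigma (c x)) (length_primitiveS ax xy yb lp).
    rewrite (dist_refl hS hsigma) subr0; have /andP[h1 h2] := HK x y ax (ltW xy) yb.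
    have : 0 <= del * (y - x) by rewrite mulr_ge0 ?subr_ge0 // ltW.
    nra.
  apply: ae_impl (ae_notin_seq D) => s nD; rewrite in_itv /= => /andP[as_ sb].
  have [dc dh hE] := HD s as_ sb nD.
  have Hd : is_derive (s : R^o) 1 (c1 : R^o -> R^o) (spd c s + del).
    apply: is_deriveD; first by apply: DeriveDef => //; rewrite -derive1E.
    exact: is_derive_affine.
  have [d1 d1E] := Hd.
  have sp0 := speed_ge0 A sigma c s.
  split => //; rewrite derive1E d1E; first by rewrite ltr_wpDl.
  by rewrite mul1r ler_pXn2r ?nnegrE ?addr_ge0 ?lerDl // ltW.
- by rewrite /c1; ring.
- by rewrite /c1; move: delE; rewrite l'E; nra.
Qed.

Lemma dist_lipschitz_ae_derivable (c : R -> S) (l : R) : 0 < l ->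
  (forall x y, 0 <= x -> x <= y -> y <= l -> d (c x) (c y) <= y - x) ->
  {ae @lebesgue_measure R, forall s, s \in `]0, l[ ->
    derivable (phi (chart_at A (c s)) \o c : R^o -> E) s 1}.
Proof.
move=> l_gt0 HL; have l0 := ltW l_gt0.
have HL1 x y : 0 <= x -> x <= y -> y <= l -> d (c x) (c y) <= 1 * (y - x).
  by rewrite mul1r; exact: HL.
have cc := dist_lipschitz_continuous ler01 HL1.
have [_ Hl] : locally_lipschitz_pair A (fun=> 0) c 0 l.
  apply: (dist_lipschitz_pair ler01) => // x y x0 xy yl.
  by rewrite subrr normr0 mul1r subr_ge0.
pose P s := derivable (phi (chart_at A (c s)) \o c : R^o -> E) s 1.
pose B (I : set R) := [set s | I s /\ 0 < s < l /\ ~ P s].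
have local x : 0 <= x <= l -> exists2 r, 0 < r &
    (@lebesgue_measure R).-negligible (B [set s | `|s - x| < r]).
  move=> xl; have [N [K [nN K0 HK]]] := Hl x xl; set i := chart_at A (c x) in HK.
  have [r1 r10 Hr1] := within_nbhs_preimage cc xl (nbhs_dom hS (dom_at (c x))).
  have /nbhs_ballP[r2 /= r20 Hr2] := nN.
  pose r := Num.min r1 r2; have r0 : 0 < r by rewrite lt_min r10.
  have rr1 : r <= r1 by rewrite ge_min lexx.
  have rr2 : r <= r2 by rewrite ge_min lexx orbT.
  pose a := Num.max 0 (x - r / 2); pose b := Num.min l (x + r / 2).
  have [a0 ax] : 0 <= a /\ x - r / 2 <= a by rewrite !le_max !lexx orbT.
  have [bl bx] : b <= l /\ b <= x + r / 2 by rewrite !ge_min !lexx orbT.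
  have ab : a < b.
    have /andP[x0 xl'] := xl.
    by rewrite /a /b gt_max !lt_min l_gt0 /=; apply/and3P; split; lra.
  have nf j : {ae @lebesgue_measure R, forall s, s \in `]a, b[ ->
      derivable (fun u : R^o => phi i (c u) 0 j : R^o) s 1}.
    apply: (lipschitz_ae_derivable ab K0) => u v au uv vb.
    have Nu : N u by apply: Hr2; rewrite /ball /= ltr_distlC; apply/andP; split; lra.
    have Nv : N v by apply: Hr2; rewrite /ball /= ltr_distlC; apply/andP; split; lra.
    have [||_] := HK v u Nv Nu; [by apply/andP; split; lra..|].
    rewrite (ger0_norm (_ : 0 <= v - u)) ?subr_ge0 // => /(le_trans _); apply.
    by have := rV_coord_le (phi i (c v) - phi i (c u)) j; rewrite !mxE.
  have nfa : {ae @lebesgue_measure R, forall s, forall j : 'I_n, s \in `]a, b[ ->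
      derivable (fun u : R^o => phi i (c u) 0 j : R^o) s 1}.
    by apply: (filter_forall (ae_filter_ringOfSetsType (@lebesgue_measure R))) => j; exact: nf.
  exists (r / 2); first by rewrite divr_gt0.
  apply: negligibleS nfa => s [/= sx [/andP[s0 sl] nP]] H; apply: nP.
  move: sx; rewrite ltr_distlC => /andP[sx1 sx2].
  have [as_ sb] : a < s /\ s < b.
    by rewrite /a /b gt_max lt_min s0 sl /=; split; lra.
  have ds : derivable (phi i \o c : R^o -> E) s 1.
    apply/derivable_mxP => i0 j; rewrite (ord1 i0); apply: H.
    by rewrite in_itv /= as_.
  have ci : dom i (c s).
    apply: Hr1; first by rewrite !ltW.
    by rewrite ltr_distlC; apply/andP; split; lra.
  by have [] := velocity_chart sigma hS (continuous_at_interior cc s0 sl) ci ds.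
have nB (I I1 I2 : set R) : (I `<=` I1 `|` I2) ->
    (@lebesgue_measure R).-negligible (B I1) -> (@lebesgue_measure R).-negligible (B I2) ->
    (@lebesgue_measure R).-negligible (B I).
  move=> II n1 n2; apply: negligibleS (negligibleU n1 n2) => s [Is H].
  by have [I1s|I2s] := II s Is; [left|right]; split.
have : (@lebesgue_measure R).-negligible (B [set s | s <= l]).
  apply: (@real_induction _ 0 l (fun x => (@lebesgue_measure R).-negligible (B [set s | s <= x]))) => //.
  - rewrite (_ : B _ = set0); first exact: negligible_set0.
    by apply/seteqP; split => // s [/= s0 [/andP[+ _] _]]; rewrite ltNge s0.
  - move=> x /andP[x0 xl] /(_ x); rewrite lexx x0 => /(_ isT) nx.
    have [|r r0 nr] := local x; first by rewrite x0 ltW.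
    exists (x + r / 2); first by rewrite ltrDl divr_gt0.
    move=> z /andP[xz zr]; apply: nB nx nr => s /= sz.
    have [sx|xs] := leP s x; first by left.
    by right; rewrite /= ltr_distlC; apply/andP; split; lra.
  - move=> x /andP[x0 xl] Hx; have [|r r0 nr] := local x; first by rewrite ltW.
    pose y := Num.max 0 (x - r / 2).
    have yx : y < x by rewrite /y gt_max x0; lra.
    have [y0 yr] : 0 <= y /\ x - r / 2 <= y by rewrite !le_max !lexx orbT.
    have ny := Hx y; rewrite y0 yx in ny; apply: nB (ny isT) nr => s /= sx.
    have [sy|ys] := leP s y; first by left.
    by right; rewrite /= ltr_distlC; apply/andP; split; lra.
apply: negligibleS => s /= /not_implyP[+ nP]; rewrite in_itv /= => /andP[s0 sl].
by split; [exact: ltW|rewrite s0 sl].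
Qed.

Lemma causal_pair_of_lipschitz (c : R -> S) (l t : R) : 0 < l ->
  (forall x y, 0 <= x -> x <= y -> y <= l -> d (c x) (c y) <= y - x) ->
  causal_pair A sigma 1 (fun s => s + t) c 0 l.
Proof.
move=> l0 HL.
have HL1 x y : 0 <= x -> x <= y -> y <= l -> d (c x) (c y) <= 1 * (y - x).
  by rewrite mul1r; exact: HL.
have cc := dist_lipschitz_continuous ler01 HL1.
split => //.
  apply: (dist_lipschitz_pair ler01) => // x y x0 xy yl.
  by rewrite opprD addrACA subrr addr0 mul1r ger0_norm // subr_ge0.
apply: ae_impl (dist_lipschitz_ae_derivable l0 HL) => s + sl => /(_ sl) ds.
have Hd : is_derive (s : R^o) 1 (fun s : R^o => s + t : R^o) 1.
  rewrite (_ : (fun s : R^o => s + t : R^o) = fun s : R^o => 1 * s + t); first exact: is_derive_affine.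
  by apply/funext => u; rewrite mul1r.
have [d1 d1E] := Hd.
rewrite derive1E d1E mul1r expr1n; split => //.
suff sp1 : spd c s <= 1 by rewrite expr_le1 //; exact: speed_ge0.
move: sl; rewrite in_itv /= => /andP[s0 sl].
have sp0 := speed_ge0 A sigma c s.
have [C C0 HC] := tnorm_upper hsigma (c s).
apply/ler_addgt0Pr => q q0.
have D0 : 0 < spd c s + C by rewrite ltr_wpDl.
pose e := Num.min 2^-1 (q / (spd c s + C)).
have e0 : 0 < e by rewrite lt_min invr_gt0 ltr0n divr_gt0.
have e1 : e < 1 by rewrite gt_min invf_lt1 // ltr1n.
have eq : e * (spd c s + C) <= q by rewrite -ler_pdivlMr // ge_min lexx orbT.
have [U nU HU] := dist_two_sided hS hsigma (c s) e0 e1.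
have [r1 r10 Hr1] := derive1_eps ds e0.
have sl' : 0 <= s <= l by rewrite !ltW.
have [r2 r20 Hr2] := within_nbhs_preimage cc sl' nU.
pose h := Num.min (Num.min r1 r2) (l - s) / 2.
have h0 : 0 < h by rewrite divr_gt0 // !lt_min r10 r20 subr_gt0.
have [hr1 hr2 hl] : [/\ h < r1, h < r2 & h < l - s].
  have m0 : 0 < Num.min (Num.min r1 r2) (l - s) by rewrite !lt_min r10 r20 subr_gt0.
  have m1 : Num.min (Num.min r1 r2) (l - s) <= r1 by rewrite !ge_min lexx.
  have m2 : Num.min (Num.min r1 r2) (l - s) <= r2 by rewrite !ge_min lexx orbT.
  have m3 : Num.min (Num.min r1 r2) (l - s) <= l - s by rewrite !ge_min lexx !orbT.
  by rewrite /h; split; lra.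
pose y := s + h.
have ys : `|y - s| = h by rewrite /y addrAC subrr add0r gtr0_norm.
have yh : y - s = h by rewrite /y addrAC subrr add0r.
have Uy : U (c y).
  apply: Hr2; last by rewrite ys.
  by rewrite /y; apply/andP; split; lra.
have Us : U (c s) by exact: nbhs_singleton.
have [_ low _] := HU _ _ Us Uy.
have up : d (c s) (c y) <= y - s by apply: HL; rewrite /y; lra.
have := Hr1 y; rewrite ys yh => /(_ hr1).
set w := derive1 _ s; set u := phi _ _ - phi _ _ => H1.
have H2 : h * spd c s <= tnorm (c s) u + C * (e * h).
  have -> : h * spd c s = tnorm (c s) (h *: w).
    by rewrite (tnormZ hsigma) gtr0_norm.
  rewrite -[h *: w](subKr u) -(addrC (- _)); apply: le_trans (tnormD hsigma _ _ _) _.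
  rewrite (tnormN hsigma) addrC lerD2l; apply: le_trans (HC _) _.
  by rewrite ler_wpM2l // ltW.
move: low up; rewrite yh => low up.
have H3 : (1 - e) * (h * spd c s) <= h + C * (e * h).
  apply: (@le_trans _ _ ((1 - e) * (tnorm (c s) u + C * (e * h)))).
    by rewrite ler_wpM2l // subr_ge0 ltW.
  rewrite mulrDr; apply: lerD; first exact: le_trans low up.
  have : 0 <= C * (e * h) by rewrite mulr_ge0 ?(ltW C0) // mulr_ge0 // ltW.
  nra.
have H4 : h * ((1 - e) * spd c s) <= h * (1 + C * e) by nra.
rewrite ler_pM2l // in H4; lra.
Qed.

End causal_estimates.

(** * Minimizing curves and the causal relation *)

Lemma compact_pointwise_cluster (I : eqType) (T : topologicalType) (K : set T)
    (u : nat -> I -> T) : compact K -> (forall k x, K (u k x)) ->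
  exists c : I -> T, forall x y U V N, nbhs (c x) U -> nbhs (c y) V ->
    exists2 k, (N <= k)%N & U (u k x) /\ V (u k y).
Proof.
move=> cK Ku.
have cP := @tychonoff I (fun=> T) (fun=> K) (fun=> cK).
have [|c [_ cl]] := cP (u @ \oo) _.
  by exists 0%N => // k _ x; exact: Ku.
exists c => x y U V N nU nV.
have nUV : nbhs (c : prod_topology (fun _ : I => T)) [set f | U (f x) /\ V (f y)].
  have px : nbhs (c : prod_topology (fun _ : I => T)) [set f | U (f x)].
    exact: (@proj_continuous I (fun=> T) x c U nU).
  have py : nbhs (c : prod_topology (fun _ : I => T)) [set f | V (f y)].
    exact: (@proj_continuous I (fun=> T) y c V nV).
  exact: (@filterI _ _ (nbhs_filter (c : prod_topology (fun _ : I => T))) _ _ px py).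
have FN : (u @ \oo) [set f | exists2 k, (N <= k)%N & f = u k].
  by exists N => // k Nk; exists k.
by have [f [[k Nk ->] UV]] := cl _ _ FN nUV; exists k.
Qed.

Section causal_relation.
Context (R : realType) (n : nat) (S : topologicalType).
Notation E := 'rV[R]_n.
Context (A : atlas E S) (sigma : S -> E -> E -> R).
Hypotheses (hS : smooth_manifold A) (hsigma : riemannian_metric A sigma).
Notation d := (dist A sigma).
Notation A' := (product_atlas A).
Notation g := (product_metric sigma).
Notation X := (@partial_t R E S).

Lemma causal_le_dist (p q : R^o * S) : causal_le A' g X p q -> d p.2 q.2 <= q.1 - p.1.
Proof.
rewrite product_metricE => -[->|[c [a [b [fc <- <-]]]]].
  by rewrite (dist_refl hS hsigma) subrr.
by move: fc => /(future_causalP hsigma _ _ _ ltr01)/(causal_pair_dist hS hsigma).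
Qed.

Lemma causal_le_pair (c1 : R -> R) (c2 : R -> S) a b (p q : R^o * S) :
  causal_pair A sigma 1 c1 c2 a b -> (c1 a, c2 a) = p -> (c1 b, c2 b) = q ->
  causal_le A' g X p q.
Proof.
rewrite product_metricE => cp pE qE; right.
exists (fun s => (c1 s, c2 s) : R^o * S), a, b; split => //.
exact/(future_causalP hsigma _ _ _ ltr01).
Qed.

Lemma dist_lt_causal_pair p q l t : d p q < l ->
  exists c1 c2 a b, [/\ causal_pair A sigma 1 c1 c2 a b,
    c1 a = t, c1 b = t + l, c2 a = p & c2 b = q].
Proof. by move=> /(dist_lt hS hsigma)[l' pq ll']; exact: (causal_pair_of_joins hS hsigma t pq ll'). Qed.

Lemma causal_pair_sub k c1 c2 a b x y : causal_pair A sigma k c1 c2 a b ->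
  a <= x -> x < y -> y <= b -> causal_pair A sigma k c1 c2 x y.
Proof.
move=> [ab [cc Hl] ae] ax xy yb; split => //.
  split.
    apply: continuous_subspaceW cc => s; rewrite /= !in_itv /= => /andP[xs sy].
    by rewrite (le_trans ax) // (le_trans sy).
  move=> s /andP[xs sy]; have [|N [K [nN K0 HK]]] := Hl s.
    by rewrite (le_trans ax) // (le_trans sy).
  exists N, K; split => // r r' Nr Nr' /andP[xr ry] /andP[xr' r'y].
  by apply: HK => //; apply/andP; split; lra.
apply: ae_impl ae => s H; rewrite in_itv /= => /andP[xs sy]; apply: H.
by rewrite in_itv /= (le_lt_trans ax) // (lt_le_trans sy).
Qed.

Lemma causal_pair_IVT k c1 c2 a b v : causal_pair A sigma k c1 c2 a b ->
  c1 a <= v <= c1 b -> exists2 s, a <= s <= b & c1 s = v.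
Proof.
move=> [ab llp _] vI; have abW := ltW ab.
have [||s] := @IVT _ c1 a b v abW; last by rewrite in_itv /=; exists s.
  exact: locally_lipschitz_pair_continuous llp.
by move: vI => /andP[av vb]; rewrite minEle maxEle (le_trans av vb) av vb.
Qed.

Lemma near_minimizer p q e : 0 < e -> 0 < d p q -> exists c : R -> S,
  [/\ c 0 = p, c (d p q) = q, forall x, d p (c x) <= (1 + e) * d p q &
      forall x y, 0 <= x -> x <= y -> y <= d p q -> d (c x) (c y) <= (1 + e) * (y - x)].
Proof.
move=> e0; set l := d p q => l0.
have [|c1 [c2 [a [b [cp ca cb c2a c2b]]]]] := @dist_lt_causal_pair p q ((1 + e) * l) 0.
  by rewrite -/l mulrDl mul1r ltrDl mulr_gt0.
rewrite add0r in cb; have [ab _ _] := cp; have nd := causal_pair_nondecreasing cp.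
have pd x y : a <= x -> x <= y -> y <= b -> d (c2 x) (c2 y) <= c1 y - c1 x.
  move=> ax; rewrite le_eqVlt => /predU1P[<-|xy] yb.
    by rewrite (dist_refl hS hsigma) subrr.
  exact: (causal_pair_dist hS hsigma (causal_pair_sub cp ax xy yb)).
have /choice[s Hs] (u : R) : exists s, a <= s <= b /\ (0 <= u <= l -> c1 s = (1 + e) * u).
  have [ul|nul] := boolP (0 <= u <= l); last by exists a; rewrite lexx ltW.
  have [|s sab sE] := causal_pair_IVT (v := (1 + e) * u) cp.
    have /andP[u0 u1] := ul; rewrite ca cb mulr_ge0 //=; last by lra.
    by rewrite ler_wpM2l //; lra.
  by exists s.
exists (fun u => c2 (s u)); split.
- have [/andP[as_ sb] h] := Hs 0; apply/esym/(dist_eq0 hS hsigma)/le_anti.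
  rewrite (dist_ge0 hS hsigma) andbT -c2a; apply: le_trans (pd _ _ _ _ _) _ => //.
  by rewrite h ?ca ?mulr0 ?subrr // lexx ltW.
- have [/andP[as_ sb] h] := Hs l; apply/(dist_eq0 hS hsigma)/le_anti.
  rewrite (dist_ge0 hS hsigma) andbT -c2b; apply: le_trans (pd _ _ _ _ _) _ => //.
  by rewrite h ?cb ?subrr // lexx ltW.
- move=> x; have [/andP[as_ sb] _] := Hs x; rewrite -c2a.
  apply: le_trans (pd _ _ _ _ _) _ => //; rewrite ca subr0 -cb; exact: nd.
- move=> x y x0; rewrite le_eqVlt => /predU1P[<- _|xy yl].
    by rewrite (dist_refl hS hsigma) subrr mulr0.
  have [/andP[asx sxb] hx] := Hs x; have [/andP[asy syb] hy] := Hs y.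
  have {}hx : c1 (s x) = (1 + e) * x by apply: hx; rewrite x0 ltW // (lt_le_trans xy).
  have {}hy : c1 (s y) = (1 + e) * y by apply: hy; rewrite yl (le_trans x0) // ltW.
  have sxy : s x <= s y.
    rewrite leNgt; apply/negP => /ltW yx; have := nd _ _ asy yx sxb.
    by rewrite hx hy ler_pM2l ?leNgt ?xy //; lra.
  by apply: le_trans (pd _ _ asx sxy syb) _; rewrite hx hy -mulrBr.
Qed.

Lemma dist_continuous p : continuous (d p).
Proof. exact: (calibrated_continuous hS hsigma (calibrated_dist hS hsigma p)). Qed.

Lemma closed_ball_compact p r : heine_borel A sigma -> compact [set z | d p z <= r].
Proof.
move=> hb; apply: hb; first exact:
  (@preimage_closed _ _ (d p) [set x | x <= r] (fun z _ => @dist_continuous p z) (@closed_le _ r)).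
exists (r + r) => x y /= px py; rewrite (riemannian_dist hS hsigma) lee_fin.
apply: le_trans (dist_triangle hS hsigma x p y) _.
by rewrite (dist_sym hS hsigma x) lerD.
Qed.

Lemma minimizer p q : heine_borel A sigma -> 0 < d p q -> exists c : R -> S,
  [/\ c 0 = p, c (d p q) = q &
      forall x y, 0 <= x -> x <= y -> y <= d p q -> d (c x) (c y) <= y - x].
Proof.
move=> hb; set l := d p q => l0.
have e0 (k : nat) : 0 < k.+1%:R^-1 :> R by rewrite invr_gt0 ltr0n.
have e1 (k : nat) : k.+1%:R^-1 <= 1 :> R by rewrite invf_le1 ?ltr0n // ler1n.
have /choice[u Hu] (k : nat) := near_minimizer (e0 k) l0.
have [k x|c Hc] := compact_pointwise_cluster (u := u) (closed_ball_compact (p := p) (r := 2 * l) hb).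
  have [_ _ + _] := Hu k => /(_ x)/le_trans; apply.
  rewrite ler_wpM2r ?(ltW l0) // -[2]/(1 + 1) lerD2l; exact: e1.
have nb x e : 0 < e -> nbhs (c x) [set z | d (c x) z < e].
  move=> e_0; have /cvgrPdist_lt /(_ e e_0) := @dist_continuous (c x) (c x).
  by apply: filterS => z /=; rewrite (dist_refl hS hsigma) add0r normrN ger0_norm // dist_ge0.
have tri := dist_triangle hS hsigma; have sym := dist_sym hS hsigma.
have d0 := dist_ge0 hS hsigma.
have fix_ x z : (forall k, u k x = z) -> c x = z.
  move=> uz; apply: (dist_eq0 hS hsigma); apply/le_anti; rewrite d0 andbT.
  apply/ler_addgt0Pr => e e_0; rewrite add0r.
  by have [k _ [+ _]] := Hc x x _ _ 0%N (nb x e e_0) (nb x e e_0); rewrite /= uz => /ltW.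
exists c; split.
- by apply: fix_ => k; have [] := Hu k.
- by apply: fix_ => k; have [] := Hu k.
move=> x y x0 xy yl; apply/ler_addgt0Pr => e e_0.
have e3 : 0 < e / 3 by rewrite divr_gt0.
have e4 : 0 < e / 3 / (y - x + 1) by rewrite divr_gt0 // ltr_wpDl // subr_ge0.
have [N _ HN] := near_infty_natSinv_lt (PosNum e4).
have [k Nk [/= h1 h2]] := Hc x y _ _ N (nb x _ e3) (nb y _ e3).
have [_ _ _ /(_ x y x0 xy yl) h3] := Hu k.
have := HN k Nk; rewrite /= ltr_pdivlMr ?ltr_wpDl ?subr_ge0 // => h4.
have h5 := tri (c x) (u k x) (c y); have h6 := tri (u k x) (u k y) (c y).
have h7 := e0 k; rewrite sym in h2.
move: h3 h4 h7; set ee := k.+1%:R^-1 => h3 h4 h7; nra.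
Qed.

Lemma dist_le_causal_le (p q : R^o * S) : heine_borel A sigma ->
  d p.2 q.2 <= q.1 - p.1 -> causal_le A' g X p q.
Proof.
case: p q => [t p] [s q] /= hb; rewrite le_eqVlt => /predU1P[st|/(@dist_lt_causal_pair _ _ _ t)].
  have := dist_ge0 hS hsigma p q; rewrite le_eqVlt => /predU1P[pq0|pq0].
    left; move: st; rewrite -pq0 => /esym/subr0_eq ->.
    by rewrite (dist_eq0 hS hsigma (esym pq0)).
  have [c [c0 cl Hc]] := minimizer hb pq0.
  have cp := causal_pair_of_lipschitz hS hsigma t pq0 Hc.
  by apply: (causal_le_pair cp); rewrite ?add0r ?c0 // cl st subrK.
move=> [c1 [c2 [a [b [cp ca cb c2a c2b]]]]].
by apply: (causal_le_pair cp); rewrite ?ca ?c2a // cb c2b addrC subrK.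
Qed.

End causal_relation.

(** * Null distance and completeness *)

Lemma is_metric_EFin (R : realType) (T : Type) (D : T -> T -> R) :
  (forall x y, 0 <= D x y) -> (forall x y, D x y = 0 <-> x = y) ->
  (forall x y, D x y = D y x) -> (forall x y z, D x z <= D x y + D y z) ->
  is_metric (fun x y => (D x y)%:E).
Proof.
move=> D0 Deq Dsym Dtri; split=> [||x y|x y|x y z] //.
- by split=> [[/Deq]|/Deq ->].
- by congr EFin; exact: Dsym.
- exact: Dtri.
Qed.

Lemma cauchy_sequence_cvg (R : realType) (u : nat -> R) :
  (forall e, 0 < e -> exists N, forall m k, (N <= m)%N -> (N <= k)%N -> `|u m - u k| < e) ->
  exists l, forall e, 0 < e -> exists N, forall m, (N <= m)%N -> `|u m - l| < e.
Proof.
move=> H; have cu : cvg (u @ \oo).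
  apply: R_complete; apply: cauchy_exP => e /H[N HN]; exists (u N); exists N => // k /= Nk.
  by rewrite /ball /=; exact: HN.
exists (lim (u @ \oo)) => e e0; move/cvgrPdist_lt : cu => /(_ e e0)[N _ HN].
by exists N => m Nm; rewrite distrC; exact: HN.
Qed.

Section lorentzian_product.
Context (R : realType) (n : nat) (S : topologicalType).
Notation E := 'rV[R]_n.
Context (A : atlas E S) (sigma : S -> E -> E -> R).
Hypotheses (hS : smooth_manifold A) (hsigma : riemannian_metric A sigma).
Notation d := (dist A sigma).
Notation A' := (product_atlas A).
Notation g := (product_metric sigma).
Notation X := (@partial_t R E S).
Notation t := (@time_coord R S).

Lemma time_coord_continuous : continuous t.
Proof. by move=> p; exact: cvg_fst. Qed.

Lemma time_coord_time_function : time_function A' g X t.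
Proof.
split; first exact: time_coord_continuous.
rewrite product_metricE => p q [[//|[c [a [b [fc <- <-]]]]] _].
by move: fc => /(future_causalP hsigma _ _ _ ltr01)/causal_pair_time.
Qed.

Lemma scaled_product_causal k : 0 < k -> causal A' (scaled_product_metric sigma k) X.
Proof.
move=> k0 [c [a [b [+ cab]]]]; move=> /(future_causalP hsigma _ _ _ k0)/causal_pair_time.
by rewrite cab ltxx.
Qed.

Lemma product_stably_causal : stably_causal A' g X.
Proof.
exists (scaled_product_metric sigma 2); split.
- exact: (scaled_product_lorentzian hS hsigma).
- rewrite product_metricE => p v cv; have [v0 h] : v != 0 /\ scaled_product_metric sigma 1 p v v <= 0.
    by case: cv => -[v0 h]; split => //; rewrite ?h // ltW.
  split => //; move: h; rewrite /scaled_product_metric mul1r -expr2.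
  have [v1|v1] := eqVneq v.1 0; last first.
    have : 0 < v.1 ^+ 2 by rewrite exprn_even_gt0.
    by move: (v.1 ^+ 2) => w; lra.
  have v2 : v.2 != 0.
    apply: contra_neq v0 => v2; rewrite (surjective_pairing v) v1 v2 //.
  by have [_ /(_ p.2 v.2 v2)] := hsigma; rewrite v1 expr0n /= mulr0 oppr0 add0r => /lt_geF ->.
- exact: scaled_product_causal.
Qed.

Lemma causal_diamond_compact p q : heine_borel A sigma -> compact (causal_diamond A' g X p q).
Proof.
move=> hb; have -> : causal_diamond A' g X p q =
    [set z | d p.2 z.2 - z.1 <= - p.1] `&` [set z | d q.2 z.2 + z.1 <= q.1].
  apply/seteqP; split => z [].
    move=> /(causal_le_dist hS hsigma) h1 /(causal_le_dist hS hsigma) h2.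
    by rewrite (dist_sym hS hsigma) in h2; split; rewrite /=; lra.
  by move=> /= h1 h2; split; apply: (dist_le_causal_le hS hsigma hb);
    rewrite ?(dist_sym hS hsigma z.2); lra.
have c1 : continuous (fun z : R^o * S => z.1 : R) by move=> z; exact: cvg_fst.
have cd x : continuous (fun z : R^o * S => d x z.2 : R).
  move=> z; apply: (@continuous_comp _ _ _ snd (d x)); first exact: cvg_snd.
  exact: (dist_continuous hS hsigma).
have closed_sub (f : R^o * S -> R) r : continuous f -> closed [set z | f z <= r].
  by move=> cf; exact: (@preimage_closed _ _ f [set x | x <= r] (fun z _ => cf z) (@closed_le _ r)).
apply: (@subclosed_compact _ _ (`[p.1, q.1] `*` [set z | d p.2 z <= q.1 - p.1])).
- apply: closedI; apply: closed_sub => z.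
    by apply: cvgB; [exact: cd|exact: c1].
  by apply: cvgD; [exact: cd|exact: c1].
- apply: compact_setX; first exact: segment_compact.
  exact: (closed_ball_compact hS hsigma).
- move=> z [/= h1 h2]; have := dist_ge0 hS hsigma p.2 z.2; have := dist_ge0 hS hsigma q.2 z.2.
  by move=> h3 h4; split; rewrite /= ?in_itv /=; [apply/andP; split; lra|lra].
Qed.

Lemma heine_borel_of_diamonds :
  (forall p q, compact (causal_diamond A' g X p q)) -> heine_borel A sigma.
Proof.
move=> cD B cB [r Br]; have [->|/set0P[p Bp]] := eqVneq B set0; first exact: compact0.
pose T := `|r| + 1.
have near q : B q -> d p q < T.
  move=> Bq; have := Br p q Bp Bq; rewrite (riemannian_dist hS hsigma) lee_fin => /le_lt_trans; apply.
  by rewrite (le_lt_trans (ler_norm r)) // ltrDl.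
have cK : compact ([set z : R^o * S | z.1 = 0] `&` [set z | B z.2]).
  apply: subclosed_compact (cD (- T, p) (T, p)) _.
    apply: closedI.
      apply: (@preimage_closed _ _ (fun z : R^o * S => z.1 : R) [set 0]).
        by move=> z _; exact: cvg_fst.
      exact: closed_eq.
    by apply: (@preimage_closed _ _ (snd : R^o * S -> S) B) => // z _; exact: cvg_snd.
  move=> [z1 z] [/= -> /near pz].
  have lt_le (x y : R^o * S) : d x.2 y.2 < y.1 - x.1 -> causal_le A' g X x y.
    case: x y => [t1 x] [t2 y] /= /(dist_lt_causal_pair hS hsigma t1).
    move=> [c1 [c2 [a [b [cp ca cb c2a c2b]]]]].
    by apply: (causal_le_pair hsigma cp); rewrite ?ca ?c2a // cb c2b addrC subrK.
  split; apply: lt_le; rewrite /= ?opprK ?add0r ?subr0 //.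
  by rewrite (dist_sym hS hsigma).
have -> : B = snd @` ([set z : R^o * S | z.1 = 0] `&` [set z | B z.2]).
  apply/seteqP; split => [q Bq|q [z [_ Bz] <-] //].
  by exists (0, q).
apply: continuous_compact cK; apply: continuous_subspaceT => z; exact: cvg_snd.
Qed.

Let rise (p q : R^o * S) := Num.max `|q.1 - p.1| (d p.2 q.2).

Lemma piecewise_causal_length c a b k s :
  piecewise_causal_curve A' g X c a b k s -> rise (c a) (c b) <= null_length t c k s.
Proof.
move=> [[k0 <- <- sI] _ pc]; rewrite /null_length /time_coord.
have step i : (i < k)%N ->
    d (c (s i)).2 (c (s i.+1)).2 <= `|(c (s i.+1)).1 - (c (s i)).1|.
  rewrite product_metricE in pc.
  move=> /pc[/(future_causalP hsigma _ _ _ ltr01)|/(past_causalP hsigma _ _ _ ltr01)]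
    /(causal_pair_dist hS hsigma) /le_trans; apply; first exact: ler_norm.
  by rewrite -opprD -normrN ler_norm.
suff H m : (m <= k)%N -> rise (c (s 0%N)) (c (s m)) <= \sum_(i < m) `|(c (s i.+1)).1 - (c (s i)).1|.
  exact: H.
elim: m => [_|m IH mk]; first by rewrite big_ord0 /rise subrr normr0 (dist_refl hS hsigma) maxxx.
rewrite big_ord_recr /=; have := IH (ltnW mk); rewrite /rise !ge_max => /andP[h1 h2].
apply/andP; split.
  rewrite -(subrKA (c (s m)).1); apply: le_trans (ler_normD _ _) _.
  by rewrite [leLHS]addrC lerD2r.
apply: le_trans (dist_triangle hS hsigma _ (c (s m)).2 _) _.
by apply: lerD => //; exact: step.
Qed.

Lemma causal_pair_shift k c1 c1' c2 a b v : causal_pair A sigma k c1 c2 a b ->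
  (forall s, a <= s <= b -> c1' s = c1 s + v) -> causal_pair A sigma k c1' c2 a b.
Proof.
move=> [ab [cc Hl] ae] H; split => //.
  split => // s /Hl[N [K [nN K0 HK]]]; exists N, K; split => // r r' Nr Nr' rab r'ab.
  have [h1 h2] := HK r r' Nr Nr' rab r'ab.
  by rewrite !H // opprD addrACA subrr addr0.
apply: ae_impl ae => s + sab => /(_ sab)[d1 d2 d3 d4].
have Hd : is_derive (s : R^o) 1 (c1' : R^o -> R^o) (derive1 (c1 : R -> R^o) s).
  have h : \forall z \near s, (c1 z + v : R^o) = (c1' z : R^o).
    move: sab; rewrite in_itv /= => /andP[as_ sb]; near=> z; rewrite H //.
    apply/andP; split; apply: ltW; near: z; [exact: lt_nbhsr|exact: lt_nbhsl].
  apply: (@near_eq_is_derive _ _ _ (fun z : R^o => c1 z + v : R^o)) => //.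
  rewrite -[derive1 _ _]addr0; apply: is_deriveD.
  by apply: DeriveDef => //; rewrite -derive1E.
have [dd ddE] := Hd.
by rewrite derive1E ddE.
Unshelve. all: by end_near. Qed.

Lemma null_distance_le p q l : p <> q -> rise p q < l -> (null_distance A' g X t p q <= l%:E)%E.
Proof.
move=> pq; rewrite /rise gt_max => /andP[dl /(dist_lt_causal_pair hS hsigma p.1)].
move=> [c1 [c2 [a [b [cp ca cb c2a c2b]]]]].
move: dl; rewrite ltr_norml => /andP[dl1 dl2].
have [ab llp _] := cp.
pose v := p.1 + (l + (q.1 - p.1)) / 2.
have [s0 /andP[as0 s0b] s0v] : exists2 s, a <= s <= b & c1 s = v.
  by apply: (causal_pair_IVT cp); rewrite ca cb /v; apply/andP; split; lra.
have {}as0 : a < s0.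
  by rewrite lt_neqAle as0 andbT; apply/eqP => as_; move: s0v; rewrite -as_ ca /v; lra.
have {}s0b : s0 < b.
  by rewrite lt_neqAle s0b andbT; apply/eqP => sb_; move: s0v; rewrite sb_ cb /v; lra.
(* v is chosen so that the reflected time component ends at q.1. *)
pose c1' s := v - `|c1 s - v|.
have nd := causal_pair_nondecreasing cp.
have c1a : c1' a = p.1 by rewrite /c1' ca ler0_norm /v; lra.
have c1s : c1' s0 = v by rewrite /c1' s0v subrr normr0 subr0.
have c1b : c1' b = q.1 by rewrite /c1' cb ger0_norm /v; lra.
rewrite /null_distance; case: asboolP => // _.
apply: ereal_inf_lbound.
exists (fun s => (c1' s, c2 s) : R^o * S), a, b, 2%N,
  (fun i => if i is i'.+1 then if i' is 0 then s0 else b else a).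
split; last 1 first.
- rewrite /null_length /time_coord !big_ord_recr big_ord0 /= add0r c1a c1s c1b.
  have n1 : 0 <= v - p.1 by rewrite /v; lra.
  have n2 : q.1 - v <= 0 by rewrite /v; lra.
  by rewrite (ger0_norm n1) (ler0_norm n2) /v; congr EFin; lra.
- split; first by split => // -[|[|]].
    apply/locally_lipschitz_productP; have [cc Hl] := llp; split => // s /Hl[N [K [nN K0 HK]]].
    exists N, K; split => // r r' Nr Nr' rab r'ab; have [h1 h2] := HK r r' Nr Nr' rab r'ab.
    split => //; apply: le_trans h1; rewrite /c1' /=.
    rewrite (_ : v - `|c1 r - v| - _ = `|c1 r' - v| - `|c1 r - v|); last by ring.
    apply: le_trans (ler_dist_dist _ _) _.
    by rewrite opprB addrA subrK distrC.
  move=> [|[|//]] _; rewrite product_metricE /=.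
    left; apply/(future_causalP hsigma _ _ _ ltr01).
    apply: (causal_pair_shift (v := 0) (causal_pair_sub cp (lexx a) as0 (ltW s0b))) => s /andP[as_ ss0].
    rewrite /= /c1' ler0_norm; first by ring.
    by rewrite subr_le0 -s0v nd // ltW.
  right; apply/(past_causalP hsigma _ _ _ ltr01).
  apply: (causal_pair_shift (v := - v - v) (causal_pair_sub cp (ltW as0) s0b (lexx b))) => s /andP[s0s sb].
  rewrite /= /c1' ger0_norm; first by ring.
  by rewrite subr_ge0 -s0v nd // ltW.
- by rewrite c1a c2a -surjective_pairing.
- by rewrite c1b c2b -surjective_pairing.
Qed.

Lemma null_distanceE p q :
  null_distance A' g X t p q = (Num.max `|q.1 - p.1| (d p.2 q.2))%:E.
Proof.
have [->|pq] := pselect (p = q).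
  by rewrite /null_distance asboolT // subrr normr0 (dist_refl hS hsigma) maxxx.
apply/le_anti/andP; split.
  by apply/lee_addgt0Pr => e e0; apply: null_distance_le => //; rewrite ltrDl.
rewrite /null_distance; case: asboolP => // _; apply: le_ereal_inf_tmp => x [c [a [b [k [s [pc ca cb ->]]]]]].
by rewrite lee_fin -ca -cb; exact: piecewise_causal_length pc.
Qed.

Lemma complete_product : complete_metric_space (riemannian_distance A sigma) <->
  complete_metric_space (null_distance A' g X t).
Proof.
have -> : riemannian_distance A sigma = fun p q => (d p q)%:E.
  by apply/funext => p; apply/funext => q; exact: riemannian_dist.
have -> : null_distance A' g X t = fun p q => (rise p q)%:E.
  by apply/funext => p; apply/funext => q; exact: null_distanceE.
have md : is_metric (fun p q => (d p q)%:E).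
  apply: is_metric_EFin; [exact: dist_ge0| |exact: dist_sym|exact: dist_triangle].
  by move=> x y; split=> [|->]; [exact: dist_eq0|exact: dist_refl].
have mr : is_metric (fun p q => (rise p q)%:E).
  apply: is_metric_EFin => [x y|x y|x y|x y z].
  - by rewrite le_max normr_ge0.
  - split=> [|->]; last by rewrite /rise subrr normr0 (dist_refl hS hsigma) maxxx.
    move=> h; have : rise x y <= 0 by rewrite h.
    rewrite /rise ge_max => /andP[]; rewrite normr_le0 subr_eq0 => /eqP h1 h2.
    rewrite (surjective_pairing x) (surjective_pairing y) h1; congr (_, _).
    by apply: (dist_eq0 hS hsigma); apply/le_anti; rewrite h2 dist_ge0.
  - by rewrite /rise distrC (dist_sym hS hsigma).
  - rewrite /rise ge_max; apply/andP; split.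
      rewrite -(subrKA y.1) addrC; apply: le_trans (ler_normD _ _) _.
      by apply: lerD; rewrite le_max lexx.
    apply: le_trans (dist_triangle hS hsigma _ y.2 _) _.
    by apply: lerD; rewrite le_max lexx orbT.
split=> -[_ H]; split => // u cu.
- have [|T HT] := @cauchy_sequence_cvg _ (fun k => (u k).1).
    move=> e /cu[N HN]; exists N => m k Nm Nk; have := HN k m Nk Nm.
    by rewrite lte_fin /rise gt_max => /andP[].
  have [|x Hx] := H (fun k => (u k).2).
    move=> e /cu[N HN]; exists N => m k Nm Nk; have := HN m k Nm Nk.
    by rewrite !lte_fin /rise gt_max => /andP[].
  exists (T, x) => e e0; have [N1 H1] := HT e e0; have [N2 H2] := Hx e e0.
  exists (maxn N1 N2) => m; rewrite geq_max => /andP[/H1 h1 /H2].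
  by rewrite !lte_fin /rise gt_max distrC /= h1.
- have [|[T x] Hx] := H (fun k => (0, u k)).
    move=> e e0; have [N HN] := cu e e0; exists N => m k Nm Nk; have := HN m k Nm Nk.
    by rewrite !lte_fin /rise gt_max /= subrr normr0 e0.
  exists x => e /Hx[N HN]; exists N => m /HN.
  by rewrite !lte_fin /rise gt_max => /andP[].
Qed.

End lorentzian_product.

Theorem theorem1p3 (R : realType) (n : nat) (S : topologicalType)
    (A : atlas 'rV[R]_n S) (sigma : S -> 'rV[R]_n -> 'rV[R]_n -> R)
    (hS : smooth_manifold A) (hsigma : riemannian_metric A sigma) :
  let A' := product_atlas A in
  let g := product_metric sigma in
  let X := @partial_t R 'rV[R]_n S in
  let t := @time_coord R S in
  [/\ spacetime A' g X /\ stably_causal A' g X,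
      time_function A' g X t,
      (heine_borel A sigma <->
         forall p q, compact (causal_diamond A' g X p q)) /\
      (heine_borel A sigma <-> globally_hyperbolic A' g X) &
      (complete_metric_space (riemannian_distance A sigma) <->
         complete_metric_space (null_distance A' g X t))].
Proof.
move=> A' g X t.
have hb : heine_borel A sigma <-> forall p q, compact (causal_diamond A' g X p q).
  split; first by move=> hb p q; exact: causal_diamond_compact.
  exact: heine_borel_of_diamonds.
split; [|exact: time_coord_time_function| |exact: complete_product].
  by split; [exact: product_spacetime|exact: product_stably_causal].
split => //; split=> [/hb ?|[_ /hb //]]; split => //.
by rewrite /g product_metricE; exact: scaled_product_causal.
Qed.
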